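(* Let $k\geq 3$ and $d\geq 3$. Every $(k+d-1,7^k,d)_7$ code and every $(k+d-1,5^k,d)_5$ code is equivalent to a linear code.
   Context: An $(n,M,d)_q$ code is a subset of $\mathcal{A}^n$, where $\mathcal{A}$ is an alphabet of size $q$ (here identified with the field $\mathbb{F}_q$), having $M$ elements and minimum Hamming distance $d$. Two codes of length $n$ are equivalent if one can be obtained from the other by a permutation of the coordinates followed by a permutation of the symbols in each coordinate separately (possibly different permutations in different coordinates). A code is linear if it is an $\mathbb{F}_q$-linear subspace of $\mathbb{F}_q^n$. *)

(* Defs.v *)
From mathcomp Require Import all_boot all_order all_algebra all_fingroup.
Set Implicit Arguments. Unset Strict Implicit. Unset Printing Implicit Defensive.
Import GRing.Theory.
Local Open Scope ring_scope.

Definition hdist (F : finFieldType) (n : nat) (x y : 'rV[F]_n) : nat :=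
  #|[set i : 'I_n | x 0 i != y 0 i]|.

Definition has_min_dist (F : finFieldType) (n : nat) (C : {set 'rV[F]_n}) (d : nat) : Prop :=
  (exists x y, [/\ x \in C, y \in C, x != y & hdist x y = d]) /\
  (forall x y, x \in C -> y \in C -> x != y -> (d <= hdist x y)%N).

Definition is_code (F : finFieldType) (n M d : nat) (C : {set 'rV[F]_n}) : Prop :=
  #|C| = M /\ has_min_dist C d.

Definition linear_code (F : finFieldType) (n : nat) (C : {set 'rV[F]_n}) : Prop :=
  0 \in C /\ (forall (a : F) x y, x \in C -> y \in C -> a *: x + y \in C).

Definition code_equiv (F : finFieldType) (n : nat) (C D : {set 'rV[F]_n}) : Prop :=
  exists (s : 'S_n) (pi : 'I_n -> {perm F}),
    D = [set (\row_j (pi j) (x 0 (s j))) | x : 'rV[F]_n in C].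
Arguments is_code {F} n M d C.

(* Main.v *)
(** Over 5 or 7 symbols, a set of words is MDS of dimension [k] when every [k]
    positions carry each [k]-tuple of symbols exactly once.  Fixing all but two
    (all but three) information symbols of the code leaves MDS sets which,
    restricted to four (five) coordinates, we call planes (cubes).

    A plane splits into the lines on which the last coordinate is constant.  Two
    of its lines amount to a pair of permutations, which up to relabelling is one
    of a short list; completing each pair in every possible way shows that each
    plane is, with a prescribed line sent to the diagonal, one of finitely many
    normal forms.  A second search shows that no cube contains a non-linear normal
    form, and that the labels turning one plane of a cube into a linear plane also
    turn the planes meeting it in a line into linear planes.

    Labels with [l x + m y = t z] on a plane are unique up to affine maps, because
    [f (a + b) = g a + h b] forces [f] to be affine over a prime field.  Walking
    through adjacent planes therefore gives one label per coordinate, for which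
    every parity symbol is affine in any two information symbols; hence its slopes
    are constant, and the relabelled code is affine. *)

Require Import Defs.
From Stdlib Require Import Setoid.
From mathcomp Require Import all_boot all_order all_algebra all_fingroup.
From mathcomp Require Import ring.
Set Implicit Arguments. Unset Strict Implicit. Unset Printing Implicit Defensive.
Import GRing.Theory.

(** * Search procedures *)

(** A plane is a pair of orthogonal Latin squares, and over 7 symbols such pairs need not be linear.
    Linearity therefore has to come from dimension 3: [k >= 3] and [d >= 3] provide the three
    information and two parity symbols of a cube. The obstacle is the number of cubes. A cube
    containing a normal form at [x5 = 0] is tested only through its slices [x1 = 0] and [x2 = v].
    Sending the diagonal to that line ties the relabellings of three coordinates together, so that
    one permutation [tau] describes them all. For a linear form [tau] matters only up to affine
    substitutions; once it fixes 0 and 1, agreement of the labels of two planes means that [tau] is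
    the identity. The searches impose a test on every branch, and the soundness proofs follow the
    one branch that the given plane dictates. The witnesses in the tables are merely checked, so
    their origin needs no proof. *)

(* A plane is stored by its lines: the line [(B, C)] consists of the points
   [(a, B a, C a)].  A normal form [phi] lists the lines 1, ..., q - 1; line 0 is
   the diagonal. *)
Notation tri := (nat * nat * nat)%type.
Notation line := (seq nat * seq nat)%type.
Notation ap := (nth 0).

Definition pm (T : Type) (f : nat) (t : T * T * T) : T * T * T :=
  let: (x, y, z) := t in
  match f with
  | 0 => (x, y, z) | 1 => (x, z, y) | 2 => (y, x, z)
  | 3 => (y, z, x) | 4 => (z, x, y) | _ => (z, y, x)
  end.

Arguments pm : simpl never.

Definition memn (x : nat) (s : seq nat) : bool := has (eqn x) s.
Fixpoint uniqn (s : seq nat) : bool :=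
  if s is x :: s' then ~~ memn x s' && uniqn s' else true.
Definition remn (x : nat) (s : seq nat) : seq nat :=
  filter (fun y => ~~ eqn x y) s.

(** Systems of distinct representatives of [doms] that avoid [used]. *)
Fixpoint sdr (doms : seq (seq nat)) (used : seq nat) : seq (seq nat) :=
  if doms is d :: ds then
    flatten [seq (if memn x used then [::]
                  else [seq x :: s | s <- sdr ds (x :: used)]) | x <- d]
  else [:: [::]].

Notation cell := (nat * nat * seq nat)%type.

Fixpoint shorter (s t : seq nat) : bool :=
  match s, t with
  | _, [::] => false
  | [::], _ :: _ => true
  | _ :: s', _ :: t' => shorter s' t'
  end.

Fixpoint pickmin (best : cell) (cs rest : seq cell) : cell * seq cell :=
  if cs is c :: cs' then
    if shorter c.2 best.2 then pickmin c cs' (best :: rest)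
    else pickmin best cs' (c :: rest)
  else (best, rest).

Definition update (a b c : nat) (cs : seq cell) : seq cell :=
  map (fun d : cell => let: (a', b', s) := d in
    if eqn a a' then (a', b', remn c s)
    else if eqn b b' then (a', b', remn c s) else d) cs.

(* Fills the cells of a Latin square, most constrained cell first, and requires
   [K] of every completion. *)
Fixpoint lsearch (n : nat) (cs : seq cell) (acc : seq tri)
    (K : seq tri -> bool) : bool :=
  if n is n'.+1 then
    if cs is c0 :: cs0 then
      let: ((a, b, s), rest) := pickmin c0 cs0 [::] in
      all (fun c => lsearch n' (update a b c rest) ((a, b, c) :: acc) K) s
    else K acc
  else false.

Fixpoint strike (n : nat) (s : seq bool) : seq bool :=
  match s, n with
  | b :: s', 0 => false :: s'
  | b :: s', n'.+1 => b :: strike n' s'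
  | [::], _ => [::]
  end.

(** Transversals: one cell from each row, no column and no symbol twice. The flags [ub] and [uc]
    mark the columns and symbols still free. *)
Fixpoint trans (rows : seq (seq (nat * nat))) (ub uc : seq bool) :
    seq (seq (nat * nat)) :=
  if rows is r :: rs then
    flatten [seq (if nth false ub p.1 then if nth false uc p.2 then
                    [seq p :: s | s <- trans rs (strike p.1 ub) (strike p.2 uc)]
                  else [::] else [::])
            | p <- r]
  else [:: [::]].

(** A row has at most one cell in each column, so the column alone identifies the cell to be
    removed. *)
Fixpoint drop_line (t : seq (nat * nat)) (rows : seq (seq (nat * nat))) :
    seq (seq (nat * nat)) :=
  match t, rows with
  | p :: t', r :: rs => filter (fun p' => ~~ eqn p.1 p'.1) r :: drop_line t' rs
  | _, _ => [::]
  end.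

(* Splits the remaining cells into [n] parallel lines in every possible way, each
   time through the first remaining cell of the first row. *)
Fixpoint psearch (fr : seq bool) (n : nat) (rows : seq (seq (nat * nat)))
    (ls : seq line) (K : seq line -> bool) : bool :=
  if n is n'.+1 then
    if rows is (p :: _) :: rs then
      all (fun t => psearch fr n' (drop_line t rows) ((unzip1 t, unzip2 t) :: ls) K)
          (trans ([:: p] :: rs) fr fr)
    else false
  else K ls.

Definition on (l : line) (t : tri) : bool :=
  let: (x, y, z) := t in eqn (ap l.1 x) y && eqn (ap l.2 x) z.

(* [m] is the line onto which the diagonal is sent. *)
Definition img (f : nat) (tau : seq nat) (m : line) (t : tri) : tri :=
  let: (x, y, z) := t in
  let: (u, v, w) := pm f (ap tau x, ap tau y, ap tau z) in
  (u, ap m.1 v, ap m.2 w).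

Notation entry := (nat * nat * seq nat)%type.
(** Nested conditionals instead of [&&]: under call-by-value evaluation they stop at the first
    failing test. The same form recurs in the other searches. *)
Definition is_perm (q : nat) (t : seq nat) : bool :=
  if eqn (size t) q then if all (fun x => x < q) t then uniqn t else false else false.

(** * Completions of two lines to a plane *)

Section Rectangles.
Variable q : nat.
Definition idx := iota 0 q.
Definition diag : line := (idx, idx).

Definition points (l : line) : seq tri :=
  [seq (a, ap l.1 a, ap l.2 a) | a <- idx].

Definition sends f tau m (lj l : line) : bool :=
  all (fun t => on l (img f tau m t)) (points lj).

(** [js] names the lines of [Ls] that contain the images of the lines of the form. Being distinct
    and different from [m], the image of the diagonal, they exhaust the plane, so the last symbols
    of the images form a permutation. *)
Definition good_entry (phis : seq (seq line)) (Ls : seq line) (m : nat)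
    (h : entry) : bool :=
  let: (i, f, tau) := h in
  let js := [seq find (sends f tau (nth diag Ls m) lj) Ls
            | lj <- nth [::] phis i] in
  [&& all (fun j => j < size Ls) js, uniqn (m :: js), i < size phis, f < 6
    & is_perm q tau].

(** The cells off the two given lines; a symbol is withheld from a cell if one of these lines
    already uses it in the same row or column. *)
Definition rect_cells (pi sg : seq nat) : seq cell :=
  flatten [seq [seq (a, b,
        [seq c <- idx | [&& ~~ eqn c a, ~~ eqn c b, ~~ eqn c (ap sg a)
          & ~~ has (fun x => eqn (ap pi x) b && eqn (ap sg x) c) idx]])
      | b <- idx & ~~ eqn b a && ~~ eqn b (ap pi a)] | a <- idx].

Definition rows_of (ts : seq tri) : seq (seq (nat * nat)) :=
  [seq [seq (t.1.2, t.2) | t <- ts & eqn t.1.1 a] | a <- idx].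

(** Representatives are taken up to exchanging the two lines, so either may turn out to be the
    prescribed one; hence an entry for each. The fuel exceeds the number of cells, and [lsearch]
    answers [false] when it runs out. *)
Definition check_rect (phis : seq (seq line)) (pi sg : seq nat)
    (e0 e1 : seq entry) : bool :=
  lsearch (q * q).+1 (rect_cells pi sg) [::] (fun ts =>
    psearch (nseq q true) (q - 2) (rows_of ts) [::] (fun ls =>
      let Ls := [:: diag, (pi, sg) & ls] in
      has (good_entry phis Ls 0) e0 && has (good_entry phis Ls 1) e1)).

Definition check_reps phis (stds : seq (seq nat))
    (reps : seq (nat * seq nat * seq entry * seq entry)) : bool :=
  all (fun r => let: (t, sg, e0, e1) := r in
    check_rect phis (nth [::] stds t) sg e0 e1) reps.
End Rectangles.

(** * Pairs of lines up to relabelling *)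

Fixpoint eqs (s t : seq nat) : bool :=
  match s, t with
  | [::], [::] => true
  | x :: s', y :: t' => if eqn x y then eqs s' t' else false
  | _, _ => false
  end.

Definition compt (s t : seq nat) : seq nat := [seq ap s x | x <- t].

Fixpoint orb (n : nat) (x : seq nat) (a b : nat) : seq nat :=
  b :: (if n is n'.+1 then
          let b' := ap x b in if eqn b' a then [::] else orb n' x a b'
        else [::]).

Section RectangleCover.
Variable q : nat.
Let idx := iota 0 q.
Definition invt (t : seq nat) : seq nat := [seq find (eqn y) t | y <- idx].

Definition cycles (x : seq nat) : seq (seq nat) :=
  foldl (fun acc a => if has (memn a) acc then acc else rcons acc (orb q x a a)) [::] idx.
(** Reading the cycles by increasing length gives a permutation that conjugates [x] to the standard
    one of its cycle type, which shifts consecutive blocks cyclically. *)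
Definition cyc_order (x : seq nat) : seq nat :=
  flatten (flatten [seq [seq c <- cycles x | eqn (size c) n] | n <- iota 0 q.+1]).

Definition derangements : seq (seq nat) :=
  sdr [seq remn a idx | a <- idx] [::].
Definition discordant (pi : seq nat) : seq (seq nat) :=
  sdr [seq remn (ap pi a) (remn a idx) | a <- idx] [::].

Variable stds : seq (seq nat).

Definition conjugate_ok (pi : seq nat) : bool :=
  let h := cyc_order pi in
  if is_perm q h then has (fun s => eqs (compt pi h) (compt h s)) stds else false.

(* Permuting the coordinates by [f] and relabelling by [h] turns the diagonal and
   [(pi, sg)] into the diagonal and [(ps, ss)], in this order or, if [m], in the
   opposite one. *)
Definition good_variant (pi sg : seq nat) (m : bool) (f : nat) (h ps ss : seq nat) : bool :=
  let: (A0, A1, A2) := pm f (idx, pi, sg) in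
  if is_perm q h then
    if m then
      let h1 := compt A0 h in
      if eqs (compt A1 (compt h ps)) h1 then eqs (compt A2 (compt h ss)) h1 else false
    else
      let ts := compt (invt A0) h in
      if eqs (compt A0 ts) h then
        if eqs (compt A1 ts) (compt h ps) then eqs (compt A2 ts) (compt h ss)
        else false
      else false
  else false.

Variable reps : seq (nat * seq nat).

(** A recipe for finding witnesses: [h0] conjugates [x] to a standard permutation, and the
    centralizer of the latter is the freedom left for conjugating [z]. Soundness rests on the
    concluding [good_variant] and the lookup in [reps] alone. *)
Definition canon_ok (cents : seq (seq (seq nat))) (pi sg : seq nat) : bool :=
  has (fun m : bool => has (fun f =>
    let: (A0, A1, A2) := pm f (idx, pi, sg) in
    let i0 := invt A0 in
    let x := if m then compt A0 (invt A1) else compt A1 i0 in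
    let z := if m then compt A0 (invt A2) else compt A2 i0 in
    let h0 := cyc_order x in
    let xh := compt x h0 in
    let t := find (fun s => eqs xh (compt h0 s)) stds in
    let z0 := compt (compt (invt h0) z) h0 in
    has (fun c =>
      let ss := compt (compt (invt c) z0) c in
      if has (fun r : nat * seq nat => if eqs r.2 ss then eqn r.1 t else false) reps
      then
        let h := if m then compt (invt A0) (compt h0 c) else compt h0 c in
        good_variant pi sg m f h (nth [::] stds t) ss
      else false)
    (nth [::] cents t)) (iota 0 6)) [:: false; true].

Definition centralizers : seq (seq (seq nat)) :=
  [seq [seq c <- sdr (nseq q idx) [::] | eqs (compt c s) (compt s c)] | s <- stds].

Definition rect_cover : bool :=
  if all conjugate_ok derangements then
    let cents := centralizers in
    all (fun pi => all (canon_ok cents pi) (discordant pi)) stds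
  else false.
End RectangleCover.

(** * Search for cubes through a given plane *)

Section CubeSearch.
Variable q : nat.
Let idx := iota 0 q.
Let diag : line := (idx, idx).

(* The triples grouped by their largest entry, so that a group can be tested as
   soon as the corresponding prefix of the relabelling is known. *)
Definition strata (f : nat) (phi : seq line) : seq (seq tri) :=
  let ts := [seq pm f t | t <- flatten [seq points q l | l <- phi]] in
  [seq [seq t <- ts | eqn (maxn t.1.1 (maxn t.1.2 t.2)) i] | i <- idx].

Definition avoids (T : seq (seq nat)) (tau : seq nat) (t : tri) : bool :=
  let: (x, y, z) := t in
  ~~ eqn (ap (nth [::] T (ap tau x)) (ap tau y)) (ap tau z).

Fixpoint tsearch (T : seq (seq nat)) (tss : seq (seq tri))
    (pre avail : seq nat) : seq (seq nat) :=
  if tss is ts :: tss' then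
    flatten [seq (let pre' := rcons pre x in
      if all (avoids T pre') ts
      then tsearch T tss' pre' (remn x avail) else [::]) | x <- avail]
  else [:: pre].

Variables (phis : seq (seq line)) (nlin : nat).

(* The relabelling of a linear normal form ([i >= nlin]) can be assumed to fix 0
   and 1, by [affine_invariant]. *)
Definition cands (T : seq (seq nat)) (k : nat) : seq (nat * nat * seq nat) :=
  flatten [seq flatten [seq
      (let tss := strata f (nth [::] phis i) in
       [seq (i, f, tau) | tau <-
         if i < nlin then tsearch T tss [::] idx
         else tsearch T (drop 2 tss) [:: 0; 1] (drop 2 idx)])
    | f <- iota 0 6] | i <- iota k (size phis - k)].

Definition plane_lines (m : line) (h : nat * nat * seq nat) : seq (seq tri) :=
  let: (i, f, tau) := h in
  [seq [seq img f tau m t | t <- points q l] | l <- diag :: nth [::] phis i].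

Definition share (v : nat) (L : seq (seq tri)) : seq (nat * nat) :=
  [seq (let t := nth (0, 0, 0) l (find (fun t : tri => eqn t.1.1 v) l) in
        (t.1.2, t.2)) | l <- L].

Definition mismatch (s1 s2 : seq (nat * nat)) : bool :=
  has (fun p1 => has (fun p2 =>
    if eqn p1.1 p2.1 then ~~ eqn p1.2 p2.2 else false) s2) s1.

Definition clash (v : nat) (s1 s2 : seq (nat * nat)) (L1 L2 : seq (seq tri)) : bool :=
  has (fun x => let: (p1, l1) := x in
    let l2 := nth [::] L2 (find (fun p2 : nat * nat => eqn p1.1 p2.1) s2) in
    has (fun t1 : tri => if eqn t1.1.1 v then false else
      has (fun t2 : tri => if eqn t1.1.2 t2.1.2 then eqn t1.2 t2.2 else false) l2) l1)
    (zip s1 L1).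

(* Entry [z] at [(x, y)]: the slice [x1 = 0] of a cube containing [phi0] at
   [x5 = 0] has no word [(x, y, z)] off [x5 = 0], since three of its coordinates
   would agree with a word of [phi0].  The entry [q] means no restriction.
   [table2] is the analogue for the slice [x2 = v]. *)
Definition table1 (phi0 : seq line) : seq (seq nat) :=
  [seq [seq nth q [seq ap l.2 x | l <- phi0]
              (find (fun l : line => eqn (ap l.1 x) y) phi0) | y <- idx] | x <- idx].

Definition cross (v : nat) (M : seq line) : line :=
  ([seq ap l.1 v | l <- M], [seq ap l.2 v | l <- M]).

Definition table2 (v : nat) (M : seq line) : seq (seq nat) :=
  let m2 := cross v M in
  [seq [seq (let x := find (fun x => eqn (ap l.1 x) (ap m2.1 y)) idx in
             if eqn x v then q else find (eqn (ap l.2 x)) m2.2) | y <- idx] | l <- M].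

(* The slices [x1 = 0] and [x2 = v] must agree where they meet ([mismatch]), and
   no other two of their words may agree in three coordinates ([clash]). *)
Definition no_extension (i0 v k : nat) (stop : seq nat -> bool) : bool :=
  let phi0 := nth [::] phis i0 in
  let M := diag :: phi0 in
  let m2 := cross v M in
  let N1 := cands (table1 phi0) k in
  let D2 := [seq (let L := plane_lines m2 h in (share 0 L, L))
            | h <- cands (table2 v M) k] in
  all (fun h1 =>
    let L1 := plane_lines diag h1 in
    let s1 := share v L1 in
    if stop h1.2 then true
    else all (fun d => if mismatch s1 d.1 then true
                       else clash v s1 d.1 L1 d.2) D2) N1.

(* Affine substitutions of the indices permute the lines of a linear plane. *)
Definition affine_table (x y : nat) : seq nat :=
  [seq (x + (q + y - x) * t) %% q | t <- idx].

Definition affine_invariant (phi : seq line) : bool :=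
  all (fun x => all (fun y => if eqn x y then true else
    let a := affine_table x y in
    let js := [seq find (sends q 0 a diag l) phi | l <- phi] in
    if is_perm q a then
      if all (fun j => j < size phi) js then uniqn js else false
    else false) idx) idx.

(** The plane [z = nu * x + (1 - nu) * y] modulo [q], with line [j] given by [y = x - j]; [q - j]
    and [q.+1 - nu] keep the subtractions within [nat]. *)
Definition linear_plane (nu : nat) : seq line :=
  [seq ([seq (x + (q - j)) %% q | x <- idx],
        [seq (nu * x + (q.+1 - nu) * (x + (q - j))) %% q | x <- idx])
  | j <- iota 1 q.-1].

Definition plane_words (phi : seq line) : seq (seq nat) :=
  flatten [seq [seq [:: j; t.1.1; t.1.2; t.2] | t <- points q (nth diag (diag :: phi) j)]
          | j <- idx].

Definition relabel_word (s : seq nat) (g : seq (seq nat)) (w : seq nat) :=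
  [seq ap (nth [::] g i) (ap w (ap s i)) | i <- iota 0 4].

Definition reflag_ok (phi0 phi : seq line) (s : seq nat) (g : seq (seq nat)) : bool :=
  let ws := plane_words phi in
  [&& perm_eq s (iota 0 4), eqn (size g) 4, all (is_perm q) g &
      all (fun w => has (eqs (relabel_word s g w)) ws) (plane_words phi0)].
End CubeSearch.

(** * Tables of normal forms *)

(* The last two normal forms are linear. *)
Definition phis7 : seq (seq line) := [::
 [:: ([::4;3;1;2;0;6;5],[::1;4;3;6;5;2;0]); ([::2;6;4;1;5;0;3],[::4;5;6;0;2;3;1]); ([::1;4;6;5;2;3;0],[::5;2;0;1;3;6;4]); ([::6;0;5;4;3;2;1],[::3;6;4;5;0;1;2]); ([::3;5;0;6;1;4;2],[::2;3;1;4;6;0;5]); ([::5;2;3;0;6;1;4],[::6;0;5;2;1;4;3])];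
 [:: ([::5;0;6;1;2;3;4],[::4;2;3;5;6;1;0]); ([::1;6;0;5;3;4;2],[::2;4;1;6;0;3;5]); ([::6;4;3;2;5;1;0],[::5;6;4;1;2;0;3]); ([::2;3;5;4;6;0;1],[::3;5;0;2;1;6;4]); ([::3;2;4;0;1;6;5],[::6;0;5;4;3;2;1]); ([::4;5;1;6;0;2;3],[::1;3;6;0;5;4;2])];
 [:: ([::3;6;0;4;5;2;1],[::2;3;6;1;0;4;5]); ([::5;0;6;2;3;1;4],[::3;2;4;5;1;6;0]); ([::6;5;4;1;2;3;0],[::5;4;3;2;6;0;1]); ([::4;2;3;0;1;6;5],[::6;0;5;4;3;1;2]); ([::2;4;1;5;6;0;3],[::1;5;0;6;2;3;4]); ([::1;3;5;6;0;4;2],[::4;6;1;0;5;2;3])];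
 [:: ([::1;0;4;5;6;3;2],[::2;5;6;4;1;0;3]); ([::3;2;6;1;5;4;0],[::1;0;5;6;2;3;4]); ([::2;3;5;4;0;6;1],[::4;6;0;1;3;2;5]); ([::4;5;0;6;2;1;3],[::5;3;1;0;6;4;2]); ([::5;6;1;0;3;2;4],[::6;4;3;2;5;1;0]); ([::6;4;3;2;1;0;5],[::3;2;4;5;0;6;1])];
 [:: ([::6;2;0;5;1;3;4],[::1;0;5;6;3;4;2]); ([::2;6;3;4;5;0;1],[::3;4;6;0;2;1;5]); ([::1;0;5;6;3;4;2],[::6;2;0;5;1;3;4]); ([::5;3;4;1;6;2;0],[::4;5;1;2;0;6;3]); ([::3;4;6;0;2;1;5],[::2;6;3;4;5;0;1]); ([::4;5;1;2;0;6;3],[::5;3;4;1;6;2;0])];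
 [:: ([::3;0;6;2;5;4;1],[::6;2;5;1;3;0;4]); ([::1;5;0;4;2;6;3],[::2;4;3;6;0;1;5]); ([::4;3;5;1;6;2;0],[::3;0;6;5;2;4;1]); ([::5;2;3;6;0;1;4],[::1;6;4;0;5;3;2]); ([::6;4;1;5;3;0;2],[::4;5;0;2;1;6;3]); ([::2;6;4;0;1;3;5],[::5;3;1;4;6;2;0])];
 [:: ([::3;6;4;0;5;1;2],[::6;4;1;2;0;3;5]); ([::4;0;1;2;3;6;5],[::3;6;0;4;5;1;2]); ([::2;5;0;4;6;3;1],[::1;3;5;6;2;0;4]); ([::1;4;5;6;2;0;3],[::2;5;6;0;3;4;1]); ([::5;3;6;1;0;2;4],[::4;2;3;5;1;6;0]); ([::6;2;3;5;1;4;0],[::5;0;4;1;6;2;3])];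
 [:: ([::2;3;5;4;6;1;0],[::3;5;6;1;0;2;4]); ([::3;2;0;6;5;4;1],[::6;0;1;4;2;3;5]); ([::1;0;4;5;2;6;3],[::4;3;5;0;6;1;2]); ([::6;4;1;0;3;2;5],[::5;6;0;2;1;4;3]); ([::5;6;3;2;1;0;4],[::1;2;4;5;3;6;0]); ([::4;5;6;1;0;3;2],[::2;4;3;6;5;0;1])];
 [:: ([::5;3;1;0;6;4;2],[::6;4;0;1;2;3;5]); ([::2;4;6;1;0;3;5],[::1;6;4;5;3;0;2]); ([::6;5;4;2;3;1;0],[::3;0;1;6;5;2;4]); ([::4;0;3;6;5;2;1],[::5;2;6;0;1;4;3]); ([::3;2;0;5;1;6;4],[::2;3;5;4;6;1;0]); ([::1;6;5;4;2;0;3],[::4;5;3;2;0;6;1])];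
 [:: ([::6;5;0;1;2;4;3],[::4;0;3;6;5;2;1]); ([::5;6;4;2;1;3;0],[::6;3;1;0;2;4;5]); ([::1;4;5;6;3;0;2],[::5;6;4;2;0;1;3]); ([::2;0;3;4;5;6;1],[::1;2;6;5;3;0;4]); ([::4;3;1;0;6;2;5],[::3;5;0;4;1;6;2]); ([::3;2;6;5;0;1;4],[::2;4;5;1;6;3;0])];
 [:: ([::3;4;6;0;2;1;5],[::1;5;4;2;3;6;0]); ([::4;6;1;5;0;2;3],[::3;2;0;1;6;4;5]); ([::5;2;0;4;6;3;1],[::4;0;5;6;1;2;3]); ([::1;5;4;2;3;6;0],[::2;6;1;5;0;3;4]); ([::2;3;5;6;1;0;4],[::6;4;3;0;5;1;2]); ([::6;0;3;1;5;4;2],[::5;3;6;4;2;0;1])];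
 [:: ([::1;0;6;4;2;3;5],[::6;3;4;5;0;1;2]); ([::4;6;3;1;5;2;0],[::3;0;5;2;1;6;4]); ([::6;4;0;5;3;1;2],[::5;2;1;0;6;4;3]); ([::2;3;5;0;6;4;1],[::1;4;3;6;2;0;5]); ([::3;5;1;2;0;6;4],[::2;6;0;4;5;3;1]); ([::5;2;4;6;1;0;3],[::4;5;6;1;3;2;0])];
 [:: ([::6;3;5;1;0;4;2],[::3;4;0;5;6;2;1]); ([::1;4;3;6;5;2;0],[::2;3;6;0;1;4;5]); ([::3;2;4;0;6;1;5],[::1;0;5;4;2;6;3]); ([::4;6;0;5;2;3;1],[::6;5;1;2;3;0;4]); ([::2;5;6;4;1;0;3],[::5;6;4;1;0;3;2]); ([::5;0;1;2;3;6;4],[::4;2;3;6;5;1;0])];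
 [:: ([::5;4;0;1;6;2;3],[::3;5;6;2;1;4;0]); ([::1;6;3;5;0;4;2],[::5;4;1;6;2;0;3]); ([::6;3;4;2;5;0;1],[::2;6;3;5;0;1;4]); ([::2;0;5;6;3;1;4],[::1;3;4;0;5;6;2]); ([::4;2;6;0;1;3;5],[::6;0;5;4;3;2;1]); ([::3;5;1;4;2;6;0],[::4;2;0;1;6;3;5])];
 [:: ([::5;3;1;0;6;4;2],[::6;4;0;1;2;3;5]); ([::1;6;4;2;0;3;5],[::4;5;1;6;3;0;2]); ([::2;4;5;6;3;1;0],[::1;6;3;0;5;2;4]); ([::4;0;3;5;2;6;1],[::5;2;6;4;0;1;3]); ([::6;5;0;4;1;2;3],[::3;0;5;2;6;4;1]); ([::3;2;6;1;5;0;4],[::2;3;4;5;1;6;0])];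
 [:: ([::3;6;1;2;5;0;4],[::4;3;0;5;1;6;2]); ([::6;0;5;4;2;1;3],[::2;4;6;1;0;3;5]); ([::5;2;3;0;6;4;1],[::3;6;1;2;5;0;4]); ([::4;3;0;5;1;6;2],[::6;0;5;4;2;1;3]); ([::1;5;4;6;3;2;0],[::5;2;3;0;6;4;1]); ([::2;4;6;1;0;3;5],[::1;5;4;6;3;2;0])];
 [:: ([::3;2;4;1;6;0;5],[::6;0;3;5;1;4;2]); ([::4;5;0;6;3;2;1],[::5;3;1;0;2;6;4]); ([::5;3;1;0;2;6;4],[::4;5;0;6;3;2;1]); ([::6;0;3;5;1;4;2],[::3;2;4;1;6;0;5]); ([::1;4;6;2;5;3;0],[::2;6;5;4;0;1;3]); ([::2;6;5;4;0;1;3],[::1;4;6;2;5;3;0])];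
 [:: ([::1;0;3;2;5;6;4],[::2;4;5;6;0;1;3]); ([::2;4;5;1;6;0;3],[::1;6;4;5;2;3;0]); ([::3;5;6;0;1;4;2],[::4;3;0;1;6;2;5]); ([::4;3;0;6;2;1;5],[::5;2;6;4;3;0;1]); ([::5;6;1;4;3;2;0],[::6;5;3;0;1;4;2]); ([::6;2;4;5;0;3;1],[::3;0;1;2;5;6;4])];
 [:: ([::4;5;6;2;0;1;3],[::2;6;4;5;3;0;1]); ([::1;0;3;4;6;2;5],[::3;5;0;6;1;4;2]); ([::5;4;0;6;2;3;1],[::4;3;1;0;6;2;5]); ([::6;3;1;0;5;4;2],[::5;4;6;2;0;1;3]); ([::2;6;5;1;3;0;4],[::1;2;3;4;5;6;0]); ([::3;2;4;5;1;6;0],[::6;0;5;1;2;3;4])];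
 [:: ([::1;2;0;5;3;6;4],[::2;4;3;6;5;0;1]); ([::2;6;4;1;5;0;3],[::6;3;5;4;0;1;2]); ([::4;3;5;2;6;1;0],[::3;0;1;5;2;6;4]); ([::3;5;6;4;0;2;1],[::1;2;4;0;6;3;5]); ([::5;0;3;6;1;4;2],[::4;5;6;1;3;2;0]); ([::6;4;1;0;2;3;5],[::5;6;0;2;1;4;3])];
 [:: ([::3;0;4;1;6;2;5],[::5;6;3;0;1;4;2]); ([::1;5;0;6;2;3;4],[::2;3;1;4;5;6;0]); ([::6;4;1;2;5;0;3],[::3;5;4;6;0;2;1]); ([::4;2;6;5;3;1;0],[::6;0;5;1;2;3;4]); ([::2;3;5;4;0;6;1],[::1;4;6;2;3;0;5]); ([::5;6;3;0;1;4;2],[::4;2;0;5;6;1;3])];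
 [:: ([::6;0;1;2;3;4;5],[::1;2;3;4;5;6;0]); ([::5;6;0;1;2;3;4],[::2;3;4;5;6;0;1]); ([::4;5;6;0;1;2;3],[::3;4;5;6;0;1;2]); ([::3;4;5;6;0;1;2],[::4;5;6;0;1;2;3]); ([::2;3;4;5;6;0;1],[::5;6;0;1;2;3;4]); ([::1;2;3;4;5;6;0],[::6;0;1;2;3;4;5])];
 [:: ([::6;0;1;2;3;4;5],[::2;3;4;5;6;0;1]); ([::5;6;0;1;2;3;4],[::4;5;6;0;1;2;3]); ([::4;5;6;0;1;2;3],[::6;0;1;2;3;4;5]); ([::3;4;5;6;0;1;2],[::1;2;3;4;5;6;0]); ([::2;3;4;5;6;0;1],[::3;4;5;6;0;1;2]); ([::1;2;3;4;5;6;0],[::5;6;0;1;2;3;4])]].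
(* One derangement for each cycle type. *)
Definition stds7 : seq (seq nat) := [:: [::1;0;3;2;5;6;4]; [::1;0;3;4;5;6;2]; [::1;2;0;4;5;6;3]; [::1;2;3;4;5;6;0]].
(* Index of [pi] in [stds7], [sg], and for the completions of this pair of lines
   the normal form, coordinate permutation and relabelling that realise it, with
   the diagonal and with [(pi, sg)] as line 0. *)
Definition reps7 : seq (nat * seq nat * seq entry * seq entry) := [::
 (0, [::2;3;0;1;6;4;5], [::], [::]);
 (0, [::2;3;0;4;6;1;5], [::], [::]);
 (0, [::2;3;1;0;6;4;5], [::], [::]);
 (0, [::2;3;1;4;6;0;5], [::], [::]);
 (0, [::2;3;4;5;6;0;1], [::], [::]);
 (0, [::2;3;4;5;6;1;0], [::], [::]);
 (0, [::2;4;0;5;6;1;3], [::], [::]);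
 (0, [::2;4;0;5;6;3;1], [:: (0,2,[::0;4;5;6;1;2;3]); (0,2,[::4;5;3;1;0;2;6])], [:: (0,2,[::6;5;3;1;0;2;4]); (0,2,[::0;6;5;4;1;2;3])]);
 (0, [::2;4;1;5;6;0;3], [:: (3,2,[::2;3;5;0;4;1;6]); (3,0,[::1;0;4;3;5;2;6]); (14,3,[::0;1;4;2;3;5;6]); (8,3,[::0;1;4;2;3;5;6]); (8,5,[::3;2;5;1;0;4;6])], [:: (3,2,[::6;3;0;1;2;5;4]); (3,0,[::5;1;2;3;0;6;4]); (14,3,[::1;5;2;6;3;0;4]); (8,4,[::1;5;2;3;0;6;4]); (8,1,[::3;6;0;1;2;5;4])]);
 (0, [::2;4;1;5;6;3;0], [::], [::]);
 (0, [::2;4;1;6;0;3;5], [::], [::]);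
 (0, [::2;4;5;6;0;1;3], [:: (17,0,[::0;1;2;3;4;5;6])], [:: (18,0,[::0;3;4;5;1;2;6])]);
 (0, [::2;4;5;6;0;3;1], [:: (5,0,[::4;1;3;0;5;2;6]); (7,2,[::1;5;2;6;0;4;3]); (7,0,[::0;6;2;5;1;4;3]); (5,2,[::4;0;3;1;6;2;5]); (10,4,[::4;5;0;2;6;1;3]); (10,1,[::4;6;1;2;5;0;3])], [:: (7,0,[::2;6;0;4;3;5;1]); (5,2,[::5;2;1;3;6;0;4]); (5,0,[::5;3;1;2;4;0;6]); (7,2,[::3;4;0;6;2;5;1]); (10,4,[::5;4;2;0;6;3;1]); (10,1,[::5;6;3;0;4;2;1])]);
 (0, [::2;4;5;6;1;0;3], [:: (1,0,[::0;5;6;1;4;3;2]); (2,0,[::3;5;1;4;0;6;2])], [:: (2,0,[::1;5;3;6;2;4;0]); (1,0,[::0;5;6;2;1;4;3])]);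
 (0, [::2;4;5;6;1;3;0], [::], [::]);
 (0, [::2;4;6;5;0;1;3], [:: (13,1,[::3;5;4;0;6;2;1]); (7,0,[::3;5;1;0;4;2;6]); (3,4,[::2;4;0;1;6;5;3]); (8,3,[::4;2;0;1;6;5;3]); (8,0,[::2;0;4;6;5;1;3]); (3,2,[::5;1;6;2;4;0;3]); (8,5,[::1;5;6;0;2;4;3]); (11,2,[::2;4;6;0;5;3;1]); (7,0,[::0;1;3;4;2;5;6]); (12,2,[::5;1;6;3;4;2;0]); (11,1,[::1;2;0;4;5;6;3])], [:: (11,1,[::3;0;2;6;5;4;1]); (7,0,[::2;3;1;6;0;5;4]); (3,2,[::5;3;4;0;6;2;1]); (8,0,[::0;2;6;4;5;3;1]); (8,3,[::6;0;2;3;4;5;1]); (3,4,[::0;6;2;3;4;5;1]); (8,5,[::3;5;4;2;0;6;1]); (12,2,[::5;3;4;1;6;0;2]); (7,0,[::1;5;3;2;6;0;4]); (11,2,[::0;6;4;2;5;1;3]); (13,1,[::1;5;6;2;4;0;3])]);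
 (0, [::2;4;6;5;1;3;0], [::], [::]);
 (2, [::2;0;3;1;6;4;5], [::], [::]);
 (2, [::2;3;4;5;6;0;1], [:: (19,0,[::0;1;2;4;3;5;6]); (20,0,[::2;1;5;0;6;4;3])], [:: (20,0,[::0;1;4;2;3;5;6]); (19,0,[::0;5;3;2;1;4;6])]);
 (2, [::2;3;4;5;6;1;0], [:: (13,1,[::2;0;4;1;5;6;3])], [:: (10,1,[::5;0;3;6;2;1;4])]);
 (2, [::2;3;5;0;6;4;1], [:: (1,2,[::2;4;1;3;6;0;5])], [:: (0,0,[::6;0;5;1;4;3;2])]);
 (2, [::3;5;4;1;6;0;2], [:: (0,2,[::5;0;6;4;1;2;3]); (2,0,[::0;2;4;3;6;1;5])], [:: (2,0,[::1;2;6;3;4;0;5]); (0,2,[::5;1;4;6;0;2;3])]);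
 (1, [::2;3;1;0;6;4;5], [::], [::]);
 (1, [::2;3;1;5;6;0;4], [::], [::]);
 (1, [::2;3;4;0;6;1;5], [:: (6,0,[::0;2;1;4;5;3;6])], [:: (7,0,[::4;6;5;3;1;0;2])]);
 (1, [::2;3;4;1;6;0;5], [::], [::]);
 (1, [::2;3;4;5;6;0;1], [::], [::]);
 (1, [::2;3;4;5;6;1;0], [::], [::]);
 (1, [::2;3;4;6;0;1;5], [:: (10,0,[::1;6;5;3;0;4;2])], [:: (12,0,[::3;0;6;1;4;5;2])]);
 (1, [::2;3;5;0;6;1;4], [:: (4,0,[::0;6;5;4;1;2;3]); (2,0,[::5;2;3;4;6;0;1]); (4,0,[::0;1;3;6;5;4;2])], [:: (3,0,[::6;4;3;5;0;1;2]); (0,2,[::6;3;4;5;1;2;0]); (3,1,[::0;1;5;3;6;4;2])]);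
 (1, [::2;3;5;6;0;1;4], [:: (5,0,[::2;6;4;3;1;0;5]); (6,0,[::0;6;3;1;4;5;2])], [:: (6,0,[::0;2;6;5;3;4;1]); (5,0,[::5;6;3;4;0;1;2])]);
 (1, [::2;4;0;5;6;1;3], [::], [::]);
 (1, [::2;4;0;6;3;1;5], [:: (10,0,[::2;6;4;5;1;0;3]); (12,1,[::0;1;4;2;3;5;6]); (2,0,[::6;0;5;2;3;4;1]); (0,2,[::3;2;5;1;6;0;4]); (10,1,[::1;5;3;6;2;0;4]); (12,0,[::0;2;3;1;4;6;5])], [:: (12,0,[::0;2;6;1;5;3;4]); (10,1,[::1;4;6;3;2;0;5]); (0,2,[::6;2;4;1;3;0;5]); (2,0,[::3;0;4;2;6;5;1]); (12,1,[::0;1;5;2;6;4;3]); (10,0,[::2;3;5;4;1;0;6])]);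
 (1, [::2;4;1;5;6;0;3], [:: (11,2,[::0;1;5;2;6;3;4]); (10,2,[::0;4;2;1;3;5;6])], [:: (10,2,[::1;5;2;0;6;4;3]); (11,2,[::1;0;4;2;3;6;5])]);
 (1, [::2;4;1;6;0;3;5], [:: (18,3,[::2;5;6;0;3;4;1]); (18,0,[::4;2;6;3;1;0;5])], [:: (18,0,[::2;4;5;3;1;0;6]); (18,3,[::4;6;5;0;3;2;1])]);
 (1, [::2;4;1;6;3;0;5], [:: (11,4,[::4;1;0;5;2;3;6]); (18,2,[::1;0;3;2;6;4;5]); (10,4,[::5;3;4;0;6;1;2]); (18,5,[::6;3;4;1;2;0;5])], [:: (10,4,[::4;6;5;1;3;0;2]); (18,5,[::3;6;5;0;2;1;4]); (11,4,[::5;0;1;4;2;6;3]); (18,2,[::0;1;6;2;3;5;4])]);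
 (3, [::2;0;4;1;6;3;5], [::], [::]);
 (3, [::2;0;4;5;6;1;3], [:: (7,4,[::0;5;3;6;1;4;2]); (2,2,[::2;0;1;4;6;3;5]); (20,0,[::1;2;0;4;6;3;5]); (7,2,[::0;4;6;3;2;5;1])], [:: (5,4,[::0;5;1;2;6;4;3]); (2,2,[::5;6;2;0;4;3;1]); (20,0,[::2;5;6;0;4;3;1]); (5,2,[::1;2;0;5;6;3;4])]);
 (3, [::2;0;5;1;6;4;3], [:: (20,0,[::5;2;3;0;6;1;4]); (9,0,[::1;2;6;4;3;0;5]); (9,0,[::1;6;4;3;5;2;0]); (9,0,[::5;3;2;4;6;1;0]); (9,1,[::0;3;6;1;2;4;5]); (9,1,[::0;1;2;5;4;6;3]); (9,1,[::3;2;6;0;4;5;1]); (20,2,[::1;4;3;6;0;5;2]); (20,1,[::0;6;3;5;2;4;1])], [:: (20,0,[::3;6;2;5;4;1;0]); (8,3,[::3;6;2;5;1;0;4]); (8,4,[::6;2;3;5;1;0;4]); (8,0,[::2;3;6;5;1;0;4]); (8,1,[::6;3;2;0;4;5;1]); (8,5,[::2;6;3;0;4;5;1]); (8,2,[::3;2;6;0;4;5;1]); (20,2,[::2;6;3;0;1;4;5]); (20,1,[::3;2;6;0;1;4;5])]);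
 (3, [::2;3;4;5;6;0;1], [:: (3,2,[::2;5;1;4;3;0;6]); (3,4,[::3;0;4;1;2;5;6]); (15,0,[::0;1;3;5;4;2;6]); (20,0,[::3;6;1;2;5;4;0]); (3,2,[::0;3;6;2;1;5;4]); (3,4,[::1;5;2;6;0;3;4]); (15,1,[::0;5;1;4;6;3;2]); (3,4,[::4;1;5;2;3;6;0]); (3,2,[::3;6;2;5;4;1;0]); (3,2,[::5;1;4;0;6;3;2]); (3,4,[::6;3;0;4;5;1;2]); (20,0,[::0;3;5;6;2;1;4]); (20,0,[::4;0;2;3;6;5;1]); (20,0,[::1;4;6;0;3;2;5]); (21,2,[::0;1;2;3;4;5;6]); (20,0,[::6;2;4;5;1;0;3]); (3,4,[::2;6;3;0;1;4;5]); (3,2,[::6;2;5;1;0;4;3]); (3,2,[::1;4;0;3;2;6;5]); (3,4,[::0;4;1;5;6;2;3]); (20,0,[::2;5;0;1;4;3;6]); (20,0,[::5;1;3;4;0;6;2]); (3,4,[::5;2;6;3;4;0;1]); (3,2,[::4;0;3;6;5;2;1])], [:: (3,4,[::1;4;0;3;2;6;5]); (3,2,[::2;6;3;0;1;4;5]); (15,1,[::0;2;6;3;1;4;5]); (20,0,[::5;2;0;6;3;4;1]); (3,4,[::6;2;5;1;0;4;3]); (3,2,[::0;4;1;5;6;2;3]); (15,0,[::0;6;4;2;3;5;1]); (3,2,[::3;0;4;1;2;5;6]); (3,4,[::2;5;1;4;3;0;6]); (3,4,[::4;0;3;6;5;2;1]); (3,2,[::5;2;6;3;4;0;1]); (20,0,[::2;6;4;3;0;1;5]);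 (20,0,[::6;3;1;0;4;5;2]); (20,0,[::3;0;5;4;1;2;6]); (21,2,[::0;1;2;3;4;5;6]); (20,0,[::1;5;3;2;6;0;4]); (3,2,[::1;5;2;6;0;3;4]); (3,4,[::5;1;4;0;6;3;2]); (3,4,[::0;3;6;2;1;5;4]); (3,2,[::6;3;0;4;5;1;2]); (20,0,[::4;1;6;5;2;3;0]); (20,0,[::0;4;2;1;5;6;3]); (3,2,[::4;1;5;2;3;6;0]); (3,4,[::3;6;2;5;4;1;0])]);
 (3, [::2;3;5;6;0;1;4], [:: (12,3,[::3;6;4;0;2;1;5]); (12,2,[::0;1;2;3;4;6;5]); (12,5,[::1;6;5;3;4;0;2]); (11,4,[::4;5;2;3;6;1;0]); (5,1,[::6;0;2;5;3;4;1]); (5,0,[::6;2;0;5;1;4;3]); (5,1,[::1;4;3;5;6;2;0]); (5,0,[::1;3;4;5;0;2;6]); (11,5,[::2;5;4;0;1;6;3]); (12,4,[::6;1;5;0;2;3;4])], [:: (12,3,[::0;4;6;3;1;2;5]); (12,2,[::3;2;1;0;6;4;5]); (11,5,[::1;5;6;3;2;4;0]); (12,4,[::4;2;5;3;1;0;6]); (5,1,[::2;6;0;5;4;1;3]); (5,0,[::2;0;6;5;3;1;4]); (5,1,[::4;3;1;5;0;6;2]); (5,0,[::4;1;3;5;2;6;0]); (12,5,[::2;4;5;0;6;3;1]); (11,4,[::6;5;1;0;4;2;3])]);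
 (3, [::2;3;6;5;1;0;4], [::], [::]);
 (3, [::2;4;5;0;6;1;3], [:: (12,4,[::6;3;1;4;0;5;2]); (13,4,[::3;6;2;1;4;0;5])], [:: (13,4,[::2;0;1;6;3;5;4]); (12,4,[::0;3;5;2;6;1;4])]);
 (3, [::2;5;6;1;0;4;3], [:: (7,5,[::5;6;4;0;3;1;2]); (7,1,[::2;5;1;0;4;3;6]); (7,2,[::6;2;3;0;1;4;5]); (5,3,[::4;3;1;2;6;0;5]); (5,4,[::3;1;4;5;2;0;6]); (5,0,[::1;4;3;6;5;0;2])], [:: (5,5,[::0;6;4;5;2;3;1]); (5,1,[::6;4;0;1;5;3;2]); (5,2,[::4;0;6;2;1;3;5]); (7,3,[::1;2;0;3;6;4;5]); (7,4,[::5;1;4;3;0;6;2]); (7,0,[::2;5;6;3;4;0;1])]);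
 (3, [::3;4;5;6;0;1;2], [:: (18,1,[::5;3;2;4;6;1;0]); (11,5,[::4;1;2;6;5;0;3]); (11,2,[::0;2;6;1;4;5;3]); (18,5,[::2;1;4;5;6;0;3]); (18,2,[::3;6;4;1;5;2;0]); (15,1,[::0;1;3;5;4;2;6]); (11,1,[::6;0;2;3;1;5;4]); (18,1,[::6;4;3;5;0;2;1]); (11,1,[::1;2;4;5;3;0;6]); (15,1,[::0;6;4;2;3;5;1]); (11,1,[::3;4;6;0;5;2;1]); (18,2,[::5;1;6;3;0;4;2]); (11,2,[::4;6;3;5;1;2;0]); (18,5,[::1;0;3;4;5;6;2]); (11,5,[::3;0;1;5;4;6;2]); (11,5,[::2;6;0;4;3;5;1]); (11,2,[::1;3;0;2;5;6;4]); (18,5,[::5;4;0;1;2;3;6]); (18,2,[::0;3;1;5;2;6;4]); (18,1,[::4;2;1;3;5;0;6]); (16,0,[::0;3;1;5;6;2;4]); (11,1,[::4;5;0;1;6;3;2]); (18,2,[::6;2;0;4;1;5;3]); (18,5,[::3;2;5;6;0;1;4]); (18,2,[::1;4;2;6;3;0;5]); (18,1,[::2;0;6;1;3;5;4]); (22,1,[::0;1;2;3;4;5;6]); (11,2,[::2;4;1;3;6;0;5]); (11,5,[::1;5;6;3;2;4;0]); (11,2,[::5;0;4;6;2;3;1]); (11,1,[::5;6;1;2;0;4;3]); (11,5,[::0;4;5;2;1;3;6]); (18,1,[::1;6;5;0;2;4;3]); (18,5,[::6;5;1;2;3;4;0]); (18,1,[::3;1;0;2;4;6;5]); (11,5,[::6;3;4;1;0;2;5]);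 (11,2,[::6;1;5;0;3;4;2]); (18,2,[::2;5;3;0;4;1;6]); (18,1,[::0;5;4;6;1;3;2]); (18,5,[::0;6;2;3;4;5;1]); (11,5,[::5;2;3;0;6;1;4]); (18,5,[::4;3;6;0;1;2;5]); (11,2,[::3;5;2;4;0;1;6]); (18,2,[::4;0;5;2;6;3;1]); (11,1,[::0;1;3;4;2;6;5]); (15,1,[::0;2;6;3;1;4;5]); (11,1,[::2;3;5;6;4;1;0])], [:: (18,1,[::1;3;4;2;0;5;6]); (11,5,[::3;6;5;1;2;0;4]); (11,2,[::0;5;1;6;3;2;4]); (18,5,[::4;5;2;1;0;6;3]); (18,2,[::1;5;0;3;6;2;4]); (16,0,[::0;1;5;4;2;3;6]); (11,1,[::3;2;0;6;1;4;5]); (18,1,[::2;4;5;3;1;6;0]); (11,1,[::5;4;2;1;3;6;0]); (15,1,[::0;5;1;4;6;3;2]); (11,1,[::0;6;4;3;5;1;2]); (18,2,[::3;0;2;5;1;4;6]); (11,2,[::4;2;5;3;0;6;1]); (18,5,[::3;4;1;0;6;5;2]); (11,5,[::2;5;4;0;1;6;3]); (11,5,[::1;4;3;6;0;5;2]); (11,2,[::1;6;2;0;4;3;5]); (18,5,[::0;1;5;4;3;2;6]); (18,2,[::5;2;4;0;3;6;1]); (18,1,[::0;2;3;1;6;4;5]); (15,1,[::0;6;4;2;3;5;1]); (11,1,[::1;0;5;4;6;2;3]); (18,2,[::4;1;3;6;2;5;0]); (18,5,[::5;6;3;2;1;0;4]); (18,2,[::6;3;5;1;4;0;2]); (18,1,[::5;0;1;6;4;2;3]);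 (22,1,[::0;1;2;3;4;5;6]); (11,2,[::2;0;3;1;5;4;6]); (11,5,[::0;3;2;5;6;4;1]); (11,2,[::5;3;6;4;1;0;2]); (11,1,[::2;1;6;5;0;3;4]); (11,5,[::6;2;1;4;5;3;0]); (18,1,[::4;6;0;5;3;1;2]); (18,5,[::1;2;6;5;4;3;0]); (18,1,[::6;1;2;0;5;3;4]); (11,5,[::5;1;0;3;4;2;6]); (11,2,[::6;4;0;5;2;1;3]); (18,2,[::0;4;6;2;5;1;3]); (18,1,[::3;5;6;4;2;0;1]); (18,5,[::2;3;0;6;5;4;1]); (11,5,[::4;0;6;2;3;1;5]); (18,5,[::6;0;4;3;2;1;5]); (11,2,[::3;1;4;2;6;5;0]); (18,2,[::2;6;1;4;0;3;5]); (11,1,[::4;3;1;0;2;5;6]); (15,1,[::0;1;3;5;4;2;6]); (11,1,[::6;5;3;2;4;0;1])])].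
(* The non-linear normal forms are, up to the choice of line 0 and of the order of
   the coordinates, those with index 0, 8, 14, 17 and 19.  Entry [i] carries the
   last of these up to [i] to normal form [i]; the entries of these five are
   dummies. *)
Definition reflags7 : seq (seq nat * seq (seq nat)) := [::
 ([::], [::]);
 ([::0;2;1;3], [:: [::1;2;0;3;4;5;6]; [::0;4;5;6;3;1;2]; [::5;2;3;4;1;0;6]; [::4;6;1;0;5;2;3]]);
 ([::0;2;1;3], [:: [::1;2;3;0;4;5;6]; [::0;3;5;6;4;1;2]; [::3;4;2;1;5;6;0]; [::2;1;4;5;0;3;6]]);
 ([::2;0;1;3], [:: [::0;4;5;6;1;2;3]; [::0;1;3;2;4;5;6]; [::0;4;5;6;1;3;2]; [::0;5;6;3;2;1;4]]);
 ([::2;0;1;3], [:: [::1;4;5;6;2;0;3]; [::0;1;2;4;3;5;6]; [::6;5;3;4;2;0;1]; [::1;4;2;5;3;0;6]]);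
 ([::1;0;2;3], [:: [::0;4;5;6;1;2;3]; [::4;5;3;0;6;1;2]; [::4;0;3;1;5;2;6]; [::4;5;1;6;3;0;2]]);
 ([::1;0;2;3], [:: [::1;4;5;6;0;2;3]; [::0;3;4;5;6;1;2]; [::3;1;5;6;0;4;2]; [::6;2;4;5;0;3;1]]);
 ([::1;0;2;3], [:: [::1;4;5;6;2;0;3]; [::0;1;2;4;5;3;6]; [::2;6;5;4;3;0;1]; [::3;5;1;2;6;0;4]]);
 ([::], [::]);
 ([::0;2;3;1], [:: [::1;2;3;4;0;5;6]; [::0;1;2;3;4;5;6]; [::6;5;0;1;2;4;3]; [::4;0;3;6;5;2;1]]);
 ([::2;0;3;1], [:: [::0;1;4;2;3;5;6]; [::0;3;4;5;1;2;6]; [::0;3;1;4;5;2;6]; [::0;1;2;3;4;6;5]]);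
 ([::2;0;3;1], [:: [::1;0;4;2;3;5;6]; [::0;1;3;2;4;5;6]; [::1;0;2;4;6;3;5]; [::6;0;1;3;5;2;4]]);
 ([::3;0;1;2], [:: [::2;5;0;3;1;6;4]; [::0;6;4;5;2;1;3]; [::1;2;0;3;6;5;4]; [::2;5;0;1;3;4;6]]);
 ([::2;0;3;1], [:: [::1;2;5;3;4;0;6]; [::0;3;4;5;1;2;6]; [::5;1;4;6;2;0;3]; [::3;5;6;2;1;0;4]]);
 ([::], [::]);
 ([::1;0;2;3], [:: [::0;1;4;2;3;5;6]; [::0;1;3;4;5;2;6]; [::0;3;4;6;5;1;2]; [::0;4;6;2;3;5;1]]);
 ([::1;0;2;3], [:: [::1;2;5;3;4;6;0]; [::0;1;2;3;4;5;6]; [::3;4;1;5;6;2;0]; [::6;5;2;4;3;1;0]]);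
 ([::], [::]);
 ([::0;1;2;3], [:: [::1;0;2;3;4;5;6]; [::0;4;5;1;2;3;6]; [::4;0;1;5;6;2;3]; [::2;3;0;6;4;5;1]]);
 ([::], [::]);
 ([::0;1;2;3], [:: [::1;0;2;3;4;5;6]; [::0;1;3;2;4;5;6]; [::3;0;1;4;6;2;5]; [::5;6;0;3;1;4;2]])].

(** Permuting the coordinates of [z = nu * x + (1 - nu) * y] changes [nu] through [1 - nu] and
    [nu / (nu - 1)]. Modulo 5 the values other than 0 and 1 form one orbit; modulo 7 they form two,
    {2, 4, 6} and {3, 5}. This accounts for one linear form here and two over 7 symbols. *)
Definition phis5 : seq (seq line) := [:: linear_plane 5 2].
Definition stds5 : seq (seq nat) := [:: [::1;0;3;4;2]; [::1;2;3;4;0]].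
Definition reps5 : seq (nat * seq nat * seq entry * seq entry) := [::
 (0, [::2;3;4;0;1], [::], [::]); (1, [::2;0;4;1;3], [::], [::]);
 (1, [::2;3;4;0;1], [:: (0,2,[::0;1;2;3;4])], [:: (0,2,[::0;1;2;3;4])])].

(** * Permutations stored as tables *)

Lemma eqn_eqE (x y : nat) : eqn x y = (x == y). Proof. by []. Qed.

Lemma memnE x s : memn x s = (x \in s).
Proof. by elim: s => //= y s ->; rewrite in_cons. Qed.

Lemma uniqnE s : uniqn s = uniq s.
Proof. by elim: s => //= y s ->; rewrite memnE. Qed.

Lemma eqsE s t : eqs s t = (s == t).
Proof.
elim: s t => [|x s IHs] [|y t] //=; rewrite IHs eqseq_cons eqn_eqE.
by case: eqP.
Qed.

Lemma mem_remn x y s : (y \in remn x s) = (y != x) && (y \in s).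
Proof. by rewrite mem_filter eqn_eqE eq_sym. Qed.

Lemma is_permP q t : reflect (perm_eq t (iota 0 q)) (is_perm q t).
Proof.
apply: (iffP idP).
  rewrite /is_perm eqn_eqE; case: eqP => // st; case: allP => // lt_t.
  rewrite uniqnE => Ut; apply: uniq_perm => //; first exact: iota_uniq.
  have sub : {subset t <= iota 0 q} by move=> x /lt_t; rewrite mem_iota.
  by have [|_] := uniq_min_size Ut sub; rewrite // size_iota st.
move=> pt; rewrite /is_perm eqn_eqE (perm_size pt) size_iota eqxx uniqnE.
rewrite (perm_uniq pt) iota_uniq ifT //; apply/allP => x.
by rewrite (perm_mem pt) mem_iota.
Qed.

Section PermTable.
Variables (q : nat) (t : seq nat).
Hypothesis pt : is_perm q t.

Lemma perm_tab_size : size t = q.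
Proof. by move/is_permP/perm_size: pt; rewrite size_iota. Qed.
Lemma perm_tab_uniq : uniq t.
Proof. by move/is_permP/perm_uniq: pt; rewrite iota_uniq. Qed.
Lemma mem_perm_tab x : (x \in t) = (x < q).
Proof. by move/is_permP/perm_mem: pt => ->; rewrite mem_iota. Qed.
Lemma perm_tab_lt x : x < q -> ap t x < q.
Proof. by move=> xq; rewrite -mem_perm_tab mem_nth // perm_tab_size. Qed.
Lemma perm_tab_inj x y : x < q -> y < q -> ap t x = ap t y -> x = y.
Proof.
move=> xq yq /eqP; rewrite nth_uniq ?perm_tab_size //; first by move/eqP.
exact: perm_tab_uniq.
Qed.
Lemma perm_tab_index x : x < q -> ap t (index x t) = x.
Proof. by move=> xq; rewrite nth_index ?mem_perm_tab. Qed.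
Lemma perm_tab_index_lt x : x < q -> index x t < q.
Proof. by move=> xq; rewrite -[X in _ < X]perm_tab_size index_mem mem_perm_tab. Qed.
Lemma perm_tab_indexK x : x < q -> index (ap t x) t = x.
Proof. by move=> xq; rewrite index_uniq ?perm_tab_size // perm_tab_uniq. Qed.
End PermTable.

Lemma is_perm_idx q : is_perm q (iota 0 q).
Proof. exact/is_permP. Qed.

Lemma ap_iota q x : x < q -> ap (iota 0 q) x = x.
Proof. by move=> xq; rewrite nth_iota. Qed.

Lemma ap_compt s t x : x < size t -> ap (compt s t) x = ap s (ap t x).
Proof. by move=> xt; rewrite (nth_map 0). Qed.

Lemma is_perm_tab q t : size t = q -> (forall x, x < q -> ap t x < q) ->
  (forall x y, x < q -> y < q -> ap t x = ap t y -> x = y) -> is_perm q t.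
Proof.
move=> st lt_t inj_t; rewrite /is_perm eqn_eqE st eqxx uniqnE.
rewrite ifT; last by apply/(all_nthP 0) => i; rewrite st => /lt_t.
by apply/(uniqP 0) => i j; rewrite !inE st => iq jq; apply: inj_t.
Qed.

Lemma is_perm_compt q s t : is_perm q s -> is_perm q t -> is_perm q (compt s t).
Proof.
move=> ps pt; have st := perm_tab_size pt.
apply: is_perm_tab => [|x xq|x y xq yq]; first by rewrite size_map.
  by rewrite ap_compt ?st // !perm_tab_lt.
rewrite !ap_compt ?st // => /(perm_tab_inj ps) eq_t.
by apply: (perm_tab_inj pt) => //; apply: eq_t; apply: perm_tab_lt.
Qed.

Lemma ap_invt q t x : x < q -> ap (invt q t) x = index x t.
Proof.
move=> xq; rewrite (nth_map 0) ?size_iota // nth_iota // add0n.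
by apply: eq_find => y /=; rewrite eqn_eqE eq_sym.
Qed.

Lemma is_perm_invt q t : is_perm q t -> is_perm q (invt q t).
Proof.
move=> pt; apply: is_perm_tab => [|x xq|x y xq yq]; first by rewrite size_map size_iota.
  by rewrite ap_invt // perm_tab_index_lt.
rewrite !ap_invt // => e.
by rewrite -(perm_tab_index pt xq) e (perm_tab_index pt yq).
Qed.

(** * Codes meeting the Singleton bound *)

(** Words are lists of numbers, so that the tables of the searches apply directly and fixing a
    symbol is removing a head. *)
Definition mds (q n k : nat) (X : seq nat -> Prop) : Prop :=
  [/\ forall w, X w -> (size w == n) && all (fun a => a < q) w,
      forall I w v, uniq I -> size I = k -> all (fun i => i < n) I ->
        X w -> X v -> {in I, forall i, ap w i = ap v i} -> w = v
    & forall I f, uniq I -> size I = k -> all (fun i => i < n) I ->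
        (forall i, f i < q) -> exists2 w, X w & {in I, forall i, ap w i = f i}].

Definition wact n (s : seq nat) (g : seq (seq nat)) (w : seq nat) : seq nat :=
  [seq ap (nth [::] g i) (ap w (ap s i)) | i <- iota 0 n].

Definition bounded n q (w : seq nat) := (size w == n) && all (fun a => a < q) w.

Definition act_ok q n (s : seq nat) (g : seq (seq nat)) : bool :=
  is_perm n s && all (is_perm q) g && (size g == n).

(** The preimage of [X] under [wact]. Boundedness has to be imposed: the default values of [ap]
    would let in words of wrong length or with symbols out of range. *)
Definition twist n q s g (X : seq nat -> Prop) (w : seq nat) : Prop :=
  bounded n q w /\ X (wact n s g w).

Lemma ap_act n s g w i : i < n -> ap (wact n s g w) i = ap (nth [::] g i) (ap w (ap s i)).
Proof. by move=> ltin; rewrite (nth_map 0) ?size_iota // nth_iota. Qed.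

Lemma boundedP n q w : bounded n q w -> size w = n /\ (forall i, i < n -> ap w i < q).
Proof.
case/andP=> /eqP sw /allP lw; split=> // i lin.
by apply: lw; rewrite mem_nth ?sw.
Qed.

Lemma boundedI n q w : size w = n -> (forall i, i < n -> ap w i < q) -> bounded n q w.
Proof.
move=> sw lw; rewrite /bounded sw eqxx /=; apply/(all_nthP 0) => i.
by rewrite sw; apply: lw.
Qed.

Lemma wact_surj n q s g u : act_ok q n s g -> bounded n q u ->
  exists2 w, bounded n q w & wact n s g w = u.
Proof.
case/andP=> /andP[ps /allP pg] /eqP sg bu; have [su lu] := boundedP bu.
have pgi i : i < n -> is_perm q (nth [::] g i).
  by move=> lin; apply: pg; rewrite mem_nth ?sg.
pose w := mkseq (fun i => index (ap u (index i s)) (nth [::] g (index i s))) n.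
have aw i : i < n -> ap w i = index (ap u (index i s)) (nth [::] g (index i s)).
  by move=> li; rewrite nth_mkseq.
exists w.
  apply: boundedI => [|i li]; rewrite ?size_mkseq // aw //.
  have lj := perm_tab_index_lt ps li.
  by apply: (perm_tab_index_lt (pgi _ lj)); apply: lu.
apply: (@eq_from_nth _ 0) => [|j]; rewrite size_map size_iota ?su // => lj.
rewrite ap_act // aw ?(perm_tab_lt ps lj) // (perm_tab_indexK ps lj).
by rewrite (perm_tab_index (pgi _ lj)) // lu.
Qed.

Lemma mds_twist q n k s g X :
  act_ok q n s g -> mds q n k X -> mds q n k (twist n q s g X).
Proof.
move=> ok [bX uX eX]; have /andP[/andP[ps /allP pg] /eqP sg] := ok.
have pgi i : i < n -> is_perm q (nth [::] g i).
  by move=> lin; apply: pg; rewrite mem_nth ?sg.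
(* The image of [w] under [wact] shows the symbol of position [i] at position [index i s]. *)
pose J (I : seq nat) := [seq index i s | i <- I].
have JP I : uniq I -> all (fun i => i < n) I ->
    [/\ uniq (J I), size (J I) = size I & all (fun i => i < n) (J I)].
  move=> UI /allP lI; split; rewrite ?size_map //.
    rewrite map_inj_in_uniq // => i j /lI li /lI lj e.
    by rewrite -(perm_tab_index ps li) e (perm_tab_index ps lj).
  by rewrite all_map; apply/allP => i /lI /= li; apply: perm_tab_index_lt.
split=> [w [] //|I w v UI sI lI [bw Xw] [bv Xv] eqwv|I f UI sI lI lf].
  have [UJ sJ lJ] := JP I UI lI; rewrite -sI -sJ in uX.
  have [sw lw] := boundedP bw; have [sv lv] := boundedP bv.
  have /(congr1 (fun u => ap u)) e : wact n s g w = wact n s g v.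
    apply: (uX (J I)) => // _ /mapP[i Ii ->]; have li := allP lI i Ii.
    by rewrite !ap_act ?(perm_tab_index_lt ps li) // (perm_tab_index ps li) eqwv.
  apply: (@eq_from_nth _ 0); rewrite ?sw ?sv // => i li.
  have lj := perm_tab_index_lt ps li.
  have := congr1 (fun u => u (index i s)) e; rewrite /= !ap_act // (perm_tab_index ps li).
  by apply: (perm_tab_inj (pgi _ lj)); rewrite ?lw ?lv.
have [UJ sJ lJ] := JP I UI lI.
have q0 : 0 < q by apply: leq_ltn_trans (lf 0).
pose f' j := ap (nth [::] g j) (f (ap s j)).
have [j|u Xu eu] := eX (J I) f' UJ (etrans sJ sI) lJ.
  have [lj|lj] := ltnP j n; first exact: (perm_tab_lt (pgi _ lj)).
  (* [f'] must be bounded at every index; beyond [n] it reads an empty table and takes the default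
     value 0. *)
  by rewrite /f' (nth_default _ (_ : size g <= j)) ?sg // nth_nil.
have [w bw wE] := wact_surj ok (bX u Xu); have [_ lw] := boundedP bw.
exists w; first by split=> //; rewrite wE.
move=> i Ii; have li := allP lI i Ii; have lj := perm_tab_index_lt ps li.
have: ap u (index i s) = f' (index i s) by apply: eu; apply: map_f.
rewrite -wE ap_act // /f' (perm_tab_index ps li); apply: (perm_tab_inj (pgi _ lj)) => //.
exact: lw.
Qed.

Lemma mds_slice q n k X a : a < q -> mds q n.+1 k.+1 X -> mds q n k (fun w => X (a :: w)).
Proof.
move=> aq [bX uX eX]; split=> [w /bX /=/andP[sw /andP[_ lw]]|I w v UI sI lI Xw Xv eqwv|].
- by rewrite -eqSS sw.
- suff [] : a :: w = a :: v by [].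
  apply: (uX (0 :: [seq i.+1 | i <- I])) => //=.
  + rewrite (map_inj_uniq succn_inj) UI andbT; by apply/mapP => -[].
  + by rewrite size_map sI.
  + by rewrite all_map.
  move=> i; rewrite in_cons => /predU1P[->|/mapP[j Ij ->]] //=.
  exact: eqwv.
move=> I f UI sI lI lf.
have [] := eX (0 :: [seq i.+1 | i <- I]) (fun i => if i is j.+1 then f j else a).
- rewrite /= (map_inj_uniq succn_inj) UI andbT; by apply/mapP => -[].
- by rewrite /= size_map sI.
- by rewrite /= all_map.
- by case.
move=> [|b w] Xw ew; first by have := bX _ Xw.
exists w; first by have /= <- := ew 0 (mem_head _ _).
by move=> i Ii; apply: (ew i.+1); rewrite in_cons map_f // orbT.
Qed.

(** * Normal forms of planes *)

Lemma finite_choice (T : Type) (d : T) n (R : nat -> T -> Prop) :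
  (forall i, i < n -> exists x, R i x) ->
  exists2 s, size s = n & forall i, i < n -> R i (nth d s i).
Proof.
elim: n => [|n IHn] exR; first by exists [::].
have [i lin|s sn Rs] := IHn; first by apply: exR; rewrite ltnW.
have [x Rx] := exR n (ltnSn n).
exists (rcons s x) => [|i]; first by rewrite size_rcons sn.
rewrite ltnS nth_rcons sn leq_eqVlt => /predU1P[->|lin]; first by rewrite ltnn eqxx.
by rewrite lin; apply: Rs.
Qed.

Section Plane.
Variables (q : nat) (P : seq nat -> Prop).
Hypothesis mdsP : mds q 4 2 P.

Lemma plane_uniq w v i j : i < 4 -> j < 4 -> i != j -> P w -> P v ->
  ap w i = ap v i -> ap w j = ap v j -> w = v.
Proof.
move=> li lj ij Pw Pv ei ej; case: mdsP => _ uP _.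
apply: (uP [:: i; j]) => //=; rewrite ?inE ?ij ?li ?lj //.
by move=> k; rewrite !inE => /pred2P[]->.
Qed.

Lemma plane_word w : P w -> exists x y z e, w = [:: x; y; z; e] /\
  [&& x < q, y < q, z < q & e < q].
Proof.
case: mdsP => bP _ _ /bP/andP[/eqP].
case: w => [|x [|y [|z [|e []]]]] //= _; rewrite andbT => lw.
by exists x, y, z, e.
Qed.

Lemma plane_lt x y z e : P [:: x; y; z; e] -> [/\ x < q, y < q, z < q & e < q].
Proof. by case/plane_word=> ? [? [? [? [[-> -> -> ->] /and4P[]]]]]. Qed.

Lemma plane_ex01 x y : x < q -> y < q -> exists z e, P [:: x; y; z; e].
Proof.
move=> xq yq; case: mdsP => _ _ eP.
have [i|w Pw ew] := eP [:: 0; 1] (fun i => if i is 0 then x else y) isT erefl isT.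
  by case: i.
have [x' [y' [z [e [dw _]]]]] := plane_word Pw; rewrite dw in Pw ew.
exists z, e; have /= <- := ew 0 isT; have /= <- := ew 1 isT; exact: Pw.
Qed.

Lemma plane_ex03 x e : x < q -> e < q -> exists y z, P [:: x; y; z; e].
Proof.
move=> xq yq; case: mdsP => _ _ eP.
have [i|w Pw ew] := eP [:: 0; 3] (fun i => if i is 0 then x else e) isT erefl isT.
  by case: i.
have [x' [y [z [e' [dw _]]]]] := plane_word Pw; rewrite dw in Pw ew.
exists y, z; have /= <- := ew 0 isT; have /= <- := ew 3 isT; exact: Pw.
Qed.

Lemma uniq01 x y z e z' e' :
  P [:: x; y; z; e] -> P [:: x; y; z'; e'] -> z = z' /\ e = e'.
Proof. by move=> p p'; case: (plane_uniq (i := 0) (j := 1) isT isT isT p p' erefl erefl). Qed.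
Lemma uniq02 x z y e y' e' :
  P [:: x; y; z; e] -> P [:: x; y'; z; e'] -> y = y' /\ e = e'.
Proof. by move=> p p'; case: (plane_uniq (i := 0) (j := 2) isT isT isT p p' erefl erefl). Qed.
Lemma uniq12 y z x e x' e' :
  P [:: x; y; z; e] -> P [:: x'; y; z; e'] -> x = x' /\ e = e'.
Proof. by move=> p p'; case: (plane_uniq (i := 1) (j := 2) isT isT isT p p' erefl erefl). Qed.
Lemma uniq03 x e y z y' z' :
  P [:: x; y; z; e] -> P [:: x; y'; z'; e] -> y = y' /\ z = z'.
Proof. by move=> p p'; case: (plane_uniq (i := 0) (j := 3) isT isT isT p p' erefl erefl). Qed.
Lemma uniq13 y e x z x' z' :
  P [:: x; y; z; e] -> P [:: x'; y; z'; e] -> x = x' /\ z = z'.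
Proof. by move=> p p'; case: (plane_uniq (i := 1) (j := 3) isT isT isT p p' erefl erefl). Qed.
Lemma uniq23 z e x y x' y' :
  P [:: x; y; z; e] -> P [:: x'; y'; z; e] -> x = x' /\ y = y'.
Proof. by move=> p p'; case: (plane_uniq (i := 2) (j := 3) isT isT isT p p' erefl erefl). Qed.

Lemma line_table e : e < q -> exists2 t : seq (nat * nat), size t = q &
  forall a, a < q -> P [:: a; (nth (0, 0) t a).1; (nth (0, 0) t a).2; e].
Proof.
move=> eq; apply: (@finite_choice _ (0, 0) q
  (fun a p => P [:: a; p.1; p.2; e])) => a aq.
by have [y [z p]] := plane_ex03 aq eq; exists (y, z).
Qed.

Lemma perm_pickmin best cs rest (r := pickmin best cs rest) :
  perm_eq (r.1 :: r.2) (best :: cs ++ rest).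
Proof.
rewrite {}/r; elim: cs best rest => [|c cs IHcs] best rest //=.
case: ifP => _; rewrite (permPl (IHcs _ _)).
  by rewrite -cat_cons -(cat1s best rest) perm_catCA.
by rewrite perm_cons -(cat1s c rest) perm_catCA.
Qed.

(** The branch to follow gives each cell (a, b) the symbol that [P] puts there. Striking this symbol
    from the other cells of the row and column loses nothing, because two coordinates determine a
    word of [P]. *)
Lemma lsearch_sound n cs acc K :
  lsearch n cs acc K -> uniq [seq c.1 | c <- cs] ->
  (forall a b s, (a, b, s) \in cs -> [/\ a < q, b < q &
     forall c e, P [:: a; b; c; e] -> c \in s]) ->
  (forall a b c, (a, b, c) \in acc -> exists e, P [:: a; b; c; e]) ->
  exists ts, [/\ K ts,
    forall a b c, (a, b, c) \in ts -> exists e, P [:: a; b; c; e],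
    forall a b s, (a, b, s) \in cs -> exists c, (a, b, c) \in ts,
    {subset acc <= ts}
  & forall a b c, (a, b, c) \in ts -> (a, b, c) \in acc \/
      (a, b) \in [seq c.1 | c <- cs]].
Proof.
elim: n cs acc => //= n IHn [|c0 cs0] acc.
  by move=> Kacc _ _ accP; exists acc; split=> // a b c; left.
case: (pickmin _ _ _) (perm_pickmin c0 cs0 [::]) => [[[a b] s] rest].
rewrite cats0 /=; set cs := c0 :: cs0 => pcs srch Ucs csP accP.
have /andP[nab Urest] : uniq ((a, b) :: [seq c.1 | c <- rest]).
  by rewrite (perm_uniq (perm_map fst pcs : perm_eq (_ :: _) _)).
have inrest d : d \in rest -> d \in cs.
  by move=> dr; rewrite -(perm_mem pcs) in_cons dr orbT.
have /csP[aq bq sP] : (a, b, s) \in cs by rewrite -(perm_mem pcs) mem_head.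
have [c [e p]] := plane_ex01 aq bq.
have keys c' : [seq d.1 | d <- update a b c' rest] = [seq d.1 | d <- rest].
  by rewrite -map_comp; apply: eq_map => -[[a' b'] s'] /=; do 2?case: ifP.
have /IHn[|||ts [Kts tsP tsC accts tsN]] := allP srch c (sP _ _ p).
- by rewrite keys.
- move=> a' b' s' /mapP[[[a1 b1] s1] din] /=.
  have [a1q b1q s1P] := csP _ _ _ (inrest _ din).
  have ne1 : (a1, b1) <> (a, b).
    by move=> e1; case/negP: nab; rewrite -e1; apply/mapP; exists (a1, b1, s1).
  case: ifP => [/eqP ea [-> -> ->]|_]; last case: ifP => [/eqP eb [-> -> ->]|_ [-> -> ->]] //.
    subst a1; split=> // c' e' p'; rewrite mem_remn (s1P _ _ p') andbT.
    apply/eqP => ec; subst c'; have [e1 _] := uniq02 p p'.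
    by apply: ne1; rewrite e1.
  subst b1; split=> // c' e' p'; rewrite mem_remn (s1P _ _ p') andbT.
  apply/eqP => ec; subst c'; have [e1 _] := uniq12 p p'.
  by apply: ne1; rewrite e1.
- move=> a' b' c'; rewrite in_cons => /predU1P[[-> -> ->]|/accP //].
  by exists e.
exists ts; split=> // [a' b' s'|t tacc|a' b' c' /tsN].
- rewrite -(perm_mem pcs) in_cons => /predU1P[[-> -> _]|din].
    by exists c; apply: accts; rewrite mem_head.
  have: (a', b') \in [seq d.1 | d <- update a b c rest].
    by rewrite keys; apply/mapP; exists (a', b', s').
  by case/mapP=> [[[a1 b1] s1] d1 /= [-> ->]]; apply: tsC d1.
- by apply: accts; rewrite in_cons tacc orbT.
rewrite -(perm_mem (perm_map fst pcs : perm_eq (_ :: _) _)) /= !in_cons keys.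
case=> [/predU1P[[-> -> _]|->]|->]; [by right; rewrite eqxx | by left|].
by right; rewrite orbT.
Qed.

Lemma nth_strike n s m : nth false (strike n s) m = (m != n) && nth false s m.
Proof.
elim: s n m => [|b s IHs] [|n] [|m] //=; rewrite ?nth_nil ?andbF //.
by rewrite IHs eqSS.
Qed.

Lemma mem_trans rows ub uc t : size t = size rows ->
  (forall i, i < size rows -> nth (0, 0) t i \in nth [::] rows i) ->
  uniq (unzip1 t) -> uniq (unzip2 t) ->
  (forall p, p \in t -> nth false ub p.1 && nth false uc p.2) ->
  t \in trans rows ub uc.
Proof.
elim: rows t ub uc => [|r rows IHr] [|p t] ub uc //= [st] tP.
case/andP=> n1 U1 /andP[n2 U2] fr.
apply/flattenP; exists [seq p :: s | s <- trans rows (strike p.1 ub) (strike p.2 uc)].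
  apply/mapP; exists p; first exact: (tP 0).
  by have /andP[-> ->] := fr p (mem_head _ _).
apply: map_f; apply: IHr => // [i li|p' p't]; first exact: (tP i.+1).
rewrite !nth_strike; have /andP[-> ->] : nth false ub p'.1 && nth false uc p'.2.
  by apply: fr; rewrite in_cons p't orbT.
rewrite !andbT; apply/andP; split.
  by apply: contra n1 => /eqP <-; apply: map_f.
by apply: contra n2 => /eqP <-; apply: map_f.
Qed.

Lemma drop_lineP t rows : size t = size rows -> size (drop_line t rows) = size rows /\
  forall i, i < size rows -> nth [::] (drop_line t rows) i =
    [seq p' <- nth [::] rows i | (nth (0, 0) t i).1 != p'.1].
Proof.
elim: t rows => [|p t IHt] [|r rows] //= [/IHt[st tP]].
by split=> [|[|i] li] //=; rewrite ?st //; apply: tP.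
Qed.

Definition lines_ok (ls : seq line) (es : seq nat) : Prop :=
  size ls = size es /\ forall i a, i < size ls -> a < q ->
    P [:: a; ap (nth ([::], [::]) ls i).1 a; ap (nth ([::], [::]) ls i).2 a; ap es i].

(** [Es] holds the last symbols of the lines still to be found, [es] those of the lines in [ls]. The
    line of [P] through the first remaining cell is a transversal of the remaining rows, hence one
    of the branches. *)
Lemma psearch_sound n rows ls K Es es : 0 < q ->
  psearch (nseq q true) n rows ls K -> size rows = q ->
  size Es = n -> uniq (Es ++ es) -> all (fun e => e < q) Es -> lines_ok ls es ->
  (forall a e b c, a < q -> e \in Es -> P [:: a; b; c; e] -> (b, c) \in nth [::] rows a) ->
  (forall a b c, a < q -> (b, c) \in nth [::] rows a ->
     exists2 e, e \in Es & P [:: a; b; c; e]) ->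
  exists ls' es', [/\ K ls', lines_ok ls' es' & perm_eq es' (Es ++ es)].
Proof.
move=> q0; elim: n rows ls Es es => [|n IHn] rows ls Es es /=.
  by move=> Kls _ /size0nil-> _ _ lok _ _; exists ls, es; split.
case: rows => [|[|p r0] rs] // srch srows sEs UEs /allP ltE lok rA rB.
have [e eE p0] : exists2 e, e \in Es & P [:: 0; p.1; p.2; e].
  by apply: rB => //=; rewrite -surjective_pairing mem_head.
have eq := ltE _ eE; have [t st tP] := line_table eq.
have t0 : nth (0, 0) t 0 = p.
  have [e1 e2] := uniq03 p0 (tP 0 q0).
  by rewrite [RHS]surjective_pairing e1 e2 -surjective_pairing.
have Ut1 : uniq (unzip1 t).
  apply/(uniqP 0) => i j; rewrite !inE size_map st => iq jq.
  rewrite !(nth_map (0, 0)) ?st // => eb; have := tP i iq; rewrite eb => pi.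
  by have [] := uniq13 pi (tP j jq).
have Ut2 : uniq (unzip2 t).
  apply/(uniqP 0) => i j; rewrite !inE size_map st => iq jq.
  rewrite !(nth_map (0, 0)) ?st // => eb; have := tP i iq; rewrite eb => pi.
  by have [] := uniq23 pi (tP j jq).
have tin : t \in trans ([:: p] :: rs) (nseq q true) (nseq q true).
  apply: mem_trans => // [|[|i] /= li|p' /(nthP (0, 0))[i]]; rewrite ?st //.
  - by rewrite t0 mem_head.
  - have iq : i.+1 < q by rewrite -srows.
    have := rA _ _ _ _ iq eE (tP _ iq); by rewrite /= -surjective_pairing.
  move=> iq <-; have [_ l1 l2 _] := plane_lt (tP i iq).
  by rewrite !nth_nseq l1 l2.
set rows := (p :: r0) :: rs in srch srows rA rB.
have [sd dP] := drop_lineP (etrans st (esym srows)).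
have Ue : uniq Es by case/and3P: (etrans (esym (cat_uniq _ _)) UEs).
have /IHn IH := allP srch t tin.
have pE : perm_eq (rem e Es ++ e :: es) (Es ++ es).
  rewrite -cat1s perm_catCA cat1s -cat_cons perm_cat2r perm_sym.
  exact: perm_to_rem.
have [|||||a e' b c aq|a b c aq|ls' [es' [Kls lok' pes]]] := IH (rem e Es) (e :: es).
- by rewrite sd.
- by rewrite size_rem // sEs.
- by rewrite (perm_uniq pE).
- by apply/allP => e' /mem_rem/ltE.
- case: lok => sl lok; split=> [|[|i] a]; rewrite /= ?sl //; last by rewrite ltnS -sl; apply: lok.
  move=> _ aq; by have := tP a aq; rewrite !(nth_map (0, 0)) ?st.
- rewrite mem_rem_uniq // inE => /andP[ne eE'] pa; rewrite dP ?srows //.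
  rewrite mem_filter (rA _ _ _ _ aq eE' pa) andbT /=.
  apply: contra ne => /eqP eb; have := tP a aq; rewrite eb => pa'.
  by have [_ ->] := uniq01 pa pa'.
- rewrite dP ?srows // mem_filter => /andP[/= nb bc].
  have [e' eE' pa] := rB _ _ _ aq bc; exists e' => //.
  rewrite mem_rem_uniq // inE eE' andbT; apply: contra nb => /eqP ee.
  subst e'; by have [-> _] := uniq03 (tP a aq) pa.
exists ls', es'; split=> //; exact: perm_trans pes pE.
Qed.

End Plane.

(** * Soundness of the completion of two lines *)

Definition wd (t : tri) (e : nat) : seq nat := [:: t.1.1; t.1.2; t.2; e].

(** The lines of a form determine [P] only up to the names of the last symbols; [d] supplies
    these. *)
Definition realizes q (P : seq nat -> Prop) (phi : seq line) f tau (m : line) (d : seq nat) :=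
  [/\ is_perm q tau, is_perm q d
    & forall j t, j < q -> t \in points q (nth (diag q) (diag q :: phi) j) ->
        P (wd (img f tau m t) (ap d j))].

Definition full_phis q (phis : seq (seq line)) :=
  all (fun p => (size p == q.-1) && all (fun l => is_perm q l.1 && is_perm q l.2) p) phis.

Lemma pm_diag T f (x : T) : pm f (x, x, x) = (x, x, x).
Proof. by case: f => [|[|[|[|[|f]]]]]. Qed.

Lemma pm_map T U f (h : T -> U) x y z :
  pm f (h x, h y, h z) = (let: (u, v, w) := pm f (x, y, z) in (h u, h v, h w)).
Proof. by case: f => [|[|[|[|[|f]]]]]. Qed.

Section CheckRect.
Variables (q : nat) (P : seq nat -> Prop) (phis : seq (seq line)).
Hypotheses (mdsP : mds q 4 2 P) (q1 : 1 < q) (full : full_phis q phis).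
Let q0 : 0 < q := ltnW q1.

Lemma good_entry_sound Ls es m h : good_entry q phis Ls m h -> m < q ->
  size Ls = q -> uniq es -> all (fun e => e < q) es -> lines_ok q P Ls es ->
  exists i f tau d, [/\ i < size phis, f < 6,
    realizes q P (nth [::] phis i) f tau (nth (diag q) Ls m) d & ap d 0 = ap es m].
Proof.
case: h => [[i f] tau] /=; set js := map _ _.
rewrite -/(uniqn (m :: js)) uniqnE.
case/and5P=> /allP ltj Ujs li lf ptau mq sL Ues /allP lte [sles lok].
have ses : size es = q by rewrite -sles.
have sphi : size (nth [::] phis i) = q.-1 by apply/eqP; have /andP[] := allP full _ (mem_nth [::] li).
have sjs : size js = q.-1 by rewrite size_map.
(* Line [j] of the form lies on the line of [Ls] with index [nth 0 (m :: js) j] and inherits its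
   last symbol. *)
pose d := [seq ap es j | j <- m :: js].
have sd : size d = q by rewrite size_map /= sjs prednK.
have lmjs k : k < q -> nth 0 (m :: js) k < q.
  case: k => [|k] //= kq; rewrite -sL; apply: ltj; rewrite mem_nth // sjs.
  by rewrite -ltnS prednK.
have ad k : k < q -> ap d k = ap es (nth 0 (m :: js) k).
  by move=> kq; rewrite (nth_map 0) //= sjs prednK.
have pd : is_perm q d.
  apply: is_perm_tab => // [x xq|x y xq yq].
    by rewrite ad //; apply: lte; rewrite mem_nth // ses lmjs.
  rewrite !ad // => /eqP; rewrite nth_uniq ?ses ?lmjs // nth_uniq //= ?sjs ?prednK //.
  by move/eqP.
exists i, f, tau, d; split=> //; split=> // j t jq.
rewrite ad //; case: j jq => [|j] jq /=.
  case/mapP=> a; rewrite mem_iota => aq ->.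
  rewrite /img /wd /= !ap_iota // pm_diag /=.
  have := lok m (ap tau a); rewrite sL mq (perm_tab_lt ptau aq).
  by rewrite (set_nth_default (diag q)) ?sL //; apply.
have lj : j < size (nth [::] phis i) by rewrite sphi -ltnS prednK.
rewrite /js (nth_map (diag q)) // => tin.
set lj' := nth _ _ j in tin *; set k := find _ _.
have hk : has (sends q f tau (nth (diag q) Ls m) lj') Ls.
  by rewrite has_find; apply: ltj; apply: map_f; rewrite mem_nth.
have kL : k < size Ls by rewrite -has_find.
have /allP/(_ _ tin) := nth_find (diag q) hk; rewrite -/k.
case: t tin => [[x y] z] _ /=; case: (pm _ _) (pm_map f (ap tau) x y z) => [[u v] w].
case: (pm f (x, y, z)) => [[u' v'] w'] [-> -> ->] /andP[/eqP e1 /eqP e2].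
have uq : ap tau u' < q.
  have [lu|lu] := ltnP u' q; first exact: perm_tab_lt.
  by rewrite nth_default // (perm_tab_size ptau).
by have := lok k _ kL uq; rewrite (set_nth_default (diag q)) // e1 e2.
Qed.

Lemma check_rect_sound pi sg ent0 ent1 E0 E1 :
  check_rect q phis pi sg ent0 ent1 ->
  size pi = q -> size sg = q -> E0 < q -> E1 < q -> E0 != E1 ->
  (forall t, t < q -> P [:: t; t; t; E0]) ->
  (forall t, t < q -> P [:: t; ap pi t; ap sg t; E1]) ->
  (exists i f tau d, [/\ i < size phis, f < 6,
    realizes q P (nth [::] phis i) f tau (diag q) d & ap d 0 = E0]) /\
  (exists i f tau d, [/\ i < size phis, f < 6,
    realizes q P (nth [::] phis i) f tau (pi, sg) d & ap d 0 = E1]).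
Proof.
move=> chk spi ssg E0q E1q nE P0 P1.
have keys : [seq c.1 | c <- rect_cells q pi sg] =
    [seq (a, b) | a <- idx q, b <- [seq b <- idx q | ~~ eqn b a && ~~ eqn b (ap pi a)]].
  rewrite /rect_cells map_flatten -map_comp; congr flatten.
  by apply: eq_map => a /=; rewrite -map_comp.
have keyP a b : ((a, b) \in [seq c.1 | c <- rect_cells q pi sg]) =
    [&& a < q, b < q, b != a & b != ap pi a].
  rewrite keys; apply/allpairsPdep/and4P => [[a' [b' [aD]]]|[aq bq n1 n2]].
    rewrite mem_filter !mem_iota in aD * => /andP[/andP[n1 n2] bD] [-> ->].
    by split.
  exists a, b; rewrite mem_filter !mem_iota aq bq !eqn_eqE n1 n2; split=> //.
have [] := lsearch_sound mdsP chk.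
- rewrite keys; apply: allpairs_uniq_dep => [|a _|[a b] [a' b'] _ _ /= [-> ->]] //.
    exact: iota_uniq.
  by rewrite filter_uniq // iota_uniq.
- move=> a b s abs.
  have: (a, b) \in [seq c.1 | c <- rect_cells q pi sg] by apply/mapP; exists (a, b, s).
  rewrite keyP => /and4P[aq bq nba nbp]; split=> // c e p.
  case/flattenP: abs => _ /mapP[a' _ ->] /mapP[b' _ [<- <- ->]].
  have [_ _ cq _] := plane_lt mdsP p.
  rewrite mem_filter mem_iota /= add0n cq andbT !eqn_eqE; apply/and4P; split.
  + apply: contra nba => /eqP ec; subst c.
    by have [->] := uniq02 mdsP p (P0 a aq).
  + apply: contra nba => /eqP ec; subst c.
    by have [->] := uniq12 mdsP p (P0 b bq).
  + apply: contra nbp => /eqP ec; subst c.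
    by have [->] := uniq02 mdsP p (P1 a aq).
  apply/hasPn => x; rewrite mem_iota => xq; apply/negP => /andP[/eqP eb /eqP ec].
  have := P1 x xq; rewrite eb ec => px; have [ax _] := uniq12 mdsP p px.
  by case/negP: nbp; rewrite ax eb.
- by [].
move=> ts [Kts tsP tsC _ tsN].
have {}tsN a b c : (a, b, c) \in ts -> [&& a < q, b < q, b != a & b != ap pi a].
  by case/tsN => //; rewrite keyP.
have {}tsC a b : [&& a < q, b < q, b != a & b != ap pi a] -> exists c, (a, b, c) \in ts.
  by rewrite -keyP => /mapP[[[a' b'] s] /tsC[c cin] [-> ->]]; exists c.
pose Es := [seq e <- idx q | (e != E0) && (e != E1)].
have EsP e : (e \in Es) = [&& e != E0, e != E1 & e < q].
  by rewrite mem_filter mem_iota /= add0n andbA.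
have UEs : uniq Es by rewrite filter_uniq ?iota_uniq.
have pEs : perm_eq [:: E0, E1 & Es] (iota 0 q).
  apply: uniq_perm => /=; rewrite ?iota_uniq //.
    by rewrite UEs !inE !EsP (negbTE nE) !eqxx /= andbF.
  move=> e; rewrite !inE EsP mem_iota /=.
  case: eqP => [->|_] //=; case: eqP => [->|_] //=.
have sEs : size Es = q - 2.
  by have := perm_size pEs; rewrite size_iota /= => <-; rewrite !subSS subn0.
have rowP a b c : a < q ->
    ((b, c) \in nth [::] (rows_of q ts) a) = ((a, b, c) \in ts).
  move=> aq; rewrite (nth_map 0) ?size_iota // nth_iota // add0n.
  apply/mapP/idP => [[[[a' b'] c']]|tin].
    by rewrite mem_filter eqn_eqE => /andP[/= /eqP-> tin] [-> ->].
  by exists (a, b, c) => //; rewrite mem_filter eqn_eqE /= eqxx.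
have [] := psearch_sound mdsP q0 Kts (Es := Es) (es := [::]).
- by rewrite size_map size_iota.
- exact: sEs.
- by rewrite cats0.
- by apply/allP => e; rewrite EsP => /and3P[].
- by split.
- move=> a e b c aq; rewrite EsP => /and3P[n0 n1 eq] p; rewrite rowP //.
  have [_ bq cq _] := plane_lt mdsP p.
  have [c' cin] : exists c', (a, b, c') \in ts.
    apply: tsC; rewrite aq bq /=; apply/andP; split.
      apply: contra n0 => /eqP eb; subst b.
      by have [_ ->] := uniq01 mdsP p (P0 a aq).
    apply: contra n1 => /eqP eb; subst b.
    by have [_ ->] := uniq01 mdsP p (P1 a aq).
  have [e' p'] := tsP _ _ _ cin.
  by have [-> _] := uniq01 mdsP p p'.
- move=> a b c aq; rewrite rowP // => tin; have [e p] := tsP _ _ _ tin.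
  have /and4P[_ _ n0 n1] := tsN _ _ _ tin; have [_ _ _ eq] := plane_lt mdsP p.
  exists e => //; rewrite EsP eq andbT; apply/andP; split.
    apply: contra n0 => /eqP ee; subst e.
    by have [->] := uniq03 mdsP p (P0 a aq).
  apply: contra n1 => /eqP ee; subst e.
  by have [->] := uniq03 mdsP p (P1 a aq).
move=> ls [es [/andP[h0 h1] [sles lok]]]; rewrite cats0 => pes.
have pes2 : perm_eq [:: E0, E1 & es] (iota 0 q).
  by rewrite (permPl (_ : perm_eq _ [:: E0, E1 & Es])) // !perm_cons.
have ses : size [:: E0, E1 & es] = q by rewrite (perm_size pes2) size_iota.
have Ues : uniq [:: E0, E1 & es] by rewrite (perm_uniq pes2) iota_uniq.
have ltes : all (fun e => e < q) [:: E0, E1 & es].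
  by apply/allP => e; rewrite (perm_mem pes2) mem_iota.
have lok2 : lines_ok q P [:: diag q, (pi, sg) & ls] [:: E0, E1 & es].
  split=> [|[|[|i]] a]; rewrite /= ?sles // => li aq.
  - by rewrite !ap_iota //; apply: P0.
  - exact: P1.
  by apply: lok => //; rewrite sles.
have sL : size [:: diag q, (pi, sg) & ls] = q by rewrite (proj1 lok2).
split.
  case/hasP: h0 => h _ /good_entry_sound.
  by move/(_ [:: E0, E1 & es] q0 sL Ues ltes lok2).
case/hasP: h1 => h _ /good_entry_sound.
by move/(_ [:: E0, E1 & es] q1 sL Ues ltes lok2).
Qed.

End CheckRect.

(** * Reduction to representative pairs of lines *)

Lemma mem_sdr doms used s : size s = size doms -> uniq s ->
  (forall i, i < size s -> ap s i \in nth [::] doms i) ->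
  {in s, forall x, x \notin used} -> s \in sdr doms used.
Proof.
elim: doms used s => [|d doms IHd] used [|x s] //= [ss] /andP[nx Us] sP nu.
apply/flattenP; exists [seq x :: s | s <- sdr doms (x :: used)].
  apply/mapP; exists x; first exact: (sP 0).
  by rewrite memnE (negbTE (nu x (mem_head _ _))).
apply: map_f; apply: IHd => // [i li|y ys]; first exact: (sP i.+1).
rewrite in_cons negb_or nu ?in_cons ?ys ?orbT // andbT.
by apply: contra nx => /eqP<-.
Qed.

Lemma pm_inv f : f < 6 -> exists2 f', f' < 6 & forall T (t : T * T * T), pm f' (pm f t) = t.
Proof.
move=> lf; exists (nth 0 [:: 0; 1; 2; 4; 3; 5] f).
  by case: f lf => [|[|[|[|[|[|f]]]]]].
by case: f lf => [|[|[|[|[|[|f]]]]]] // _ T [[x y] z].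
Qed.

Lemma pm_comp g f : g < 6 -> f < 6 ->
  exists2 h, h < 6 & forall T (t : T * T * T), pm g (pm f t) = pm h t.
Proof.
move=> lg lf; pose t := (0, 1, 2); pose h := find (fun h => pm h t == pm g (pm f t)) (iota 0 6).
exists h; first by rewrite /h; case: g lg h => [|[|[|[|[|[|g]]]]]] // _; case: f lf => [|[|[|[|[|[|f]]]]]].
by rewrite /h; case: g lg h => [|[|[|[|[|[|g]]]]]] // _; case: f lf => [|[|[|[|[|[|f]]]]]] // _ _ T [[x y] z].
Qed.

Lemma pmP T (Pr : T -> Prop) f x y z : Pr x -> Pr y -> Pr z ->
  let: (u, v, w) := pm f (x, y, z) in [/\ Pr u, Pr v & Pr w].
Proof. by case: f => [|[|[|[|[|f]]]]]. Qed.

Section Turn.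
Variables (q : nat) (Q : seq nat -> Prop) (f : nat) (G : seq nat * seq nat * seq nat).
Hypotheses (G0 : is_perm q G.1.1) (G1 : is_perm q G.1.2) (G2 : is_perm q G.2).

(** Only the first three coordinates move; the last is kept, so that lines go to lines with the same
    last symbol. *)
Definition turn : seq nat -> Prop :=
  let: (s0, s1, s2) := pm f (0, 1, 2) in let: (g0, g1, g2) := pm f G in
  twist 4 q [:: s0; s1; s2; 3] [:: g0; g1; g2; idx q] Q.

Lemma mds_turn : mds q 4 2 Q -> mds q 4 2 turn.
Proof.
rewrite /turn; case: G G0 G1 G2 => [[g0 g1] g2] /= p0 p1 p2.
by case: f => [|[|[|[|[|f']]]]] /=; apply: mds_twist; rewrite /act_ok /= ?p0 ?p1 ?p2 is_perm_idx.
Qed.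

Lemma turnE x y z e : x < q -> y < q -> z < q -> e < q ->
  turn [:: x; y; z; e] <-> Q (wd (pm f (ap G.1.1 x, ap G.1.2 y, ap G.2 z)) e).
Proof.
rewrite /turn /twist; case: G => [[g0 g1] g2] /= xq yq zq eq.
have b : bounded 4 q [:: x; y; z; e] by rewrite /bounded /= xq yq zq eq.
by case: f => [|[|[|[|[|f']]]]]; rewrite /wact /wd /pm /idx /= ?ap_iota //; split=> [[]|].
Qed.
End Turn.

Lemma points_lt q phi j x y z :
  all (fun l => is_perm q l.1 && is_perm q l.2) phi ->
  (x, y, z) \in points q (nth (diag q) (diag q :: phi) j) -> [/\ x < q, y < q & z < q].
Proof.
move=> ok /mapP[a]; rewrite mem_iota /= add0n => aq [-> -> ->].
suff /andP[p1 p2] : is_perm q (nth (diag q) (diag q :: phi) j).1 &&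
    is_perm q (nth (diag q) (diag q :: phi) j).2 by split; rewrite ?perm_tab_lt.
have [lj|lj] := ltnP j (size (diag q :: phi)); last by rewrite nth_default //= is_perm_idx.
have := mem_nth (diag q) lj; rewrite in_cons => /predU1P[->|/(allP ok)//].
by rewrite /= is_perm_idx.
Qed.

(** The conditions on [K] say that [G] sends the point of [m] with index [v] to the diagonal point
    with index [ap K v]; hence [tau] turns into [compt K tau]. *)
Lemma realizes_turn q Q f G phi f2 tau m d K :
  is_perm q G.1.1 -> is_perm q G.1.2 -> is_perm q G.2 -> is_perm q K ->
  (forall v, v < q -> [/\ ap G.1.1 v = ap K v, ap m.1 v < q /\ ap m.2 v < q,
    ap G.1.2 (ap m.1 v) = ap K v & ap G.2 (ap m.2 v) = ap K v]) ->
  f < 6 -> f2 < 6 -> all (fun l => is_perm q l.1 && is_perm q l.2) phi ->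
  realizes q (turn q Q f G) phi f2 tau m d ->
  exists2 f3, f3 < 6 & realizes q Q phi f3 (compt K tau) (diag q) d.
Proof.
move=> G0 G1 G2 pK GK lf lf2 okphi [ptau pd R]; have [f3 lf3 f3E] := pm_comp lf lf2.
exists f3 => //; split=> // [|j t jq tin]; first exact: is_perm_compt.
have := R j t jq tin; case: t tin => [[x y] z] /(points_lt okphi)[xq yq zq].
have stau := perm_tab_size ptau.
rewrite /img !ap_compt ?stau //.
have := f3E _ (ap K (ap tau x), ap K (ap tau y), ap K (ap tau z)); rewrite (pm_map f2 (ap K)).
have := @pmP _ (fun x => x < q) f2 _ _ _ (perm_tab_lt ptau xq) (perm_tab_lt ptau yq) (perm_tab_lt ptau zq).
case: (pm f2 _) => [[u v] w] [uq vq wq] <-.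
have [Gu _ _ _] := GK u uq; have [_ [mv _] Gv _] := GK v vq; have [_ [_ mw] _ Gw] := GK w wq.
rewrite {1}/wd /= turnE ?(perm_tab_lt pd) // Gu Gv Gw.
have := @pmP _ (fun x => x < q) f _ _ _ (perm_tab_lt pK uq) (perm_tab_lt pK vq) (perm_tab_lt pK wq).
by case: (pm f _) => [[u' v'] w'] [uq' vq' wq']; rewrite /wd /= !ap_iota.
Qed.

Definition normal_plane q phis Q m e := exists i f tau d, [/\ i < size phis, f < 6,
    realizes q Q (nth [::] phis i) f tau m d & ap d 0 = e].

Lemma full_phi q phis i : full_phis q phis -> i < size phis ->
  size (nth [::] phis i) = q.-1 /\
  all (fun l => is_perm q l.1 && is_perm q l.2) (nth [::] phis i).
Proof. by move=> full li; have /andP[/eqP] := allP full _ (mem_nth [::] li). Qed.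

Lemma normal_turn q phis Q f G m e K : full_phis q phis ->
  is_perm q G.1.1 -> is_perm q G.1.2 -> is_perm q G.2 -> is_perm q K ->
  (forall v, v < q -> [/\ ap G.1.1 v = ap K v, ap m.1 v < q /\ ap m.2 v < q,
    ap G.1.2 (ap m.1 v) = ap K v & ap G.2 (ap m.2 v) = ap K v]) ->
  f < 6 -> normal_plane q phis (turn q Q f G) m e -> normal_plane q phis Q (diag q) e.
Proof.
move=> full G0 G1 G2 pK GK lf [i [f2 [tau [d [li lf2 R d0]]]]].
have [_ ok] := full_phi full li.
have [f3 lf3 R3] := realizes_turn G0 G1 G2 pK GK lf lf2 ok R.
by exists i, f3, (compt K tau), d.
Qed.

Section Variant.
Variables (q : nat) (Q : seq nat -> Prop) (phis : seq (seq line)).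
Hypotheses (mdsQ : mds q 4 2 Q) (q1 : 1 < q) (full : full_phis q phis).
Variables (pi sg h ps ss : seq nat) (e0 e1 : nat).
Hypotheses (ppi : is_perm q pi) (psg : is_perm q sg) (pps : is_perm q ps) (pss : is_perm q ss).
Hypotheses (e0q : e0 < q) (e1q : e1 < q) (ne : e0 != e1).
Hypothesis Q0 : forall t, t < q -> Q [:: t; t; t; e0].
Hypothesis Q1 : forall t, t < q -> Q [:: t; ap pi t; ap sg t; e1].

(** In the turned plane the two lines of [Q] become a representative pair. If [m] holds, the
    diagonal of [Q] becomes the second line of this pair, and the second half of [check_rect_sound]
    is the one that applies. *)
Lemma variant_sound m f ent0 ent1 : f < 6 -> good_variant q pi sg m f h ps ss ->
  check_rect q phis ps ss ent0 ent1 -> normal_plane q phis Q (diag q) e0.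
Proof.
move=> lf gv chk; have [f' lf' f'E] := pm_inv lf; move: gv; rewrite /good_variant.
have := @pmP _ (is_perm q) f _ _ _ (is_perm_idx q) ppi psg.
have := fun s => pm_map f (fun t => ap t s) (iota 0 q) pi sg.
case: (pm f _) => [[A0 A1] A2] AE [pA0 pA1 pA2]; case: ifP => // ph; have sh := perm_tab_size ph.
have {}AE s : s < q -> pm f' (ap A0 s, ap A1 s, ap A2 s) = (s, ap pi s, ap sg s).
  by move=> sq; rewrite -AE f'E ap_iota.
have sps := perm_tab_size pps; have sss := perm_tab_size pss.
case: m.
  case: ifP => //; rewrite !eqsE => /eqP E1 /eqP E2.
  pose G := (compt A0 h, compt A1 h, compt A2 h).
  have G0 : is_perm q G.1.1 by apply: is_perm_compt.
  have G1 : is_perm q G.1.2 by apply: is_perm_compt.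
  have G2 : is_perm q G.2 by apply: is_perm_compt.
  have GK v : v < q -> [/\ ap G.1.1 v = ap (compt A0 h) v,
      ap ps v < q /\ ap ss v < q, ap G.1.2 (ap ps v) = ap (compt A0 h) v &
      ap G.2 (ap ss v) = ap (compt A0 h) v].
    move=> vq; split=> //; first by split; apply: perm_tab_lt.
      by rewrite -E1 /= !ap_compt ?size_map ?sh ?sps ?perm_tab_lt.
    by rewrite -E2 /= !ap_compt ?size_map ?sh ?sss ?perm_tab_lt.
  apply: (normal_turn (m := (ps, ss)) full G0 G1 G2 G0 GK lf').
  apply: (proj2 (check_rect_sound (mds_turn f' G0 G1 G2 mdsQ) q1 full chk sps sss e1q e0q _ _ _)).
  - by rewrite eq_sym.
  - by move=> t tq; rewrite turnE // /= !ap_compt ?sh // AE ?(perm_tab_lt ph) //; apply/Q1/perm_tab_lt.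
  move=> t tq; have [g0 [m1 m2] g1 g2] := GK t tq.
  by rewrite turnE // g0 g1 g2 pm_diag; apply/Q0/perm_tab_lt.
case: ifP => //; case: ifP => //; rewrite !eqsE; set ts := compt _ h => /eqP E1 /eqP E0 /eqP E2.
have pts : is_perm q ts by apply: is_perm_compt => //; apply: is_perm_invt.
have sts := perm_tab_size pts.
pose G := (h, h, h).
have GK v : v < q -> [/\ ap G.1.1 v = ap h v, ap (diag q).1 v < q /\ ap (diag q).2 v < q,
   ap G.1.2 (ap (diag q).1 v) = ap h v & ap G.2 (ap (diag q).2 v) = ap h v].
  by move=> vq /=; rewrite ap_iota.
apply: (normal_turn full (ph : is_perm q G.1.1) ph ph ph GK lf').
apply: (proj1 (check_rect_sound (mds_turn f' (ph : is_perm q G.1.1) ph ph mdsQ) q1 full chk sps sss e0q e1q ne _ _)).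
  by move=> t tq; rewrite turnE //= pm_diag; apply/Q0/perm_tab_lt.
move=> t tq; rewrite turnE ?perm_tab_lt //=.
have -> : ap h (ap ps t) = ap A1 (ap ts t) by rewrite -!ap_compt ?sts ?sps // E1.
have -> : ap h (ap ss t) = ap A2 (ap ts t) by rewrite -!ap_compt ?sts ?sss // E2.
have -> : ap h t = ap A0 (ap ts t) by rewrite -ap_compt ?sts // E0.
by rewrite AE ?(perm_tab_lt pts) //; apply/Q1/perm_tab_lt.
Qed.
End Variant.

Definition wf_data q phis stds (reps : seq (nat * seq nat * seq entry * seq entry)) :=
  [&& full_phis q phis, all (is_perm q) stds
    & all (fun r => (r.1.1.1 < size stds) && is_perm q r.1.1.2) reps].

Section NormalForm.
Variables (q : nat) (phis : seq (seq line)) (stds : seq (seq nat)).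
Variable reps : seq (nat * seq nat * seq entry * seq entry).
Hypotheses (q1 : 1 < q) (wf : wf_data q phis stds reps).
Hypothesis cover : rect_cover q stds [seq r.1.1 | r <- reps].
Hypothesis checked : check_reps q phis stds reps.
Let full : full_phis q phis. Proof. by case/and3P: wf. Qed.

Lemma tables Q e : mds q 4 2 Q -> e < q -> exists pi sg,
  [/\ is_perm q pi, is_perm q sg & forall a, a < q -> Q [:: a; ap pi a; ap sg a; e]].
Proof.
move=> mdsQ eq; have [t st tP] := line_table mdsQ eq.
exists (unzip1 t), (unzip2 t).
have {}tP a : a < q -> Q [:: a; ap (unzip1 t) a; ap (unzip2 t) a; e].
  by move=> aq; rewrite !(nth_map (0, 0)) ?st //; apply: tP.
split=> //; apply: is_perm_tab => [|x xq|x y xq yq E]; rewrite ?size_map //.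
- by have [_ ? _ _] := plane_lt mdsQ (tP x xq).
- by have := tP x xq; rewrite E => p; have [] := uniq13 mdsQ p (tP y yq).
- by have [_ _ ? _] := plane_lt mdsQ (tP x xq).
by have := tP x xq; rewrite E => p; have [] := uniq23 mdsQ p (tP y yq).
Qed.

Section TwoLines.
Variables (Q : seq nat -> Prop) (e0 e1 : nat) (pi sg : seq nat).
Hypotheses (mdsQ : mds q 4 2 Q) (e0q : e0 < q) (e1q : e1 < q) (ne : e0 != e1).
Hypotheses (ppi : is_perm q pi) (psg : is_perm q sg).
Hypothesis Q0 : forall t, t < q -> Q [:: t; t; t; e0].
Hypothesis Q1 : forall t, t < q -> Q [:: t; ap pi t; ap sg t; e1].

Lemma deranged a : a < q -> [/\ ap pi a != a, ap sg a != a & ap sg a != ap pi a].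
Proof.
move=> aq; split; apply: contra ne => /eqP E; have := Q1 aq; rewrite E => p.
- by have [_ ->] := uniq01 mdsQ (Q0 aq) p.
- by have [_ ->] := uniq02 mdsQ (Q0 aq) p.
by have [_ ->] := uniq12 mdsQ (Q0 (perm_tab_lt ppi aq)) p.
Qed.

Lemma pi_derangement : pi \in derangements q.
Proof.
apply: mem_sdr => //; rewrite ?size_map ?size_iota ?(perm_tab_size ppi) ?(perm_tab_uniq ppi) //.
move=> i iq; rewrite (nth_map 0) ?size_iota // nth_iota // add0n mem_remn mem_iota.
by rewrite perm_tab_lt // andbT; case: (deranged iq) => -> _ _.
Qed.

Lemma sg_discordant : sg \in discordant q pi.
Proof.
apply: mem_sdr => //; rewrite ?size_map ?size_iota ?(perm_tab_size psg) ?(perm_tab_uniq psg) //.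
move=> i iq; rewrite (nth_map 0) ?size_iota // nth_iota // add0n !mem_remn mem_iota.
by rewrite perm_tab_lt // andbT; case: (deranged iq) => _ -> ->.
Qed.

Lemma normal_std : pi \in stds -> normal_plane q phis Q (diag q) e0.
Proof.
move=> pistd; case/and3P: wf => _ /allP okstds /allP okreps.
move: cover; rewrite /rect_cover; case: ifP => // _ /allP/(_ _ pistd)/allP/(_ _ sg_discordant).
case/hasP=> m _ /hasP[f]; rewrite mem_iota => /= lf.
case: (pm f _) => [[A0 A1] A2]; set t := find _ _; case/hasP=> c _; set ss := compt _ c.
case: ifP => // /hasP[r0 /mapP[r rin ->]]; rewrite eqsE; case: ifP => // /eqP <- /eqP <-.
have /andP[lt pss] := okreps r rin; set h := (if m then _ else _) => gv.
have := allP checked r rin; case: r rin lt pss gv => [[[t' sg'] en0] en1] /= _ lt pss gv chk.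
have pps := okstds _ (mem_nth [::] lt).
exact: (variant_sound mdsQ q1 full ppi psg pps pss e0q e1q ne Q0 Q1 lf gv chk).
Qed.
End TwoLines.

(** Relabelling all three coordinates by [h] keeps the diagonal and conjugates the first permutation
    of another line to a standard one. Discordant partners therefore need to be enumerated for
    standard permutations only. *)
Lemma normal_diag Q e0 : mds q 4 2 Q -> e0 < q ->
  (forall t, t < q -> Q [:: t; t; t; e0]) -> normal_plane q phis Q (diag q) e0.
Proof.
move=> mdsQ e0q Q0; pose e1 := (e0 == 0) : nat.
have e1q : e1 < q by rewrite /e1; case: eqP => // _; apply: ltnW.
have ne : e0 != e1 by rewrite /e1; case: (e0).
have [pi [sg [ppi psg Q1]]] := tables mdsQ e1q.
have : conjugate_ok q stds pi.
  move: cover; rewrite /rect_cover; case: ifP => // /allP cok _.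
  by apply: cok; apply: (pi_derangement mdsQ ne ppi Q0 Q1).
rewrite /conjugate_ok; set h := cyc_order q pi; case: ifP => // ph /hasP[s sin].
rewrite eqsE => /eqP hs; have sh := perm_tab_size ph.
have ps : is_perm q s by case/and3P: wf => _ /allP ok _; apply: ok.
pose G := (h, h, h).
have mdsR := mds_turn 0 (ph : is_perm q G.1.1) ph ph mdsQ.
have GK v : v < q -> [/\ ap G.1.1 v = ap h v, ap (diag q).1 v < q /\ ap (diag q).2 v < q,
   ap G.1.2 (ap (diag q).1 v) = ap h v & ap G.2 (ap (diag q).2 v) = ap h v].
  by move=> vq /=; rewrite ap_iota.
apply: (normal_turn full (ph : is_perm q G.1.1) ph ph ph GK (isT : 0 < 6)).
have [pi' [sg' [ppi' psg' R1]]] := tables mdsR e1q.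
apply: (normal_std mdsR e0q e1q ne ppi' psg' _ R1).
  by move=> t tq; rewrite turnE //; apply/Q0/perm_tab_lt.
suff <- : s = pi' by [].
apply: (@eq_from_nth _ 0); rewrite ?(perm_tab_size ps) ?(perm_tab_size ppi') // => a aq.
have := R1 a aq; rewrite turnE ?perm_tab_lt // => p.
have [E _] := uniq03 mdsQ p (Q1 _ (perm_tab_lt ph aq)).
apply: (perm_tab_inj ph); rewrite ?perm_tab_lt // [RHS]E.
by rewrite -!ap_compt ?(perm_tab_size ps) ?sh ?hs.
Qed.

Lemma plane_normal_form P B C e0 : mds q 4 2 P -> e0 < q -> is_perm q B -> is_perm q C ->
  (forall a, a < q -> P [:: a; ap B a; ap C a; e0]) -> normal_plane q phis P (B, C) e0.
Proof.
move=> mdsP e0q pB pC P0; pose G := (idx q, B, C).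
have pI := is_perm_idx q.
have mdsQ := mds_turn 0 (pI : is_perm q G.1.1) pB pC mdsP.
have [|i [f [tau [d [li lf [ptau pd R] d0]]]]] := normal_diag mdsQ e0q.
  by move=> t tq; rewrite turnE //= ap_iota //; apply: P0.
exists i, f, tau, d; split=> //; split=> // j t jq tin.
have [_ ok] := full_phi full li.
have := R j t jq tin; case: t tin => [[x y] z] /(points_lt ok)[xq yq zq]; rewrite /img.
have := @pmP _ (fun x => x < q) f _ _ _ (perm_tab_lt ptau xq) (perm_tab_lt ptau yq) (perm_tab_lt ptau zq).
case: (pm f _) => [[u v] w] [uq vq wq].
by rewrite /wd /= turnE ?ap_iota ?(perm_tab_lt pd) //= ?ap_iota // /pm /wd /=.
Qed.
End NormalForm.

(** * Completeness of the candidate lists *)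

Lemma tsearch_complete T tss pre avail tau :
  size tau = size pre + size tss -> uniq tau -> pre = take (size pre) tau ->
  (forall i, size pre <= i < size tau -> ap tau i \in avail) ->
  (forall i t, i < size tss -> t \in nth [::] tss i ->
     avoids T (take (size pre + i).+1 tau) t) ->
  tau \in tsearch T tss pre avail.
Proof.
elim: tss pre avail => [|ts tss IHt] pre avail /= st Ut dpre av avo.
  by rewrite inE dpre take_oversize // st addn0.
have lp : size pre < size tau by rewrite st addnS ltnS leq_addr.
have dpre' : rcons pre (ap tau (size pre)) = take (size pre).+1 tau.
  by rewrite (take_nth 0) // -dpre.
have spre' : size (rcons pre (ap tau (size pre))) = (size pre).+1 by rewrite size_rcons.
apply/flattenP; eexists.
  by apply/mapP; exists (ap tau (size pre)) => //; apply: av; rewrite leqnn.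
rewrite ifT; last first.
  by apply/allP => t tin; rewrite dpre' -(addn0 (size pre)); apply: (avo 0).
apply: IHt; rewrite ?spre' //.
- by rewrite st addnS.
- move=> i /andP[lti ltis]; rewrite mem_remn av ?ltis ?(ltnW lti) // andbT.
  by rewrite nth_uniq // neq_ltn lti orbT.
by move=> i t li tin; rewrite addSn -addnS; apply: (avo i.+1).
Qed.

Section Cands.
Variables (q : nat) (phis : seq (seq line)) (nlin : nat).
Hypotheses (q1 : 1 < q) (full : full_phis q phis).

Lemma mem_cands T k i f tau : k <= i < size phis -> f < 6 -> is_perm q tau ->
  (nlin <= i -> ap tau 0 = 0 /\ ap tau 1 = 1) ->
  (forall j t, 0 < j < q -> t \in points q (nth (diag q) (diag q :: nth [::] phis i) j) ->
     avoids T tau (pm f t)) ->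
  (i, f, tau) \in cands q phis nlin T k.
Proof.
case/andP=> ki li lf ptau norm avo; have stau := perm_tab_size ptau.
have [sphi okphi] := full_phi full li.
apply/flattenP; eexists.
  by apply/mapP; exists i; rewrite // mem_iota ki subnKC // (leq_trans ki (ltnW li)).
apply/flattenP; eexists; first by apply/mapP; exists f; rewrite // mem_iota.
apply: map_f; set phi := nth [::] phis i in sphi okphi avo *.
have sstr : size (strata q f phi) = q by rewrite size_map size_iota.
have avS c t : c < q -> t \in nth [::] (strata q f phi) c -> avoids T (take c.+1 tau) t.
  move=> cq; rewrite (nth_map 0) ?size_iota // nth_iota // add0n mem_filter.
  case/andP=> /eqP dc /mapP[t0 /flattenP[_ /mapP[l lphi ->]] t0l dt].
  have lt : index l phi < q.-1 by rewrite -sphi index_mem.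
  have /avo : 0 < (index l phi).+1 < q by rewrite ltn0Sn -(prednK (ltnW q1)) ltnS.
  move/(_ t0); rewrite /= nth_index // -dt => /(_ t0l).
  case: t dc {dt} => [[x y] z] /= dc; rewrite /avoids !nth_take // ltnS -dc;
    by rewrite ?leq_maxl // leq_max ?leq_maxl ?leq_maxr orbT.
case: ltnP => [_|/norm[tau0 tau1]].
  apply: tsearch_complete => //=; rewrite ?stau ?sstr ?take0 ?(perm_tab_uniq ptau) //.
  by move=> c cq; rewrite mem_iota perm_tab_lt.
(* For a linear form the prefix [:: 0; 1] is given, and the search starts with stratum 2. *)
have q2 : 2 <= q by [].
apply: tsearch_complete => //=; rewrite ?stau ?size_drop ?sstr ?subnKC ?(perm_tab_uniq ptau) //.
- case: (tau) stau tau0 tau1 => [|x [|y s]] /= stau; first by rewrite -stau in q2.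
    by rewrite -stau in q2.
  by move=> -> ->; rewrite take0.
- move=> c /andP[c2 cq]; rewrite drop_iota mem_iota !add0n subnKC // perm_tab_lt // andbT.
  have n0 : ap tau c != 0.
    apply/eqP; rewrite -[RHS]tau0 => /(perm_tab_inj ptau cq) c0.
    by rewrite c0 ?(ltnW q1) in c2.
  have n1 : ap tau c != 1.
    apply/eqP; rewrite -tau1 => /(perm_tab_inj ptau cq) c0.
    by rewrite c0 in c2.
  by case: (ap tau c) n0 n1 => [|[]].
by move=> c t; rewrite nth_drop => cq; apply: avS; rewrite -ltn_subRL.
Qed.
End Cands.

(** * Cubes *)

Section Cube.
Variables (q : nat) (X : seq nat -> Prop).
Hypothesis mdsX : mds q 5 3 X.

Lemma cube_uniq i j k w v : uniq [:: i; j; k] -> all (fun i => i < 5) [:: i; j; k] ->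
  X w -> X v -> ap w i = ap v i -> ap w j = ap v j -> ap w k = ap v k -> w = v.
Proof.
move=> U lt Xw Xv ei ej ek; case: mdsX => _ uX _; apply: (uX [:: i; j; k]) => //.
by move=> l; rewrite !inE => /or3P[]/eqP->.
Qed.

Definition swap5 := twist 5 q [:: 1; 0; 2; 3; 4] (nseq 5 (idx q)) X.

Lemma mds_swap5 : mds q 5 3 swap5.
Proof. by apply: mds_twist; rewrite // /act_ok /= !is_perm_idx. Qed.

Lemma cube_lt w : X w -> size w = 5 /\ forall i, i < 5 -> ap w i < q.
Proof. by case: mdsX => bX _ _ /bX; apply: boundedP. Qed.

Lemma swap5E x v y z e : swap5 [:: v; x; y; z; e] <-> X [:: x; v; y; z; e].
Proof.
split=> [[b]|p].
  have [_ lt] := boundedP b.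
  by rewrite /wact /= !(ap_iota (lt 0 isT), ap_iota (lt 1 isT), ap_iota (lt 2 isT),
    ap_iota (lt 3 isT), ap_iota (lt 4 isT)).
have [_ lt] := cube_lt p; split.
  by apply: boundedI => // -[|[|[|[|[|]]]]] //= _;
     [apply: (lt 1) | apply: (lt 0) | apply: (lt 2) | apply: (lt 3) | apply: (lt 4)].
by rewrite /wact /= !(ap_iota (lt 0 isT), ap_iota (lt 1 isT), ap_iota (lt 2 isT),
    ap_iota (lt 3 isT), ap_iota (lt 4 isT)).
Qed.
End Cube.

(** * Slices of a cube and their normal forms *)

Definition contains q (phis : seq (seq line)) i (X : seq nat -> Prop) : Prop := forall j x y z, j < q ->
  (x, y, z) \in points q (nth (diag q) (diag q :: nth [::] phis i) j) ->
  X [:: j; x; y; z; 0].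

Definition excluded q phis i : Prop := forall X, mds q 5 3 X -> contains q phis i X -> False.

Definition swapt q a := mkseq (fun x => if x == 0 then a else if x == a then 0 else x) q.

Lemma is_perm_swapt q a : a < q -> is_perm q (swapt q a).
Proof.
move=> aq; apply: is_perm_tab => [|x xq|x y xq yq]; rewrite ?size_mkseq ?nth_mkseq //.
  by case: eqP => // _; case: eqP => // _; apply: leq_ltn_trans aq.
case: eqP => [->|x0]; case: eqP => [->|y0] //; do ?case: eqP => //; congruence.
Qed.

Lemma ap_swapt q a : 0 < q -> ap (swapt q a) 0 = a.
Proof. by move=> q0; rewrite nth_mkseq. Qed.

Section Embed.
Variables (q : nat) (phis : seq (seq line)) (X P : seq nat -> Prop) (i : nat).
Hypotheses (q1 : 1 < q) (full : full_phis q phis) (mdsX : mds q 5 3 X) (li : i < size phis).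
Variables (f : nat) (tau : seq nat) (m : line) (d : seq nat).
Hypotheses (pm1 : is_perm q m.1) (pm2 : is_perm q m.2).
Hypothesis real : realizes q P (nth [::] phis i) f tau m d.

Lemma contains_twist pos (a : nat) g s : a < q -> act_ok q 5 s g ->
  (forall x y z e, P [:: x; y; z; e] -> X (pos [:: x; y; z; e; a])) ->
  (forall j x y z, j < q -> x < q -> y < q -> z < q ->
     pos (rcons (wd (img f tau m (x, y, z)) (ap d j)) a) = wact 5 s g [:: j; x; y; z; 0]) ->
  contains q phis i (twist 5 q s g X).
Proof.
move=> aq ok PX pE j x y z jq tin; have [_ okphi] := full_phi full li.
have [xq yq zq] := points_lt okphi tin; case: real => ptau pd R.
have q0 := ltnW q1.
split; first by rewrite /bounded /= jq xq yq zq q0.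
by rewrite -pE //=; apply: PX; apply: R jq tin.
Qed.

Let tab (n : nat) := compt (nth [::] [:: idx q; m.1; m.2] n) tau.

Let ptab n : n < 3 -> is_perm q (tab n).
Proof.
case: real => ptau _ _.
by case: n => [|[|[|]]] // _; apply: is_perm_compt; rewrite ?is_perm_idx.
Qed.

Let imgE x y z : x < q -> y < q -> z < q ->
  img f tau m (x, y, z) = let: (s0, s1, s2) := pm f (1, 2, 3) in
    let w := [:: 0; x; y; z] in (ap (tab 0) (ap w s0), ap (tab 1) (ap w s1), ap (tab 2) (ap w s2)).
Proof.
case: real => ptau _ _ xq yq zq; rewrite /img /tab.
have lt := perm_tab_lt ptau; have st := perm_tab_size ptau.
by case: f => [|[|[|[|[|f']]]]]; rewrite /pm /= !ap_compt ?st //= ap_iota ?lt.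
Qed.

(** The twist produces the shape that [contains] asks for: the index of the line comes first, then
    the three coordinates of the form, and last the symbol fixed by the slice, with 0 transposed to
    [b]. *)
Lemma contains_slice0 b : b < q -> (forall w, P w -> X (b :: w)) ->
  exists s g, act_ok q 5 s g /\ contains q phis i (twist 5 q s g X).
Proof.
move=> bq PX; have [ptau pd _] := real; case sE: (pm f (1, 2, 3)) => [[s0 s1] s2].
pose s := [:: 4; s0; s1; s2; 0]; pose g := [:: swapt q b; tab 0; tab 1; tab 2; d].
have ok : act_ok q 5 s g.
  rewrite /act_ok /= is_perm_swapt // !ptab // pd /= andbT.
  by move: sE; rewrite /s; case: f => [|[|[|[|[|f']]]]] [<- <- <-].
exists s, g; split=> //.
apply: (@contains_twist (fun w => [:: b; ap w 0; ap w 1; ap w 2; ap w 3]) b) => // [x y z e /PX //|].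
move=> j x y z jq xq yq zq; rewrite imgE // sE /wact /= ap_swapt ?(ltnW q1) //.
by move: sE; case: f => [|[|[|[|[|f']]]]] [<- <- <-].
Qed.

Lemma contains_slice1 b : b < q -> (forall x y z e, P [:: x; y; z; e] -> X [:: x; b; y; z; e]) ->
  exists s g, act_ok q 5 s g /\ contains q phis i (twist 5 q s g X).
Proof.
move=> bq PX; have [ptau pd _] := real; case sE: (pm f (1, 2, 3)) => [[s0 s1] s2].
pose s := [:: s0; 4; s1; s2; 0]; pose g := [:: tab 0; swapt q b; tab 1; tab 2; d].
have ok : act_ok q 5 s g.
  rewrite /act_ok /= is_perm_swapt // !ptab // pd /= andbT.
  by move: sE; rewrite /s; case: f => [|[|[|[|[|f']]]]] [<- <- <-].
exists s, g; split=> //.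
apply: (@contains_twist (fun w => [:: ap w 0; b; ap w 1; ap w 2; ap w 3]) b) => //.
move=> j x y z jq xq yq zq; rewrite imgE // sE /wact /= ap_swapt ?(ltnW q1) //.
by move: sE; case: f => [|[|[|[|[|f']]]]] [<- <- <-].
Qed.

Lemma contains_slice4 b : b < q -> (forall x y z e, P [:: x; y; z; e] -> X [:: e; x; y; z; b]) ->
  exists2 s012, s012 = pm f (1, 2, 3) &
  let s := [:: 0; s012.1.1; s012.1.2; s012.2; 4] in
  let g := [:: d; tab 0; tab 1; tab 2; swapt q b] in
  act_ok q 5 s g /\ contains q phis i (twist 5 q s g X).
Proof.
move=> bq PX; have [ptau pd _] := real; case sE: (pm f (1, 2, 3)) => [[s0 s1] s2].
exists (s0, s1, s2) => //=; set s := [:: 0; s0; s1; s2; 4]; set g := [:: d; tab 0; tab 1; tab 2; swapt q b].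
have ok : act_ok q 5 s g.
  rewrite /act_ok /= is_perm_swapt // !ptab // pd /= andbT.
  by move: sE; rewrite /s; case: f => [|[|[|[|[|f']]]]] [<- <- <-].
split=> //.
apply: (@contains_twist (fun w => [:: ap w 3; ap w 0; ap w 1; ap w 2; b]) b) => //.
move=> j x y z jq xq yq zq; rewrite imgE // sE /wact /= ap_swapt ?(ltnW q1) //.
by move: sE; case: f => [|[|[|[|[|f']]]]] [<- <- <-].
Qed.
End Embed.

Notation line_of q phi j := (nth (diag q) (diag q :: phi) j).
Notation perm_lines q := (all (fun l : line => is_perm q l.1 && is_perm q l.2)).

Lemma perm_line_of q phi j : perm_lines q phi ->
  is_perm q (line_of q phi j).1 /\ is_perm q (line_of q phi j).2.
Proof.
move=> ok; apply/andP.
have [lj|lj] := ltnP j (size (diag q :: phi)); last by rewrite nth_default //= is_perm_idx.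
have := mem_nth (diag q) lj; rewrite in_cons => /predU1P[->|/(allP ok)//].
by rewrite /= is_perm_idx.
Qed.

Lemma mem_points q l x y z :
  ((x, y, z) \in points q l) = [&& x < q, y == ap l.1 x & z == ap l.2 x].
Proof.
apply/mapP/and3P => [[a]|[xq /eqP-> /eqP->]]; last by exists x; rewrite ?mem_iota.
by rewrite mem_iota => aq [-> -> ->].
Qed.

Lemma imgE f tau m x y z : img f tau m (x, y, z) = let: (x', y', z') := pm f (x, y, z) in
  (ap tau x', ap m.1 (ap tau y'), ap m.2 (ap tau z')).
Proof. by rewrite /img pm_map; case: (pm _ _) => [[]]. Qed.

Lemma realizes_normalised q P phi f tau m d : 1 < q -> size phi = q.-1 -> perm_lines q phi ->
  affine_invariant q phi -> realizes q P phi f tau m d ->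
  exists tau' d', [/\ realizes q P phi f tau' m d', ap tau' 0 = 0, ap tau' 1 = 1
    & ap d' 0 = ap d 0].
Proof.
move=> q1 sphi ok aff [ptau pd R]; have q0 := ltnW q1.
have [lx ly] := (perm_tab_index_lt ptau q0, perm_tab_index_lt ptau q1).
have ne : index 0 tau != index 1 tau.
  by apply/eqP => E; have := perm_tab_index ptau q0; rewrite E (perm_tab_index ptau q1).
move/allP/(_ (index 0 tau)): aff; rewrite mem_iota => /(_ lx)/allP/(_ (index 1 tau)).
rewrite mem_iota => /(_ ly).
rewrite eqn_eqE (negbTE ne); cbv zeta; set a := affine_table _ _ _; set js := map _ _.
case: ifP => // pa; case: ifP => // /allP ltj; rewrite uniqnE => Uj.
have sa := perm_tab_size pa; have stau := perm_tab_size ptau.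
have sjs : size js = q.-1 by rewrite size_map.
pose e := 0 :: [seq j.+1 | j <- js].
have se : size e = q by rewrite /= size_map sjs prednK.
have pe : is_perm q e.
  have lte : all (fun x => x < q) e.
    rewrite /= q0 all_map; apply/allP => j /ltj; rewrite sphi /= => lj.
    by rewrite -(prednK q0) ltnS.
  rewrite /is_perm eqn_eqE se eqxx lte uniqnE /= (map_inj_uniq succn_inj) Uj andbT.
  by apply/mapP => -[].
exists (compt tau a), (compt d e); split.
- split; [exact: is_perm_compt | exact: is_perm_compt|].
  move=> j [[x y] z] jq tin; have [xq yq zq] := points_lt ok tin.
  rewrite ap_compt ?se //.
  have -> : img f (compt tau a) m (x, y, z) = img f tau m (ap a x, ap a y, ap a z).
    by rewrite /img !ap_compt ?sa.
  apply: R; first exact: (perm_tab_lt pe).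
  case: j jq tin => [|j] jq /=.
    by rewrite !mem_points /= => /and3P[_ /eqP-> /eqP->]; rewrite !ap_iota ?(perm_tab_lt pa) ?eqxx.
  have lj : j < size phi by rewrite sphi -ltnS (prednK q0).
  rewrite (nth_map 0) ?sjs -?sphi // (nth_map (diag q)) //=.
  set lj' := nth _ phi j; set jj := find _ _ => tin.
  have hh : has (sends q 0 a (diag q) lj') phi.
    by rewrite has_find; apply: ltj; apply: map_f; rewrite mem_nth.
  have /allP/(_ _ tin) := nth_find (diag q) hh; rewrite -/jj imgE /pm /on /=.
  rewrite !ap_iota ?(perm_tab_lt pa) // mem_points (perm_tab_lt pa) //.
  by case/andP=> /eqP<- /eqP<-; rewrite !eqxx.
- rewrite ap_compt ?sa // (nth_map 0) ?size_iota // nth_iota // add0n muln0 addn0.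
  by rewrite modn_small // (perm_tab_index ptau).
- rewrite ap_compt ?sa // (nth_map 0) ?size_iota // nth_iota // add0n muln1.
  rewrite subnKC ?(leq_trans (ltnW lx)) ?leq_addr //.
  by rewrite modnDl modn_small // (perm_tab_index ptau).
by rewrite ap_compt ?se.
Qed.

Section PlaneLines.
Variables (q : nat) (phis : seq (seq line)) (P : seq nat -> Prop) (i f : nat).
Variables (tau : seq nat) (m : line) (d : seq nat).
Hypotheses (q1 : 1 < q) (full : full_phis q phis) (li : i < size phis).
Hypothesis real : realizes q P (nth [::] phis i) f tau m d.
Let L := plane_lines q phis m (i, f, tau).

Lemma size_plane_lines : size L = q.
Proof. by have [sphi _] := full_phi full li; rewrite /= size_map sphi prednK ?(ltnW q1). Qed.

Lemma nth_plane_lines j : j < q ->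
  nth [::] L j = [seq img f tau m t | t <- points q (line_of q (nth [::] phis i) j)].
Proof.
move=> jq; have := size_plane_lines; rewrite size_map => sL.
by rewrite (nth_map (diag q)) ?sL.
Qed.

Lemma plane_linesP j t : j < q -> t \in nth [::] L j -> P (wd t (ap d j)).
Proof. by move=> jq; rewrite nth_plane_lines // => /mapP[t' tin ->]; case: real => _ _; apply. Qed.

Lemma line_hit a j : a < q -> exists2 t,
  t \in points q (line_of q (nth [::] phis i) j) & (img f tau m t).1.1 = a.
Proof.
move=> aq; have [_ ok] := full_phi full li; have [p1 p2] := perm_line_of j ok.
have [ptau _ _] := real; set l := line_of _ _ _ in p1 p2 *; pose b := index a tau.
have bq : b < q by apply: (perm_tab_index_lt ptau).
have bE : ap tau b = a by apply: (perm_tab_index ptau).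
(* The coordinate of [t] that [pm f] moves to the front must be [b]: this is the first coordinate
   for [f] = 0, 1, the second for 2, 3, the third from 4 on. All [f] beyond 5 act like 5. *)
pose x := nth 0 [:: b; b; index b l.1; index b l.1; index b l.2; index b l.2] (minn f 5).
exists (x, ap l.1 x, ap l.2 x).
  rewrite mem_points !eqxx !andbT /x.
  by case: (f) => [|[|[|[|[|]]]]] //= *; apply: perm_tab_index_lt.
by rewrite imgE /x /pm; case: (f) => [|[|[|[|[|n]]]]] /=;
  rewrite ?(perm_tab_index p1) ?(perm_tab_index p2) ?bE.
Qed.

Lemma shareP a j (p := nth (0, 0) (share a L) j) : a < q -> j < q ->
  P [:: a; p.1; p.2; ap d j].
Proof.
move=> aq jq; rewrite {}/p (nth_map [::]) ?size_plane_lines //.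
have hit : has (fun t : tri => eqn t.1.1 a) (nth [::] L j).
  have [t tin tE] := line_hit j aq; apply/hasP; exists (img f tau m t); last exact/eqP.
  by rewrite nth_plane_lines // map_f.
set n := find _ _.
have /= /eqP tE := nth_find (0, 0, 0) hit; rewrite -/n in tE.
have nL : n < size (nth [::] L j) by rewrite -has_find.
by have := plane_linesP jq (mem_nth (0, 0, 0) nL); rewrite /wd tE.
Qed.
End PlaneLines.

(** * Exclusion of cubes by two of their slices *)

Section NoExtension.
Variables (q : nat) (phis : seq (seq line)) (nlin : nat).
Hypotheses (q1 : 1 < q) (full : full_phis q phis).
Hypothesis aff : forall i, nlin <= i < size phis -> affine_invariant q (nth [::] phis i).
Hypothesis nf : forall P B C e0, mds q 4 2 P -> e0 < q -> is_perm q B -> is_perm q C ->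
  (forall a, a < q -> P [:: a; ap B a; ap C a; e0]) -> normal_plane q phis P (B, C) e0.
Let q0 : 0 < q := ltnW q1.

Definition normalised i (tau : seq nat) := nlin <= i -> ap tau 0 = 0 /\ ap tau 1 = 1.

Lemma plane_realisation P m k : mds q 4 2 P -> is_perm q m.1 -> is_perm q m.2 ->
  (forall a, a < q -> P [:: a; ap m.1 a; ap m.2 a; 0]) ->
  (forall i f tau d, i < size phis -> realizes q P (nth [::] phis i) f tau m d -> k <= i) ->
  exists i f tau d, [/\ k <= i < size phis, f < 6, realizes q P (nth [::] phis i) f tau m d,
    ap d 0 = 0 & normalised i tau].
Proof.
case: m => B C mdsP pB pC P0 ki.
have [i [f [tau [d [li lf R d0]]]]] := nf mdsP q0 pB pC P0.
have lki : k <= i < size phis by rewrite (ki _ _ _ _ li R).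
have [lin|lin] := ltnP i nlin.
  by exists i, f, tau, d; split=> //; rewrite /normalised leqNgt lin.
have [sphi ok] := full_phi full li.
have [|tau' [d' [R' t0 t1 d0']]] := realizes_normalised q1 sphi ok _ R.
  by apply: aff; rewrite lin.
by exists i, f, tau', d'; rewrite d0'; split.
Qed.

Variables (X : seq nat -> Prop) (i0 v k : nat) (stop : seq nat -> bool).
Hypotheses (mdsX : mds q 5 3 X) (li0 : i0 < size phis) (vq : v < q).
Hypothesis cont : contains q phis i0 X.
Hypothesis exk : forall i, i < k -> excluded q phis i.
Hypothesis noext : no_extension q phis nlin i0 v k stop.

Let phi0 := nth [::] phis i0.
Let M := diag q :: phi0.
Let m2 := cross v M.
Let P1 w := X (0 :: w).
Let P2 w := swap5 q X (v :: w).

Let sM : size M = q.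
Proof. by rewrite /= (full_phi full li0).1 prednK. Qed.

Let contL j x : j < q -> x < q ->
  X [:: j; x; ap (nth (diag q) M j).1 x; ap (nth (diag q) M j).2 x; 0].
Proof. by move=> jq xq; apply: cont => //; rewrite mem_points xq !eqxx. Qed.

Let P2E x y z e : P2 [:: x; y; z; e] <-> X [:: x; v; y; z; e].
Proof. exact: swap5E. Qed.

Let m2E j : j < q -> ap m2.1 j = ap (nth (diag q) M j).1 v /\ ap m2.2 j = ap (nth (diag q) M j).2 v.
Proof. by move=> jq; split; rewrite (nth_map (diag q)) ?sM. Qed.

Let P2_0 j : j < q -> P2 [:: j; ap m2.1 j; ap m2.2 j; 0].
Proof. by move=> jq; apply/P2E; have [-> ->] := m2E jq; apply: contL. Qed.

Let mdsP1 : mds q 4 2 P1. Proof. exact: mds_slice. Qed.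
Let mdsP2 : mds q 4 2 P2. Proof. by apply: mds_slice => //; apply: mds_swap5. Qed.

Let pm2 : is_perm q m2.1 /\ is_perm q m2.2.
Proof.
split; apply: is_perm_tab => [|x xq|x y xq yq E]; rewrite ?size_map //.
- by have [_ ? _ _] := plane_lt mdsP2 (P2_0 xq).
- by have := P2_0 xq; rewrite E => p; have [] := uniq13 mdsP2 p (P2_0 yq).
- by have [_ _ ? _] := plane_lt mdsP2 (P2_0 xq).
by have := P2_0 xq; rewrite E => p; have [] := uniq23 mdsP2 p (P2_0 yq).
Qed.

(** A slice realising an excluded form would yield a twist of [X] that contains this form. *)
Lemma slice_index1 i f tau d : i < size phis ->
  realizes q P1 (nth [::] phis i) f tau (diag q) d -> k <= i.
Proof.
move=> li R; rewrite leqNgt; apply/negP => ik.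
have [//|s [g [ok C]]] := contains_slice0 (m := diag q) q1 full li
  (is_perm_idx q) (is_perm_idx q) R q0 (X := X) _.
exact: exk ik _ (mds_twist ok mdsX) C.
Qed.

Lemma slice_index2 i f tau d : i < size phis ->
  realizes q P2 (nth [::] phis i) f tau m2 d -> k <= i.
Proof.
move=> li R; rewrite leqNgt; apply/negP => ik; case: pm2 => p1 p2.
have [|s [g [ok C]]] := contains_slice1 q1 full li p1 p2 R vq (X := X) _.
  by move=> x y z e /P2E.
exact: exk ik _ (mds_twist ok mdsX) C.
Qed.

Lemma avoids_table1 i f tau d j t : i < size phis ->
  realizes q P1 (nth [::] phis i) f tau (diag q) d -> 0 < j < q ->
  t \in points q (line_of q (nth [::] phis i) j) -> avoids (table1 q phi0) tau (pm f t).
Proof.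
move=> li [ptau pd R] /andP[j0 jq] tin; have [_ ok] := full_phi full li.
have := R j t jq tin; case: t tin => [[x y] z] /(points_lt ok)[xq yq zq]; rewrite imgE.
have := @pmP _ (fun x => x < q) f _ _ _ xq yq zq; case: (pm f _) => [[x' y'] z'] [xq' yq' zq'].
have [[tx ty] tz] := (perm_tab_lt ptau xq', perm_tab_lt ptau yq', perm_tab_lt ptau zq').
rewrite /wd /= /idx !ap_iota // /P1 /avoids => p; apply/negP => /eqP.
rewrite (nth_map 0) ?size_iota // nth_iota // add0n (nth_map 0) ?size_iota // nth_iota // add0n.
set l := find _ _; have [ll|ll] := ltnP l (size phi0); last first.
  by rewrite nth_default ?size_map // => E; rewrite -E ltnn in tz.
rewrite (nth_map (diag q)) // => E.
have /= /eqP E1 : eqn (ap (nth (diag q) phi0 l).1 (ap tau x')) (ap tau y').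
  by apply: (@nth_find _ (diag q) (fun l => eqn (ap l.1 (ap tau x')) (ap tau y'))); rewrite has_find.
have lq : l.+1 < q by rewrite -sM.
have := contL lq tx; rewrite /= E1 E => p'.
by have [] := cube_uniq mdsX (i := 1) (j := 2) (k := 3) isT isT p p' erefl erefl erefl.
Qed.

Lemma avoids_table2 i f tau d j t : i < size phis ->
  realizes q P2 (nth [::] phis i) f tau m2 d -> 0 < j < q ->
  t \in points q (line_of q (nth [::] phis i) j) -> avoids (table2 q v M) tau (pm f t).
Proof.
move=> li [ptau pd R] /andP[j0 jq] tin; have [_ ok] := full_phi full li.
have := R j t jq tin; case: t tin => [[x y] z] /(points_lt ok)[xq yq zq]; rewrite imgE.
have := @pmP _ (fun x => x < q) f _ _ _ xq yq zq; case: (pm f _) => [[x' y'] z'] [xq' yq' zq'].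
have [[tx ty] tz] := (perm_tab_lt ptau xq', perm_tab_lt ptau yq', perm_tab_lt ptau zq').
case: pm2 => pa pb; rewrite /wd /= => /P2E p; apply/negP => /eqP.
rewrite (nth_map (diag q)) ?sM // (nth_map 0) ?size_iota // nth_iota // add0n -/m2.
set l := nth _ M _; set a := find _ _; cbv zeta; case: eqnP => [_ E|av]; first by rewrite -E ltnn in tz.
have [pl _] : is_perm q l.1 /\ is_perm q l.2 by apply: perm_line_of; case: (full_phi full li0).
have ma := perm_tab_lt pa ty.
have hit : has (fun x => eqn (ap l.1 x) (ap m2.1 (ap tau y'))) (iota 0 q).
  apply/hasP; exists (index (ap m2.1 (ap tau y')) l.1).
    by rewrite mem_iota (perm_tab_index_lt pl).
  by apply/eqP; rewrite (perm_tab_index pl).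
have aq : a < q by rewrite -[X in _ < X](size_iota 0) -has_find.
have /eqP := nth_find 0 hit; rewrite -/a nth_iota // add0n => E1 E2.
have hit2 : has (eqn (ap l.2 a)) m2.2 by rewrite has_find E2 (perm_tab_size pb).
have /eqP := nth_find 0 hit2; rewrite E2 => E3.
have := contL tx aq; rewrite -/l E1 E3 => p'.
have /(congr1 (ap^~ 1)) /= va := cube_uniq mdsX (i := 0) (j := 2) (k := 3) isT isT p p' erefl erefl erefl.
by case: av.
Qed.

(** The last symbols of the lines of the two slices are unknown, but the slices share the line
    [x1 = 0], [x2 = v], and its points pair the lines that carry the same last symbol. Under this
    pairing a clash gives distinct words with three equal coordinates. *)
Lemma no_extension_sound : exists i f tau d, [/\ k <= i < size phis, f < 6,
  realizes q P1 (nth [::] phis i) f tau (diag q) d, ap d 0 = 0 & stop tau].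
Proof.
case: pm2 => pa pb.
have [|i1 [f1 [t1 [d1 [li1 lf1 R1 d10 n1]]]]] :=
  plane_realisation (m := diag q) mdsP1 (is_perm_idx q) (is_perm_idx q) _ slice_index1.
  by move=> a aq; rewrite !ap_iota //; have := contL q0 aq; rewrite /= !ap_iota.
have [i2 [f2 [t2 [d2 [li2 lf2 R2 d20 n2]]]]] := plane_realisation mdsP2 pa pb P2_0 slice_index2.
have [[_ l1] [_ l2]] := (andP li1, andP li2).
exists i1, f1, t1, d1; split=> //.
have h1 : (i1, f1, t1) \in cands q phis nlin (table1 q phi0) k.
  by apply: mem_cands => //; [case: R1 | move=> j t; apply: avoids_table1 R1].
have h2 : (i2, f2, t2) \in cands q phis nlin (table2 q v M) k.
  by apply: mem_cands => //; [case: R2 | move=> j t; apply: avoids_table2 R2].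
pose L1 := plane_lines q phis (diag q) (i1, f1, t1); pose s1 := share v L1.
pose L2 := plane_lines q phis m2 (i2, f2, t2); pose s2 := share 0 L2.
have: if stop t1 then true else all (fun d : seq (nat * nat) * seq (seq tri) =>
    if mismatch s1 d.1 then true else clash v s1 d.1 L1 d.2)
    [seq (share 0 (plane_lines q phis m2 h), plane_lines q phis m2 h)
    | h <- cands q phis nlin (table2 q v M) k] := allP noext _ h1.
case: ifP => // _ /allP/(_ _ (map_f _ h2)).
change ((if mismatch s1 s2 then true else clash v s1 s2 L1 L2) -> false).
have sL1 : size L1 = q := size_plane_lines f1 t1 (diag q) q1 full l1.
have sL2 : size L2 = q := size_plane_lines f2 t2 m2 q1 full l2.
have ss1 : size s1 = q by rewrite size_map.
have ss2 : size s2 = q by rewrite size_map.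
have S1 j (p := nth (0, 0) s1 j) : j < q -> X [:: 0; v; p.1; p.2; ap d1 j].
  by move=> jq; apply: (shareP q1 full l1 R1).
have S2 j (p := nth (0, 0) s2 j) : j < q -> X [:: 0; v; p.1; p.2; ap d2 j].
  by move=> jq; apply/P2E; apply: (shareP q1 full l2 R2).
case: ifP => [/hasP[p1 /(nthP (0, 0))[j1 + <-] /hasP[p2 /(nthP (0, 0))[j2 + <-]]]|_].
  rewrite ss1 ss2 => j1q j2q; case: ifP => // /eqP E /eqP[].
  have := S1 _ j1q; rewrite E => p.
  by have /(congr1 (ap^~ 3)) := cube_uniq mdsX (i := 0) (j := 1) (k := 2) isT isT p (S2 _ j2q) erefl erefl erefl.
case/hasP=> [[p1 l]] /(nthP ((0, 0), [::]))[j1]; rewrite size_zip ss1 sL1 minnn => j1q.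
rewrite nth_zip ?ss1 ?sL1 // => -[<- <-]; set j2 := find _ _ => /hasP[u1 u1in].
case: ifP => // u1v /hasP[u2 u2in].
have j2q : j2 < q by rewrite -sL2; case: ltnP u2in => // /(nth_default [::])->.
have hit : has (fun p2 : nat * nat => eqn (nth (0, 0) s1 j1).1 p2.1) s2 by rewrite has_find ss2.
have /eqP E := nth_find (0, 0) hit; rewrite -/j2 in E.
have := S1 _ j1q; rewrite E => p.
have /(congr1 (ap^~ 4)) /= dE := cube_uniq mdsX (i := 0) (j := 1) (k := 2) isT isT p (S2 _ j2q) erefl erefl erefl.
case: ifP => // /eqP Ey /eqP Ez.
have := plane_linesP q1 full l1 R1 j1q u1in; have := plane_linesP q1 full l2 R2 j2q u2in.
rewrite /wd => /P2E x2; rewrite /P1 Ey Ez dE => x1.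
have /(congr1 (ap^~ 1)) /= E1 := cube_uniq mdsX (i := 2) (j := 3) (k := 4) isT isT x1 x2 erefl erefl erefl.
by rewrite E1 eqn_eqE eqxx in u1v.
Qed.
End NoExtension.

Lemma excluded_reflag q phis i0 i s g : full_phis q phis -> 1 < q -> i0 < size phis ->
  reflag_ok q (nth [::] phis i0) (nth [::] phis i) s g ->
  excluded q phis i0 -> excluded q phis i.
Proof.
move=> full q1 li0 /and4P[ps /eqP sg pg /allP ok] ex X mdsX cont.
have q0 := ltnW q1; have [_ okphi] := full_phi full li0.
have ss : size s = 4 by rewrite (perm_size ps) size_iota.
have ls : all (fun a => a < 4) s by rewrite (perm_all _ ps).
have aok : act_ok q 5 (rcons s 4) (rcons g (idx q)).
  rewrite /act_ok all_rcons pg is_perm_idx size_rcons sg /= !andbT; apply/is_permP.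
  by rewrite -cats1 -[iota 0 5]/(iota 0 4 ++ [:: 4]) perm_cat2r.
apply: (ex _ (mds_twist aok mdsX)) => j x y z jq tin.
have [xq yq zq] := points_lt okphi tin.
split; first by rewrite /bounded /= jq xq yq zq q0.
have /ok/hasP[w] : [:: j; x; y; z] \in plane_words q (nth [::] phis i0).
  apply/flattenP; eexists; first by apply/mapP; exists j; rewrite ?mem_iota.
  by apply/mapP; exists (x, y, z).
case/flattenP=> _ /mapP[j' + ->] /mapP[[[x' y'] z'] tin' ->].
rewrite mem_iota eqsE => j'q /eqP E.
suff -> : wact 5 (rcons s 4) (rcons g (idx q)) [:: j; x; y; z; 0] = [:: j'; x'; y'; z'; 0].
  exact: cont.
have -> : [:: j'; x'; y'; z'; 0] = rcons (relabel_word s g [:: j; x; y; z]) 0 by rewrite E.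
case: s ss ls {ps ok aok E} => [|a [|b [|c [|d []]]]] // _ /= /and5P[la lb lc ld _].
case: g sg {pg} => [|g0 [|g1 [|g2 [|g3 []]]]] // _.
rewrite /wact /relabel_word /= ap_iota //.
have nE n : n < 4 -> ap [:: j; x; y; z; 0] n = ap [:: j; x; y; z] n by case: n => [|[|[|[|]]]].
by rewrite !nE.
Qed.

(** * Linear planes over a prime field *)

Definition tn (T : Type) (t : T * T * T) p := nth t.2 [:: t.1.1; t.1.2; t.2] p.

Lemma tn_pm f p p' : p < 3 -> p' < 3 -> p != p' -> exists s s',
  [/\ s < 3, s' < 3, s != s' & forall t : tri, tn (pm f t) p = tn t s /\ tn (pm f t) p' = tn t s'].
Proof.
move=> lp lp' ne; exists (tn (pm f (0, 1, 2)) p), (tn (pm f (0, 1, 2)) p').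
by case: f => [|[|[|[|[|f]]]]]; case: p lp ne => [|[|[|]]] // _; case: p' lp' => [|[|[|]]] // _ _;
  split=> // -[[]].
Qed.

Section LinearPlane.
Variable q : nat.
Hypothesis qpr : prime q.
Local Open Scope ring_scope.
Let q1 : (1 < q)%N := prime_gt1 qpr.
Let q0 : (0 < q)%N := ltnW q1.

Lemma natF_inj (x y : nat) : (x < q)%N -> (y < q)%N -> x%:R = y%:R :> 'F_q -> x = y.
Proof.
by move=> xq yq /(congr1 (fun z : 'F_q => z : nat)); rewrite !val_Fp_nat // !modn_small.
Qed.

Lemma qF0 : q%:R = 0 :> 'F_q. Proof. exact: pchar_Fp_0. Qed.

Lemma linear_line nu j x y z : (j < q)%N -> (nu <= q.+1)%N ->
  (x, y, z) \in points q (line_of q (linear_plane q nu) j) ->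
  x%:R - y%:R = j%:R :> 'F_q /\ z%:R = nu%:R * x%:R + (1 - nu%:R) * y%:R :> 'F_q.
Proof.
move=> jq nuq; rewrite mem_points => /and3P[xq /eqP-> /eqP->].
case: j jq => [|j] jq /=.
  by rewrite ap_iota // subrr; split=> //; ring.
rewrite (nth_map 0%N) ?size_iota -1?ltnS ?prednK // nth_iota -1?ltnS ?prednK //=.
rewrite !(nth_map 0%N) ?size_iota // !nth_iota // add0n add1n !Fp_nat_mod //.
rewrite !(natrD, natrM, natrB) ?(ltnW jq) // -[q.+1%:R]natr1 qF0; split; ring.
Qed.

Lemma linear_diff nu p p' : (nu <= q.+1)%N -> nu%:R != 0 :> 'F_q -> nu%:R != 1 :> 'F_q ->
  (p < 3)%N -> (p' < 3)%N -> p != p' ->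
  exists2 c : 'F_q, c != 0 & forall j t, (j < q)%N ->
    t \in points q (line_of q (linear_plane q nu) j) ->
    (tn t p)%:R - (tn t p')%:R = c * j%:R :> 'F_q.
Proof.
move=> nuq n0 n1 lp lp' ne.
(* On line [j] the coordinates are [y + e s * j], and the values 1, 0, [nu] of [e] are distinct. *)
pose e (s : nat) : 'F_q := nth 0 [:: 1; 0; nu%:R] s.
exists (e p - e p').
  case: p p' lp lp' ne => [|[|[|]]] //; case=> [|[|[|]]] // _ _ _; rewrite /e /=;
  by rewrite ?subr0 ?sub0r ?oppr_eq0 ?oner_eq0 // subr_eq0 // eq_sym.
move=> j [[x y] z] jq /(linear_line jq nuq)[<- E].
by case: p p' lp lp' ne => [|[|[|]]] //; case=> [|[|[|]]] // _ _ _; rewrite /e /= ?E; ring.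
Qed.
End LinearPlane.

(** * Labels of a cube *)

Definition label_inj q (u : nat -> 'F_q) :=
  forall x y, x < q -> y < q -> u x = u y -> x = y.

(** The slices [ap w 4 = a] and [ap w 0 = b] meet in a line; the labels [u1] and [u2] serve both.
    Separate [u0] and [u0'] allow for the scalar that depends on the pair of coordinates
    compared. *)
Definition cube_linear q (X : seq nat -> Prop) a b : Prop :=
  exists u0 u0' u1 u2 u3 u4 : nat -> 'F_q,
  [/\ label_inj u0, label_inj u0', label_inj u1, label_inj u2 & label_inj u3 /\ label_inj u4] /\
  forall w, X w ->
    [/\ (ap w 4 = a -> u1 (ap w 1) - u2 (ap w 2) = u0 (ap w 0))%R,
        (ap w 4 = a -> u1 (ap w 1) - u3 (ap w 3) = u0' (ap w 0))%R
      & (ap w 0 = b -> u1 (ap w 1) - u2 (ap w 2) = u4 (ap w 4))%R].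

Section Key.
Variables (q : nat) (phis : seq (seq line)) (nlin : nat) (nu : nat -> nat) (v : nat -> nat).
Hypotheses (qpr : prime q) (full : full_phis q phis).
Hypothesis aff : forall i, nlin <= i < size phis -> affine_invariant q (nth [::] phis i).
Hypothesis nf : forall P B C e0, mds q 4 2 P -> e0 < q -> is_perm q B -> is_perm q C ->
  (forall a, a < q -> P [:: a; ap B a; ap C a; e0]) -> normal_plane q phis P (B, C) e0.
Hypothesis lin : forall i, nlin <= i < size phis ->
  [/\ nth [::] phis i = linear_plane q (nu i), nu i <= q.+1,
      ((nu i)%:R != 0 :> 'F_q)%R & ((nu i)%:R != 1 :> 'F_q)%R].
Hypothesis excl : forall i, i < nlin -> excluded q phis i.
Hypothesis noext : forall i, nlin <= i < size phis -> v i < q /\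
  no_extension q phis nlin i (v i) nlin (fun t => eqs t (iota 0 q)).
Let q1 : 1 < q := prime_gt1 qpr.
Let q0 : 0 < q := ltnW q1.

Local Open Scope ring_scope.

(** The slice [x1 = 0] is realised with the identity as relabelling, so it is linear in the very
    labels of [x2], [x3], [x4] that serve the plane [x5 = 0]. The positions are left arbitrary
    because passing to a normal form permutes these three coordinates. *)
Lemma key_contained X i p p' p2 : mds q 5 3 X -> (i < size phis)%N -> contains q phis i X ->
  (p < 3)%N -> (p' < 3)%N -> (p2 < 3)%N -> p != p' -> p != p2 ->
  exists (c c2 c' : 'F_q) d, [/\ c != 0, c2 != 0, c' != 0, is_perm q d &
    forall w, X w -> [/\
      ap w 4 = 0%N -> (ap w p.+1)%:R - (ap w p'.+1)%:R = c * (ap w 0)%:R,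
      ap w 4 = 0%N -> (ap w p.+1)%:R - (ap w p2.+1)%:R = c2 * (ap w 0)%:R
    & ap w 0 = 0%N -> (ap w p.+1)%:R - (ap w p'.+1)%:R = c' * (index (ap w 4) d)%:R]].
Proof.
move=> mdsX li cont lp lp' lp2 ne ne2.
have lin_i : (nlin <= i < size phis)%N.
  by rewrite li andbT leqNgt; apply/negP => /excl /(_ X mdsX); apply.
have [vq noe] := noext lin_i.
have [i' [f [tau [d [li' lf R d0]]]]] :=
  no_extension_sound q1 full aff nf mdsX li vq cont excl noe.
rewrite eqsE => /eqP tauE; have [ptau pd RP] := R; have [_ lti'] := andP li'.
have [phiE nuq n0 n1] := lin lin_i; have [phiE' nuq' n0' n1'] := lin li'.
have [c c0 cE] := linear_diff qpr nuq n0 n1 lp lp' ne.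
have [c2 c20 c2E] := linear_diff qpr nuq n0 n1 lp lp2 ne2.
have [s [s' [ls ls' nes sE]]] := tn_pm f lp lp' ne.
have [c' c0' cE'] := linear_diff qpr nuq' n0' n1' ls ls' nes.
exists c, c2, c', d; split=> // w Xw.
have [sw lw] := cube_lt mdsX Xw; case: w sw Xw lw => [|j [|x [|y [|z [|e []]]]]] // _ Xw lw.
have jq : (j < q)%N := lw 0%N isT; have xq : (x < q)%N := lw 1%N isT.
have eq : (e < q)%N := lw 4%N isT.
have tnE n : (n < 3)%N -> ap [:: j; x; y; z; e] n.+1 = tn (x, y, z) n.
  by case: n => [|[|[|n]]].
rewrite (tnE p) // (tnE p') // (tnE p2) //=.
have onl : e = 0%N -> (x, y, z) \in points q (line_of q (nth [::] phis i) j).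
  move=> E0; subst; rewrite mem_points xq /=.
  set l := line_of _ _ _; have tin : (x, ap l.1 x, ap l.2 x) \in points q l by rewrite mem_points xq !eqxx.
  have := cont _ _ _ _ jq tin => p1.
  have := cube_uniq mdsX (i := 0) (j := 1) (k := 4) isT isT Xw p1 erefl erefl erefl.
  by case=> <- <-; rewrite !eqxx.
rewrite phiE in onl; split=> E0; [exact: cE (onl E0) | exact: c2E (onl E0) |subst].
have jq' := perm_tab_index_lt pd eq; set jj := index e d.
have [t tin tE] := line_hit full lti' R jj xq.
have := RP jj t jq' tin; rewrite (perm_tab_index pd eq).
have [_ ok] := full_phi full lti'.
have iE : img f (iota 0 q) (diag q) t = pm f t.
  case: (t) tin => [[x1 y1] z1] /(points_lt ok)[xq1 yq1 zq1]; rewrite imgE.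
  have := @pmP _ (fun x => x < q)%N f _ _ _ xq1 yq1 zq1.
  by case: (pm f _) => [[x' y'] z'] [xq' yq' zq'] /=; rewrite !ap_iota ?ap_iota.
rewrite iE in tE *; rewrite /wd tE => p1.
have := cube_uniq mdsX (i := 0) (j := 1) (k := 4) isT isT Xw p1 erefl erefl erefl.
case=> yE zE; have -> : (x, y, z) = pm f t by rewrite yE zE -{1}tE -!surjective_pairing.
by have [-> ->] := sE t; apply: cE' => //; rewrite -phiE'.
Qed.

Definition swap04 X := twist 5 q [:: 4; 1; 2; 3; 0]%N (nseq 5 (idx q)) X.

Lemma swap04E X x a y z e : mds q 5 3 X ->
  swap04 X [:: a; x; y; z; e] <-> X [:: e; x; y; z; a].
Proof.
move=> mdsX; split=> [[b]|p].
  have [_ lt] := boundedP b.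
  by rewrite /wact /= !(ap_iota (lt 0%N isT), ap_iota (lt 1%N isT), ap_iota (lt 2%N isT),
    ap_iota (lt 3%N isT), ap_iota (lt 4%N isT)).
have [_ lt] := cube_lt mdsX p; split.
  by apply: boundedI => // -[|[|[|[|[|]]]]] //= _;
     [apply: (lt 4%N) | apply: (lt 1%N) | apply: (lt 2%N) | apply: (lt 3%N) | apply: (lt 0%N)].
by rewrite /wact /= !(ap_iota (lt 0%N isT), ap_iota (lt 1%N isT), ap_iota (lt 2%N isT),
    ap_iota (lt 3%N isT), ap_iota (lt 4%N isT)).
Qed.

Lemma cube_labels X a b : mds q 5 3 X -> (a < q)%N -> (b < q)%N -> cube_linear q X a b.
Proof.
move=> mdsX aq bq.
pose P w := swap04 X (a :: w).
have mdsP : mds q 4 2 P.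
  by apply: mds_slice => //; apply: mds_twist; rewrite // /act_ok /= !is_perm_idx.
have [B [C [pB pC P0]]] := tables mdsP bq.
have [i [f [tau [d [li lf R d0]]]]] := nf mdsP bq pB pC P0.
have [|s012 sE] := contains_slice4 (m := (B, C)) q1 full li pB pC R aq (X := X) _.
  by move=> x y z e /(swap04E _ _ _ _ _ mdsX).
set s := [:: 0%N; _; _; _; _]; set g := [:: d; _; _; _; _] => /= -[ok cont].
have [ptau pd _] := R.
have [l0 l1 l2 [ne ne2]] : [/\ (s012.1.1.-1 < 3)%N, (s012.1.2.-1 < 3)%N, (s012.2.-1 < 3)%N &
    s012.1.1.-1 != s012.1.2.-1 /\ s012.1.1.-1 != s012.2.-1].
  by rewrite sE; case: (f) => [|[|[|[|[|]]]]].
have [e0 e1 e2] : [/\ s012.1.1.-1.+1 = s012.1.1, s012.1.2.-1.+1 = s012.1.2 & s012.2.-1.+1 = s012.2].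
  by rewrite sE; case: (f) => [|[|[|[|[|]]]]].
have [c [c2 [c' [d' [c0 c20 c0' pd' cE]]]]] :=
  key_contained (mds_twist ok mdsX) li cont l0 l1 l2 ne ne2.
rewrite e0 e1 e2 in cE.
have pt0 : is_perm q (compt (idx q) tau) by apply: is_perm_compt; rewrite ?is_perm_idx.
have pt1 : is_perm q (compt B tau) by apply: is_perm_compt.
have pt2 : is_perm q (compt C tau) by apply: is_perm_compt.
have psw := is_perm_swapt aq.
have idx_inj t : is_perm q t -> label_inj (fun n => (index n t)%:R : 'F_q).
  move=> pt x y xq yq /natF_inj E; rewrite -(perm_tab_index pt xq) E ?(perm_tab_index pt) //;
  exact: perm_tab_index_lt.
exists (fun n => c * (index n d)%:R), (fun n => c2 * (index n d)%:R),
  (fun n => (index n (compt (idx q) tau))%:R), (fun n => (index n (compt B tau))%:R),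
  (fun n => (index n (compt C tau))%:R), (fun n => c' * (index (index n (swapt q a)) d')%:R).
split.
  split; try exact: idx_inj.
  - by move=> x y xq yq /(mulfI c0); apply: idx_inj.
  - by move=> x y xq yq /(mulfI c20); apply: idx_inj.
  split; first exact: idx_inj.
  move=> x y xq yq /(mulfI c0') /(idx_inj _ pd') E.
  rewrite -(perm_tab_index psw xq) E ?(perm_tab_index psw) //; exact: perm_tab_index_lt.
move=> u Xu; have bu : bounded 5 q u by case: mdsX => bX _ _; apply: bX.
have [w bw wE] := wact_surj ok bu.
have [sw lw] := boundedP bw.
have /cE[E4 E42 E0] : twist 5 q s g X w by split=> //; rewrite wE.
have ls0 : (s012.1.1 < 5)%N by rewrite -e0 ltnS (leq_trans l0).
have ls1 : (s012.1.2 < 5)%N by rewrite -e1 ltnS (leq_trans l1).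
have ls2 : (s012.2 < 5)%N by rewrite -e2 ltnS (leq_trans l2).
have uE n : (n < 5)%N -> ap u n = ap (nth [::] g n) (ap w (ap s n)).
  by move=> ln; rewrite -wE ap_act.
rewrite (uE 0%N) // (uE 1%N) // (uE 2%N) // (uE 3%N) // (uE 4%N) //=.
rewrite (perm_tab_indexK pt0) ?lw // (perm_tab_indexK pt1) ?lw // (perm_tab_indexK pt2) ?lw //.
rewrite (perm_tab_indexK pd) ?lw // (perm_tab_indexK psw) ?lw //.
(* The twist takes the last symbol 0 to [a] by the transposition, and the first symbol 0 to [b] by
   [d0]. *)
split=> E; [apply: E4 | apply: E42 | apply: E0].
- by apply: (perm_tab_inj psw); rewrite ?lw // ap_swapt.
- by apply: (perm_tab_inj psw); rewrite ?lw // ap_swapt.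
by apply: (perm_tab_inj pd); rewrite ?lw // E d0.
Qed.
End Key.

(** * Evaluation of the searches *)

Section Blocks.
Variables (q : nat) (phis : seq (seq line)) (nlin : nat).
Hypotheses (q1 : 1 < q) (full : full_phis q phis).
Hypothesis aff : forall i, nlin <= i < size phis -> affine_invariant q (nth [::] phis i).
Hypothesis nf : forall P B C e0, mds q 4 2 P -> e0 < q -> is_perm q B -> is_perm q C ->
  (forall a, a < q -> P [:: a; ap B a; ap C a; e0]) -> normal_plane q phis P (B, C) e0.

(** By the exclusion of smaller indices the slices to be searched realise forms from [k] on only, so
    blocks have to be treated in increasing order. The other members of a block are equivalent to
    form [k] as planes. *)
Lemma excluded_block (flags : seq (seq nat * seq (seq nat))) v k k' : k < size phis -> v < q ->
  no_extension q phis nlin k v k (fun=> false) ->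
  all (fun i => let: (s, g) := nth ([::], [::]) flags i in
    reflag_ok q (nth [::] phis k) (nth [::] phis i) s g) (iota k.+1 (k' - k.+1)) ->
  (forall i, i < k -> excluded q phis i) -> forall i, i < k' -> excluded q phis i.
Proof.
move=> lk vq noext /allP flag exk.
have exkk : excluded q phis k.
  move=> X mdsX cont.
  by have [? [? [? [? []]]]] := no_extension_sound q1 full aff nf mdsX lk vq cont exk noext.
move=> i ik'; have [/exk //|ki|->//] := ltngtP i k.
have /flag : i \in iota k.+1 (k' - k.+1) by rewrite mem_iota ki subnKC // (leq_trans ki (ltnW ik')).
by case: (nth _ _ _) => s g ok; apply: excluded_reflag ok exkk.
Qed.
End Blocks.

Lemma wf7 : wf_data 7 phis7 stds7 reps7.
Proof. by vm_cast_no_check (erefl true). Qed.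
Lemma cover7 : rect_cover 7 stds7 [seq r.1.1 | r <- reps7].
Proof. by vm_cast_no_check (erefl true). Qed.
Lemma checked7 : check_reps 7 phis7 stds7 reps7.
Proof. by vm_cast_no_check (erefl true). Qed.
Lemma affine7 : all (affine_invariant 7) (drop 21 phis7).
Proof. by vm_cast_no_check (erefl true). Qed.

(** The level [v] of the second slice is a free parameter of the search; it is 5 here and 0 for the
    other forms. *)
Lemma no_extension7_0 : no_extension 7 phis7 21 0 5 0 (fun=> false).
Proof. by vm_cast_no_check (erefl true). Qed.
Lemma no_extension7_8 : no_extension 7 phis7 21 8 0 8 (fun=> false).
Proof. by vm_cast_no_check (erefl true). Qed.
Lemma no_extension7_14 : no_extension 7 phis7 21 14 0 14 (fun=> false).
Proof. by vm_cast_no_check (erefl true). Qed.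
Lemma no_extension7_17 : no_extension 7 phis7 21 17 0 17 (fun=> false).
Proof. by vm_cast_no_check (erefl true). Qed.
Lemma no_extension7_19 : no_extension 7 phis7 21 19 0 19 (fun=> false).
Proof. by vm_cast_no_check (erefl true). Qed.
Lemma no_extension7_lin :
  all (fun i => no_extension 7 phis7 21 i 0 21 (fun t => eqs t (iota 0 7))) [:: 21; 22].
Proof. by vm_cast_no_check (erefl true). Qed.

Lemma cube_labels7 X a b : mds 7 5 3 X -> a < 7 -> b < 7 -> cube_linear 7 X a b.
Proof.
have q1 : 1 < 7 by [].
have full : full_phis 7 phis7 by case/and3P: wf7.
have aff i : 21 <= i < size phis7 -> affine_invariant 7 (nth [::] phis7 i).
  case/andP=> i21 li; apply: (allP affine7).
  by rewrite -(subnKC i21) -nth_drop mem_nth // size_drop ltn_sub2r.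
have nf := plane_normal_form q1 wf7 cover7 checked7.
have exbl := @excluded_block 7 phis7 21 q1 full aff nf reflags7.
(* The arguments are the level of the second slice, the first index of the block and that of the
   next block. *)
have ex8 := exbl 5 0 8 isT isT no_extension7_0 isT (fun i => False_ind _ \o elimF idP (ltn0 i)).
have ex14 := exbl 0 8 14 isT isT no_extension7_8 isT ex8.
have ex17 := exbl 0 14 17 isT isT no_extension7_14 isT ex14.
have ex19 := exbl 0 17 19 isT isT no_extension7_17 isT ex17.
have ex21 := exbl 0 19 21 isT isT no_extension7_19 isT ex19.
have lin_cases i : 21 <= i < size phis7 -> i = 21 \/ i = 22.
  by do 21?[case: i => [|i] //]; case: i => [|[|i]] //; [left|right].
(* [i - 19] yields the parameters 2 and 3 of the two linear forms. *)
apply: (cube_labels (nlin := 21) (nu := fun i => i - 19) (v := fun=> 0) _ full aff nf _ ex21).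
- by [].
- by move=> i /lin_cases[]->.
move=> i /lin_cases ii; split=> //; apply: (allP no_extension7_lin).
by case: ii => ->.
Qed.

Lemma wf5 : wf_data 5 phis5 stds5 reps5.
Proof. by vm_cast_no_check (erefl true). Qed.
Lemma cover5 : rect_cover 5 stds5 [seq r.1.1 | r <- reps5].
Proof. by vm_cast_no_check (erefl true). Qed.
Lemma checked5 : check_reps 5 phis5 stds5 reps5.
Proof. by vm_cast_no_check (erefl true). Qed.
Lemma affine5 : affine_invariant 5 (nth [::] phis5 0).
Proof. by vm_cast_no_check (erefl true). Qed.
Lemma no_extension5 : no_extension 5 phis5 0 0 0 0 (fun t => eqs t (iota 0 5)).
Proof. by vm_cast_no_check (erefl true). Qed.

Lemma cube_labels5 X a b : mds 5 5 3 X -> a < 5 -> b < 5 -> cube_linear 5 X a b.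
Proof.
have q1 : 1 < 5 by [].
have full : full_phis 5 phis5 by case/and3P: wf5.
have zero i : 0 <= i < size phis5 -> i = 0 by case: i.
apply: (cube_labels (nlin := 0) (nu := fun=> 2) (v := fun=> 0) _ full) => //.
- by move=> i /zero->; apply: affine5.
- exact: (plane_normal_form q1 wf5 cover5 checked5).
- by move=> i /zero->.
by move=> i /zero->; split=> //; apply: no_extension5.
Qed.

(** * Gluing the labels of a code *)

Section AffineLabels.
Local Open Scope ring_scope.
Variables (q : nat).
Hypothesis qpr : prime q.
Notation F := 'F_q.

Lemma val_F_lt (a : F) : (a < q)%N.
Proof. by rewrite -[X in (_ < X)%N](Fp_cast qpr). Qed.

(** Writing one argument as a sum in several ways shows that [f - f 0] is additive, and each element
    of a prime field is a multiple of 1. *)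
Lemma affine_of_split (f g phi : F -> F) : (forall a b, phi (a + b) = f a + g b) ->
  forall a, f a = (f 1 - f 0) * a + f 0.
Proof.
move=> split_phi.
have fD a b : f (a + b) = f a + (f b - f 0).
  have E1 := split_phi a b; have E2 := split_phi (a + b) 0.
  have E3 := split_phi 0 b; have E4 := split_phi b 0.
  rewrite addr0 in E2; rewrite addr0 in E4; rewrite add0r in E3.
  have -> : f (a + b) = f a + g b - g 0 by rewrite -E1 E2; ring.
  have -> : g b = f b + g 0 - f 0 by rewrite -E4 E3; ring.
  by ring.
move=> a; rewrite -[a]natr_Zp; elim: (nat_of_ord a) => [|n IHn]; first by rewrite mulr0 add0r.
by rewrite -natr1 fD IHn; ring.
Qed.

Definition aeq (l l1 : F -> F) : Prop :=
  exists al be, al != 0 /\ forall a, l1 a = al * l a + be.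

Lemma aeq_trans l1 l l2 : aeq l l1 -> aeq l1 l2 -> aeq l l2.
Proof.
case=> al [be [al0 E]] [al' [be' [al0' E']]].
exists (al' * al), (al' * be + be'); rewrite mulf_neq0 //; split=> // a.
by rewrite E' E; ring.
Qed.

(** In the coordinates [l a] and [m b] the first relation is addition, so the second splits
    [t1 (t' (a + b))]; [l1] and [t1] get the same slope. *)
Lemma aeq_of_split (l m t l1 m1 t1 : F -> F) (pt : F -> F -> F) :
  injective l -> injective m -> injective t -> injective l1 ->
  (forall a b, l a + m b = t (pt a b)) -> (forall a b, l1 a + m1 b = t1 (pt a b)) ->
  aeq l l1 /\ aeq t t1.
Proof.
move=> /injF_bij[l' lK l'K] /injF_bij[m' mK m'K] /injF_bij[t' tK t'K] il1 E E1.
have S a b : t1 (t' (a + b)) = l1 (l' a) + m1 (m' b).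
  by rewrite -{1}(l'K a) -{1}(m'K b) E tK E1.
pose al := l1 (l' 1) - l1 (l' 0).
have fE a : l1 (l' a) = al * a + l1 (l' 0).
  exact: (@affine_of_split (fun a => l1 (l' a)) (fun b => m1 (m' b)) (fun c => t1 (t' c)) S).
have al0 : al != 0.
  rewrite subr_eq0; apply/eqP => /il1/(congr1 l); rewrite !l'K => /eqP.
  by rewrite oner_eq0.
split; first by exists al, (l1 (l' 0)); split=> // a; rewrite -[in LHS](lK a) fE.
exists al, (l1 (l' 0) + m1 (m' 0)); split=> // a.
by rewrite -[in LHS](tK a) -[t a in LHS]addr0 S fE; ring.
Qed.
End AffineLabels.

(** * Information symbols and cubes of a code *)

Section Gluing.
Local Open Scope ring_scope.
Variables (q n k : nat) (C : {set 'rV['F_q]_n}).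
Notation F := 'F_q.
Hypotheses (qpr : prime q) (k3 : (3 <= k)%N) (kn : (k.+1 < n)%N).
Hypothesis cubes : forall X a b, mds q 5 3 X -> (a < q)%N -> (b < q)%N -> cube_linear q X a b.
Hypothesis cardC : #|C| = (q ^ k)%N.
Hypothesis uniqC : forall (J : {set 'I_n}) x y, #|J| = k -> x \in C -> y \in C ->
  (forall j, j \in J -> x 0 j = y 0 j) -> x = y.

(** Restriction to [J] is injective on [C], and there are as many codewords as tuples on [J]. A
    tuple is stored as a function vanishing off [J]. *)
Lemma code_ex (J : {set 'I_n}) (f : 'I_n -> F) : #|J| = k ->
  exists2 x, x \in C & forall j, j \in J -> x 0 j = f j.
Proof.
move=> cJ; pose g (x : 'rV[F]_n) := [ffun j => if j \in J then x 0 j else 0].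
have ginj : {in C &, injective g}.
  move=> x y xC yC /ffunP gxy; apply: (uniqC cJ xC yC) => j jJ.
  by have := gxy j; rewrite !ffunE jJ.
have gsub : g @: C \subset pffun_on 0 (mem J) predT.
  apply/subsetP => _ /imsetP[x xC ->]; apply/pffun_onP; split=> [|a //].
  by apply/subsetP => j; rewrite inE ffunE; case: ifP; rewrite ?eqxx.
have /subset_cardP : #|g @: C| = #|pffun_on (0 : F) (mem J) predT|.
  by rewrite card_in_imset // card_pffun_on cardC cJ cardT -cardE card_Fp.
move=> /(_ gsub)/(_ [ffun j => if j \in J then f j else 0]).
have -> : [ffun j => if j \in J then f j else 0] \in pffun_on 0 (mem J) predT.
  apply/pffun_onP; split=> [|a //].
  by apply/subsetP => j; rewrite inE ffunE; case: ifP; rewrite ?eqxx.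
case/imsetP=> x xC /ffunP E; exists x => // j jJ.
by have := E j; rewrite !ffunE jJ.
Qed.

(** Any three of the five coordinates complete [K] to [k] positions, to which [uniqC] and [code_ex]
    apply. *)
Lemma mds_cube (cs : seq 'I_n) (K : {set 'I_n}) (x0 : 'rV[F]_n) :
  size cs = 5 -> uniq cs -> (#|K| + 3)%N = k -> {in cs, forall c, c \notin K} ->
  mds q 5 3 (fun w => exists x, [/\ x \in C, forall c, c \in K -> x 0 c = x0 0 c
    & w = [seq (x 0 c : nat) | c <- cs]]).
Proof.
move=> scs Ucs cK dK.
have [c0 _] : exists c0, c0 \in cs by case: cs scs {Ucs dK} => // c s _; exists c; rewrite mem_head.
pose S (I : seq nat) := K :|: [set c in [seq nth c0 cs i | i <- I]].
have cardS I : uniq I -> size I = 3 -> all (fun i => i < 5)%N I -> #|S I| = k.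
  move=> UI sI /allP lI; rewrite cardsU.
  have -> : K :&: [set c in [seq nth c0 cs i | i <- I]] = set0.
    apply/setP => c; rewrite !inE; apply/negP => /andP[cK' /mapP[i Ii E]].
    by have := dK c; rewrite E mem_nth ?scs ?lI // -E cK' => /(_ isT).
  rewrite cards0 subn0 cardsE; have /card_uniqP -> : uniq [seq nth c0 cs i | i <- I].
    rewrite map_inj_in_uniq // => i j /lI li /lI lj /eqP.
    by rewrite nth_uniq ?scs // => /eqP.
  by rewrite size_map sI.
have apE (x : 'rV[F]_n) i : (i < 5)%N ->
    ap [seq (x 0 c : nat) | c <- cs] i = x 0 (nth c0 cs i).
  by move=> li; rewrite (nth_map c0) ?scs.
split=> [_ [x [_ _ ->]]|I _ _ UI sI lI [x [xC xK ->]] [y [yC yK ->]] E|I f UI sI lI lf].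
- by rewrite size_map scs eqxx all_map; apply/allP => c _ /=; apply: val_F_lt.
- suff -> : x = y by [].
  apply: (uniqC (cardS I UI sI lI) xC yC) => c; rewrite !inE => /orP[cin|/mapP[i Ii ->]].
    by rewrite xK // yK.
  by have li := allP lI i Ii; have := E i Ii; rewrite !apE // => /val_inj.
have [x xC xE] := code_ex (fun c => if c \in K then x0 0 c else (f (index c cs))%:R)
  (cardS I UI sI lI).
exists [seq (x 0 c : nat) | c <- cs].
  by exists x; split=> // c cin; rewrite xE ?inE cin.
move=> i Ii; have li := allP lI i Ii; rewrite apE // xE; last first.
  by rewrite !inE map_f ?orbT.
rewrite (negbTE (dK _ _)) ?mem_nth ?scs // index_uniq ?scs //.
by rewrite val_Fp_nat // modn_small // lf.
Qed.

Definition info (i : 'I_n) := (i < k)%N.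

Lemma card_info : #|[set i | info i]| = k.
Proof.
have le : (k <= n)%N by rewrite (leq_trans _ kn) // leqW.
have -> : [set i | info i] = widen_ord le @: setT.
  apply/setP => i; rewrite inE; apply/idP/imsetP => [li|[j _ ->]]; last exact: (ltn_ord j).
  by exists (Ordinal li); rewrite ?inE //; apply: val_inj.
rewrite card_imset ?cardsT ?card_ord // => a b /(congr1 (@nat_of_ord n)).
by move=> E; apply: ord_inj; exact: E.
Qed.

Lemma info_uniq x y : x \in C -> y \in C -> (forall j, info j -> x 0 j = y 0 j) -> x = y.
Proof. by move=> xC yC E; apply: (uniqC card_info) => // j; rewrite inE; apply: E. Qed.

Lemma info_ex f : exists2 x, x \in C & forall j, info j -> x 0 j = f j.
Proof.
have [x xC xE] := code_ex f card_info; exists x => // j ij; apply: xE.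
by rewrite inE.
Qed.

Definition off (i : 'I_n) (x y : 'rV[F]_n) := forall j, info j -> j != i -> x 0 j = y 0 j.

Lemma info_set x i a : x \in C -> info i -> exists y, [/\ y \in C, y 0 i = a & off i y x].
Proof.
move=> xC ii; have [y yC yE] := info_ex (fun j => if j == i then a else x 0 j).
exists y; split=> // [|j ij nji]; rewrite yE ?eqxx //.
by rewrite (negbTE nji).
Qed.

(* Any codeword is joined to [x0] by changing one information symbol at a time
   into the corresponding symbol of [x0]. *)
Lemma info_ind (Q : 'rV[F]_n -> Prop) x0 : x0 \in C -> Q x0 ->
  (forall x z i, x \in C -> z \in C -> info i -> off i x z -> z 0 i = x0 0 i -> Q z -> Q x) ->
  forall x, x \in C -> Q x.
Proof.
move=> x0C Q0 step.
suff all_m m : (m <= k)%N -> forall x, x \in C ->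
    (forall j : 'I_n, (m <= j)%N -> info j -> x 0 j = x0 0 j) -> Q x.
  by move=> x xC; apply: (all_m k) => // j; rewrite leqNgt => /negP.
elim: m => [|m IHm] lm x xC xE.
  by rewrite (info_uniq xC x0C) // => j; apply: xE.
have mn : (m < n)%N by rewrite (leq_trans lm) // (leq_trans _ kn) // leqW.
pose i := Ordinal mn; have ii : info i by [].
have [z [zC zi zx]] := info_set (x0 0 i) xC ii.
apply: (step x z i) => // [j ij nji|]; first by rewrite zx.
apply: IHm => // [|j mj ij]; first exact: ltnW.
have [->//|nji] := eqVneq j i; rewrite zx // xE // ltn_neqAle mj andbT.
by apply: contra nji => /eqP E; apply/eqP/val_inj.
Qed.

(** * Comparison of labels in adjacent planes *)

Definition in_plane (i j : 'I_n) (x y : 'rV[F]_n) :=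
  forall c, info c -> c != i -> c != j -> y 0 c = x 0 c.

Definition rel_plane x i j p (l m t : F -> F) : Prop :=
  [/\ injective l, injective m, injective t
    & forall y, y \in C -> in_plane i j x y -> l (y 0 i) + m (y 0 j) = t (y 0 p)].

Lemma rel_planeC x i j p l m t : rel_plane x i j p l m t -> rel_plane x j i p m l t.
Proof.
case=> il im it E; split=> // y yC yx; rewrite addrC E // => c ic ni nj; exact: yx.
Qed.

(** The plane through [x0] in directions [i], [j] and the one through [x1] in directions [i], [h]
    lie in one cube and meet in a line along [i]. *)
Lemma adjacent_planes x0 x1 i j h p p' : x0 \in C -> x1 \in C ->
  info i -> info j -> info h -> i != j -> i != h -> j != h ->
  ~~ info p -> ~~ info p' -> p != p' ->
  (forall c, info c -> c != i -> c != j -> c != h -> x1 0 c = x0 0 c) ->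
  exists l m m' m2 t t2, [/\ rel_plane x0 i j p l m t, rel_plane x1 i h p l m' t
    & rel_plane x0 i j p' l m2 t2].
Proof.
move=> x0C x1C ii ij ih nij nih njh ip ip' npp x01.
(* [i] and [p] take positions 1 and 2, whose labels are common to both slices in [cube_linear]. The
   slices fix [h] as in [x0] and [j] as in [x1]. *)
pose cs := [:: j; i; p; p'; h]; pose K := [set c | info c] :\: [set i; j; h].
have pn c d : info c -> ~~ info d -> c != d by move=> ic; apply: contra => /eqP <-.
have Ucs : uniq cs.
  rewrite /= !inE !negb_or (eq_sym j i) (eq_sym p h) (eq_sym p' h) nij njh nih npp.
  by rewrite (pn j p) // (pn j p') // (pn i p) // (pn i p') // (pn h p) // (pn h p').
have cardK : (#|K| + 3)%N = k.
  have sub : [set i; j; h] \subset [set c | info c].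
    by apply/subsetP => c; rewrite !inE => /orP[/orP[]|] /eqP->.
  have c3 : #|[set i; j; h]| = 3%N.
    by rewrite -setUA cardsU1 cards2 njh !inE negb_or nij nih.
  rewrite cardsD (setIidPr sub) c3 card_info subnK //.
have dK : {in cs, forall c, c \notin K}.
  move=> c; rewrite !inE => /or4P[/eqP->|/eqP->|/eqP->|/orP[]/eqP->]; rewrite ?eqxx ?orbT //.
    by rewrite (negbTE ip) andbF.
  by rewrite (negbTE ip') andbF.
have [u0 [u0' [u1 [u2 [u3 [u4 [[i0 i0' i1 i2 [i3 i4]] E]]]]]]] :=
  cubes (mds_cube (cs := cs) x0 erefl Ucs cardK dK) (val_F_lt qpr (x0 0 h)) (val_F_lt qpr (x1 0 j)).
have inj (u : nat -> F) : label_inj u -> injective (fun a : F => u a).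
  by move=> iu a b /(iu _ _ (val_F_lt qpr a) (val_F_lt qpr b)) /val_inj.
have injN (u : nat -> F) : label_inj u -> injective (fun a : F => - u a).
  by move=> iu a b /oppr_inj; apply: inj.
have KP c : c \in K -> [/\ info c, c != i, c != j & c != h].
  by rewrite !inE !negb_or -!andbA => /and4P[-> -> -> ->].
exists (fun a => u1 a), (fun a => - u0 a), (fun a => - u4 a), (fun a => - u0' a),
  (fun a => u2 a), (fun a => u3 a).
split; split; try exact: inj; try exact: injN; move=> y yC yx.
- have [|E1 _ _] := E [seq (y 0 c : nat) | c <- cs].
    by exists y; split=> // c /KP[ic ni nj nh]; apply: yx.
  have yh : y 0 h = x0 0 h by apply: yx; rewrite // eq_sym.
  by rewrite -E1 /= ?yh //; ring.
- have [|_ _ E1] := E [seq (y 0 c : nat) | c <- cs].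
    by exists y; split=> // c /KP[ic ni nj nh]; rewrite -x01 //; apply: yx.
  have yj : y 0 j = x1 0 j by apply: yx; rewrite // eq_sym.
  by rewrite -E1 /= ?yj //; ring.
have [|_ E1 _] := E [seq (y 0 c : nat) | c <- cs].
  by exists y; split=> // c /KP[ic ni nj nh]; apply: yx.
have yh : y 0 h = x0 0 h by apply: yx; rewrite // eq_sym.
by rewrite -E1 /= ?yh //; ring.
Qed.

Lemma rel_plane_uniq x i j p l m t l1 m1 t1 : x \in C -> info i -> info j -> i != j ->
  rel_plane x i j p l m t -> rel_plane x i j p l1 m1 t1 -> aeq l l1 /\ aeq t t1.
Proof.
move=> xC ii ij nij [il im it E] [il1 im1 it1 E1].
have pt ab : exists y, [/\ y \in C, in_plane i j x y, y 0 i = ab.1 & y 0 j = ab.2].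
  have [z [zC zi zx]] := info_set ab.1 xC ii; have [y [yC yj yz]] := info_set ab.2 zC ij.
  exists y; split=> // [c ic ni nj|]; rewrite yz //; exact: zx.
have [Y YP] := fin_all_exists pt.
apply: (@aeq_of_split _ l m t l1 m1 t1 (fun a b => Y (a, b) 0 p)) => // a b.
  have [yC yx yi yj] := YP (a, b).
  by have := E _ yC yx; rewrite yi yj.
have [yC yx yi yj] := YP (a, b).
by have := E1 _ yC yx; rewrite yi yj.
Qed.

Lemma other_info i j : exists2 h, info h & (i != h) && (j != h).
Proof.
have n3 : (2 < n)%N by rewrite (leq_trans k3) // (leq_trans _ kn) // leqW.
pose o m (lm : (m < 3)%N) := Ordinal (leq_trans lm n3).
have oi m (lm : (m < 3)%N) : info (o m lm) by apply: leq_trans lm k3.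
have [[E0|E0] [E1|E1]] : ((i != o 0 isT) && (j != o 0 isT) \/ (i == o 0 isT) || (j == o 0 isT)) /\
    ((i != o 1 isT) && (j != o 1 isT) \/ (i == o 1 isT) || (j == o 1 isT)).
  by split; rewrite -negb_or; case: (_ || _); [right|left|right|left].
- by exists (o 0 isT).
- by exists (o 0 isT).
- by exists (o 1 isT).
exists (o 2 isT) => //.
by case/orP: E0 => /eqP E0; case/orP: E1 => /eqP E1; rewrite ?E0 ?E1 //;
  have := congr1 val E1; rewrite E0.
Qed.

(** By [kn] both [k] and [k.+1] are parity positions; here the second parity symbol enters. *)
Lemma other_parity p : exists2 p', ~~ info p' & p != p'.
Proof.
pose a := Ordinal (ltnW kn); pose b := Ordinal kn.
have [->|na] := eqVneq p a; last by exists a; rewrite // /info /= ltnn.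
exists b; first by rewrite /info /= ltnNge leqnSn.
by rewrite -val_eqE /= neq_ltn leqnn.
Qed.

Lemma rel_plane_ex x i j p : x \in C -> info i -> info j -> i != j -> ~~ info p ->
  exists l m t, rel_plane x i j p l m t.
Proof.
move=> xC ii ij nij ip; have [h ih /andP[nih njh]] := other_info i j.
have [p' ip' npp] := other_parity p.
have [l [m [m' [m2 [t [t2 [R _ _]]]]]]] :=
  adjacent_planes xC xC ii ij ih nij nih njh ip ip' npp (fun _ _ _ _ _ => erefl).
by exists l, m, t.
Qed.

(** [adjacent_planes] at a single codeword: rotating the plane about its line along [i] keeps the
    labels of [i] and [p]. *)
Lemma rel_plane_turn x i j j' p l m t l1 m1 t1 : x \in C -> info i -> info j -> info j' ->
  i != j -> i != j' -> ~~ info p ->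
  rel_plane x i j p l m t -> rel_plane x i j' p l1 m1 t1 -> aeq l l1 /\ aeq t t1.
Proof.
move=> xC ii ij ij' nij nij' ip R R1; have [ejj|njj] := eqVneq j j'.
  by rewrite -ejj in R1; apply: rel_plane_uniq R R1.
have [p' ip' npp] := other_parity p.
have [L [M [M' [M2 [T [T2 [S S' _]]]]]]] :=
  adjacent_planes xC xC ii ij ij' nij nij' njj ip ip' npp (fun _ _ _ _ _ => erefl).
have [a b] := rel_plane_uniq xC ii ij nij R S; have [a' b'] := rel_plane_uniq xC ii ij' nij' S' R1.
by split; [apply: aeq_trans a a' | apply: aeq_trans b b'].
Qed.

(** The third relation of [adjacent_planes] changes the parity symbol while keeping [l]. *)
Lemma info_label_uniq x i j j' p p' l m t l1 m1 t1 : x \in C -> info i -> info j -> info j' ->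
  i != j -> i != j' -> ~~ info p -> ~~ info p' ->
  rel_plane x i j p l m t -> rel_plane x i j' p' l1 m1 t1 -> aeq l l1.
Proof.
move=> xC ii ij ij' nij nij' ip ip' R R1; have [epp|npp] := eqVneq p p'.
  by rewrite -epp in R1; case: (rel_plane_turn xC ii ij ij' nij nij' ip R R1).
have [h ih /andP[nih njh]] := other_info i j'.
have [L [M [M' [M2 [T [T2 [S _ S2]]]]]]] :=
  adjacent_planes xC xC ii ij' ih nij' nih njh ip ip' npp (fun _ _ _ _ _ => erefl).
have [a _] := rel_plane_turn xC ii ij ij' nij nij' ip R S.
by have [b _] := rel_plane_uniq xC ii ij' nij' S2 R1; apply: aeq_trans a b.
Qed.

(** For [i != i'], two turns through the plane in directions [i], [i']. *)
Lemma parity_label_uniq x i j i' j' p l m t l1 m1 t1 : x \in C ->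
  info i -> info j -> info i' -> info j' -> i != j -> i' != j' -> ~~ info p ->
  rel_plane x i j p l m t -> rel_plane x i' j' p l1 m1 t1 -> aeq t t1.
Proof.
move=> xC ii ij ii' ij' nij nij' ip R R1; have [eii|nii] := eqVneq i i'.
  by subst i'; have [] := rel_plane_turn xC ii ij ij' nij nij' ip R R1.
have [l2 [m2 [t2 R2]]] := rel_plane_ex xC ii ii' nii ip.
have [_ a] := rel_plane_turn xC ii ij ii' nij nii ip R R2.
have nii' : i' != i by rewrite eq_sym.
have [_ b] := rel_plane_turn xC ii' ii ij' nii' nij' ip (rel_planeC R2) R1.
exact: aeq_trans a b.
Qed.

Lemma global_labels : exists lam : 'I_n -> F -> F, (forall c, injective (lam c)) /\
  forall x i j p l m t, x \in C -> info i -> info j -> i != j -> ~~ info p ->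
    rel_plane x i j p l m t -> [/\ aeq (lam i) l, aeq (lam j) m & aeq (lam p) t].
Proof.
have [x0 x0C _] := info_ex (fun=> 0).
have n2 : (1 < n)%N by rewrite (leq_trans (ltnW k3)) // (leq_trans _ kn) // leqW.
pose o0 := Ordinal (ltnW n2); pose o1 := Ordinal n2; pose p0 := Ordinal (ltnW kn).
have io0 : info o0 by apply: leq_trans k3.
have io1 : info o1 by apply: leq_trans k3.
have ip0 : ~~ info p0 by rewrite /info /= ltnn.
(* At [x0] the label of an information symbol is read off with parity symbol [p0], that of a parity
   symbol in the plane of [o0] and [o1]. By the uniqueness lemmas above other choices give the same
   up to [aeq]. *)
pose spec c (u : F -> F) := if info c then
    exists j m t, [/\ info j, c != j & rel_plane x0 c j p0 u m t]
  else exists l m, rel_plane x0 o0 o1 c l m u.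
have spec_ex c : exists u, spec c u.
  rewrite /spec; case ic: (info c).
    have [j ij /andP[ncj _]] := other_info c c.
    have [l [m [t R]]] := rel_plane_ex x0C ic ij ncj ip0.
    by exists l, j, m, t.
  have [l [m [t R]]] := rel_plane_ex x0C io0 io1 isT (negbT ic : ~~ info c).
  by exists t, l, m.
have [lam lamP] := fin_all_exists spec_ex; exists lam; split.
  move=> c; have := lamP c; rewrite /spec; case: ifP => _.
    by case=> j [m [t [_ _ []]]].
  by case=> l [m []].
suff Q x : x \in C -> forall i j p l m t, info i -> info j -> i != j -> ~~ info p ->
    rel_plane x i j p l m t -> aeq (lam i) l /\ aeq (lam p) t.
  move=> x i j p l m t xC ii ij nij ip R; have [a b] := Q _ xC _ _ _ _ _ _ ii ij nij ip R.
  have nji : j != i by rewrite eq_sym.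
  by have [c _] := Q _ xC _ _ _ _ _ _ ij ii nji ip (rel_planeC R).
move: x; apply: (info_ind x0C) => [i j p l m t ii ij nij ip R|].
  split.
    have := lamP i; rewrite /spec ii => -[j' [m' [t' [ij' nij' R']]]].
    exact: info_label_uniq x0C ii ij' ij nij' nij ip0 ip R' R.
  have := lamP p; rewrite /spec (negbTE ip) => -[l' [m' R']].
  exact: parity_label_uniq x0C io0 io1 ii ij isT nij ip R' R.
move=> x z c xC zC ic xz _ Qz i j p l m t ii ij nij ip R.
(* If [c] is [i] or [j], the planes through [x] and [z] coincide. *)
have [eci|nic] := eqVneq i c; last have [ejc|njc] := eqVneq j c.
- apply: (Qz i j p l m t) => //; case: R => il im it E; split=> // y yC yz; apply: E => // b ib ni nj.
  by rewrite yz // xz // -eci.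
- apply: (Qz i j p l m t) => //; case: R => il im it E; split=> // y yC yz; apply: E => // b ib ni nj.
  by rewrite yz // xz // -ejc.
(* Otherwise the plane of [i], [j] at [x] shares the labels of [i] and [p] with the plane of [i],
   [c] at [z], which the induction hypothesis covers. *)
have [p' ip' npp] := other_parity p.
have [|L [M [M' [M2 [T [T2 [S S' _]]]]]]] :=
  adjacent_planes xC zC ii ij ic nij nic njc ip ip' npp.
  by move=> b ib ni nj nc; rewrite xz.
have [a b] := rel_plane_uniq xC ii ij nij S R.
have [a' b'] := Qz _ _ _ _ _ _ ii ic nic ip S'.
by split; [apply: aeq_trans a' a | apply: aeq_trans b' b].
Qed.

(** * Linearity of the relabelled code *)

Section Labelled.
Variables (lam : 'I_n -> F -> F).
Hypothesis lam_inj : forall c, injective (lam c).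
Hypothesis lamP : forall x i j p l m t, x \in C -> info i -> info j -> i != j -> ~~ info p ->
  rel_plane x i j p l m t -> [/\ aeq (lam i) l, aeq (lam j) m & aeq (lam p) t].

Let y_ (x : 'rV[F]_n) c := lam c (x 0 c).

Lemma plane_affine x i j p : x \in C -> info i -> info j -> i != j -> ~~ info p ->
  exists al be ga, forall y, y \in C -> in_plane i j x y ->
    y_ y p = al * y_ y i + be * y_ y j + ga.
Proof.
move=> xC ii ij nij ip; have [l [m [t R]]] := rel_plane_ex xC ii ij nij ip.
have [[a [b [a0 lE]]] [a' [b' [a0' mE]]] [a2 [b2 [a20 tE]]]] := lamP xC ii ij nij ip R.
case: R => _ _ _ E; exists (a / a2), (a' / a2), ((b + b' - b2) / a2) => y yC yx.
apply: (mulfI a20); apply: (addIr b2); rewrite -tE -E // lE mE /y_.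
by field.
Qed.

(** Moving the base word in a direction [m] other than [i] stays in a plane of [i] and [m]; there
    the parity label is affine, so its slope along [i] does not change. *)
Lemma constant_slope p i : ~~ info p -> info i -> exists s, forall x y, x \in C -> y \in C ->
  off i y x -> y_ y p - y_ x p = s * (y_ y i - y_ x i).
Proof.
move=> ip ii; have [x0 x0C _] := info_ex (fun=> 0).
have [j ij /andP[nij _]] := other_info i i.
have [s [be [ga E0]]] := plane_affine x0C ii ij nij ip.
exists s => x y xC; move: x xC y; apply: (info_ind x0C) => [y yC yx|].
  have pl z : off i z x0 -> in_plane i j x0 z by move=> zx c ic ni _; apply: zx.
  rewrite (E0 y yC (pl _ yx)) (E0 x0 x0C (pl _ _)) //.
  have -> : y_ y j = y_ x0 j by rewrite /y_ yx // eq_sym.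
  by ring.
move=> x z m xC zC im xz zm IH y yC yx.
have [eim|nim] := eqVneq i m.
  subst m; have Ex := IH x xC xz.
  have zy : off i y z by move=> c ic nc; rewrite yx // xz.
  have Ey := IH y yC zy.
  have -> : y_ y p - y_ x p = (y_ y p - y_ z p) - (y_ x p - y_ z p) by ring.
  by rewrite Ex Ey; ring.
have [al [be' [ga' E]]] := plane_affine xC ii im nim ip.
have [y' [yC' yi yz]] := info_set (y 0 i) zC ii.
have pz : in_plane i m x z by move=> c ic _ nc; rewrite xz.
have py : in_plane i m x y by move=> c ic ni _; rewrite yx.
have py' : in_plane i m x y' by move=> c ic ni nc; rewrite yz // pz.
have zi : y_ z i = y_ x i by rewrite /y_ xz.
have yi' : y_ y' i = y_ y i by rewrite /y_ yi.
have ymx : y_ y m = y_ x m by rewrite /y_ yx // eq_sym.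
have ymz : y_ y' m = y_ z m by rewrite /y_ yz // eq_sym.
have := IH y' yC' yz; rewrite yi' zi => <-.
rewrite (E y yC py) (E x xC) // (E y' yC' py') (E z zC pz) ymx ymz zi yi'.
by ring.
Qed.

(** Each change of a single information symbol on the way to [x0] contributes one summand. *)
Lemma parity_affine p x0 : ~~ info p -> x0 \in C -> exists s : 'I_n -> F, forall x, x \in C ->
  y_ x p - y_ x0 p = \sum_(i | info i) s i * (y_ x i - y_ x0 i).
Proof.
move=> ip x0C.
have ex i : exists s, info i -> forall x y, x \in C -> y \in C ->
    off i y x -> y_ y p - y_ x p = s * (y_ y i - y_ x i).
  have [ii|ni] := boolP (info i); last by exists 0.
  by have [s sP] := constant_slope ip ii; exists s.
have [s sP] := fin_all_exists ex; exists s; apply: (info_ind x0C).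
  by rewrite subrr big1 // => i _; rewrite subrr mulr0.
move=> x z m xC zC im xz zm IH.
rewrite (bigD1 m) //= in IH; rewrite (bigD1 m) //=; have zmE : y_ z m = y_ x0 m by rewrite /y_ zm.
have -> : y_ x p - y_ x0 p = (y_ x p - y_ z p) + (y_ z p - y_ x0 p) by ring.
rewrite IH (sP m im z x zC xC xz) zmE subrr mulr0 add0r; congr (_ + _).
by apply: eq_bigr => i /andP[ii ni]; rewrite /y_ xz.
Qed.

Lemma labelled_linear : exists D : {set 'rV[F]_n}, linear_code D /\ code_equiv C D.
Proof.
have [x0 x0C _] := info_ex (fun=> 0).
(* Labels are shifted so that [x0] becomes the zero word. *)
have g_inj c : injective (fun a => lam c a - lam c (x0 0 c)).
  by move=> a b /addIr /lam_inj.
pose pi c := perm (g_inj c).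
pose phi (x : 'rV[F]_n) := \row_j pi j (x 0 j).
have phiE x j : phi x 0 j = y_ x j - y_ x0 j by rewrite mxE permE.
exists (phi @: C); split; last first.
  exists 1%g, pi; apply: eq_imset => x; apply/rowP => j.
  by rewrite !mxE perm1.
split.
  by apply/imsetP; exists x0 => //; apply/rowP => j; rewrite phiE subrr mxE.
move=> a _ _ /imsetP[x xC ->] /imsetP[y yC ->].
(* The codeword whose relabelled information symbols are those of the combination; [parity_affine]
   makes its parity symbols agree as well. *)
have [w wC wE] := info_ex (fun j => (pi j)^-1%g (a * phi x 0 j + phi y 0 j)).
have iw j : info j -> y_ w j - y_ x0 j = a * phi x 0 j + phi y 0 j.
  by move=> ij; rewrite -phiE mxE wE // permKV.
apply/imsetP; exists w => //; apply/rowP => p.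
have -> : (a *: phi x + phi y) 0 p = a * phi x 0 p + phi y 0 p by rewrite !mxE.
have [ip|ip] := boolP (info p); first by rewrite [RHS]phiE iw.
have [s sP] := parity_affine ip x0C.
rewrite !phiE !sP // mulr_sumr -big_split /=; apply: eq_bigr => i ii.
by rewrite iw // !phiE; ring.
Qed.
End Labelled.

Lemma code_linear : exists D : {set 'rV[F]_n}, linear_code D /\ code_equiv C D.
Proof. by have [lam [lam_inj lamP]] := global_labels; apply: labelled_linear lamP. Qed.
End Gluing.

Lemma hdist_agree (F : finFieldType) n (x y : 'rV[F]_n) (J : {set 'I_n}) :
  (forall j, j \in J -> x 0%R j = y 0%R j) -> hdist x y <= n - #|J|.
Proof.
move=> E; have -> : n - #|J| = #|~: J| by rewrite [RHS]cardsCs setCK card_ord.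
apply: subset_leq_card; apply/subsetP => j; rewrite !inE.
by apply: contraNN => /E ->.
Qed.

Theorem theorem4 (q k d : nat) (hq : q = 5 \/ q = 7) (hk : (3 <= k)%N) (hd : (3 <= d)%N)
  (C : {set 'rV['F_q]_(k + d - 1)}) :
  is_code (k + d - 1) (q ^ k) d C ->
  exists D : {set 'rV['F_q]_(k + d - 1)}, linear_code D /\ code_equiv C D.
Proof.
case=> cardC [_ minC].
have qpr : prime q by case: hq => ->.
have kn : k.+1 < k + d - 1.
  by rewrite -addnBA ?(ltnW (ltnW hd)) // -[k.+1]addn1 ltn_add2l ltn_subRL.
apply: (code_linear qpr hk kn _ cardC).
  by move=> X a b; case: hq => ->; [apply: cube_labels5 | apply: cube_labels7].
(* Words agreeing in [k] of the [k + d - 1] positions have distance at most [d - 1]. *)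
move=> J x y cJ xC yC E; apply/eqP; apply/negPn/negP => ne.
have := leq_trans (minC x y xC yC ne) (hdist_agree E).
rewrite cJ -addnBA ?(ltnW (ltnW hd)) // addKn leqNgt ltn_subrL.
by rewrite (ltnW (ltnW hd)).
Qed.
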